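(* Let $\mathcal X,\mathcal Z$ be complex Hilbert spaces and let $(E,AQ)$ be a port-Hamiltonian differential-algebraic equation (pH-DAE), where $E,Q\in L(\mathcal X,\mathcal Z)$ and $A\colon\mathcal D(A)\subseteq\mathcal Z\to\mathcal Z$. Assume that the radiality index of $(E,AQ)$ exists and that $\mathbb C_{\mathrm{Re}\ge\omega}\subseteq\rho(E,AQ)$ for some $\omega>0$. Let $\mathcal X^1,\mathcal Z^1,E_1,(AQ)_1$ be as defined in the context, and let $p=p_{\mathrm{c,res}}^{(E,AQ)}$ be the complex resolvent index of $(E,AQ)$. Then $(AQ)_1E_1^{-1}$ (on $\mathcal Z^1$) and $E_1^{-1}(AQ)_1$ (on $\mathcal X^1$) generate an (at least) $(p+2)$-times integrated semigroup. Moreover: a) if additionally $Q^*(\mathcal Z^1)=\mathcal X^1$, then $E_1^{-1}(AQ)_1$ generates a $C_0$-semigroup on $\mathcal X^1$; b) if additionally $Q(\mathcal X^1)=\mathcal Z^1$, then $(AQ)_1E_1^{-1}$ generates a $C_0$-semigroup on $\mathcal Z^1$.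
   Context: $L(\mathcal X,\mathcal Z)$ denotes the bounded linear operators from $\mathcal X$ to $\mathcal Z$; $\mathbb N=\{0,1,2,\dots\}$; $\mathbb C_{\mathrm{Re}>\omega}$ and $\mathbb C_{\mathrm{Re}\ge\omega}$ are the sets of $\lambda\in\mathbb C$ with $\operatorname{Re}\lambda>\omega$, resp. $\operatorname{Re}\lambda\ge\omega$. $(E,AQ)$ is a pH-DAE if: $E,Q\in L(\mathcal X,\mathcal Z)$; $A\colon\mathcal D(A)\subseteq\mathcal Z\to\mathcal Z$ is closed, densely defined and dissipative ($\operatorname{Re}\langle Az,z\rangle\le0$ for all $z\in\mathcal D(A)$); $\operatorname{ran}E$ is closed; $Q$ is (boundedly) invertible; and $E^*Q=Q^*E\ge0$, i.e. $\langle E^*Qx,x\rangle\ge0$ for all $x\in\mathcal X$. Put $B=AQ$ with $\mathcal D(B)=\{x\in\mathcal X:Qx\in\mathcal D(A)\}$ and $\rho(E,B)=\{\lambda\in\mathbb C:(\lambda E-B)^{-1}\in L(\mathcal Z,\mathcal X)\}$. Complex resolvent index: the smallest $p\in\mathbb N$ such that there exist $\omega'\in\mathbb R$, $C>0$ with $\mathbb C_{\mathrm{Re}>\omega'}\subseteq\rho(E,B)$ and $\|(\lambda E-B)^{-1}\|\le C|\lambda|^{p-1}$ for all $\lambda\in\mathbb C_{\mathrm{Re}>\omega'}$; under the stated hypotheses it exists (and is at most $3$). Radiality index: $(E,B)$ has a radiality index $q\in\mathbb N$ if there exist $\omega_0,C>0$ with $(\omega_0,\infty)\subseteq\rho(E,B)$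 and, for all $\lambda_0,\dots,\lambda_q\in(\omega_0,\infty)$, $$\Big\|(\lambda_0E-B)^{-1}E\cdots(\lambda_qE-B)^{-1}E\Big\|\le\frac{C}{\prod_{k=0}^q|\lambda_k-\omega_0|},\qquad \Big\|E(\lambda_0E-B)^{-1}\cdots E(\lambda_qE-B)^{-1}\Big\|\le\frac{C}{\prod_{k=0}^q|\lambda_k-\omega_0|}.$$ Subspaces and restrictions: with such $q,\omega_0$ and arbitrary $\lambda_0,\dots,\lambda_q\in(\omega_0,\infty)$ put $\mathcal X^1=\overline{\operatorname{ran}\big((\lambda_0E-B)^{-1}E\cdots(\lambda_qE-B)^{-1}E\big)}$ (closure in $\mathcal X$) and $\mathcal Z^1=\overline{\operatorname{ran}\big(E(\lambda_0E-B)^{-1}\cdots E(\lambda_qE-B)^{-1}\big)}$ (closure in $\mathcal Z$); these do not depend on the choice of the $\lambda_i$. Put $E_1=E|_{\mathcal X^1}\colon\mathcal X^1\to\mathcal Z^1$ and $(AQ)_1=AQ|_{\mathcal D(AQ)\cap\mathcal X^1}\colon\mathcal D(AQ)\cap\mathcal X^1\subseteq\mathcal X^1\to\mathcal Z^1$. Under the hypotheses these are well defined and $E_1$ is boundedly invertible; $(AQ)_1E_1^{-1}$ and $E_1^{-1}(AQ)_1$ carry their natural domains. Integrated semigroup: for an integer $n\ge1$, a linear operator $G$ on a Banach space $\mathcal W$ generates an $(n-1)$-times integrated semigroup $(S(t))_{t\ge0}$ if there exist $M,\omega>0$ and a strongly continuous family $(S(t))_{t\ge0}$ in $L(\mathcal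 W)$ with $\|S(t)\|\le Me^{\omega t}$ for all $t\ge0$, $(\omega,\infty)\subseteq\rho(G)$ and $(\lambda I-G)^{-1}w=\lambda^{n-1}\int_0^\infty e^{-\lambda t}S(t)w\,dt$ for all $w\in\mathcal W$, $\lambda>\omega$. *)

(* Defs.v *)
(* Classical real analysis over Stdlib's R with Coquelicot.  A complex Banach
   space is a [CompleteNormedModule C_AbsRing]; Coquelicot's [is_linear] means
   linear and bounded. *)
From Stdlib Require Import Reals Lra ZArith ClassicalEpsilon.
From Stdlib Require Import FunctionalExtensionality PropExtensionality ProofIrrelevance.
From Coquelicot Require Import Coquelicot.
Set Implicit Arguments.
Unset Strict Implicit.
Open Scope R_scope.

Notation Normed := (NormedModule C_AbsRing).
Notation Banach := (CompleteNormedModule C_AbsRing).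

(* The inner product is linear in its first argument.  Positivity and
   definiteness follow from [inner_norm] and the axioms of a norm. *)
Record Hilbert := {
  hilbert_banach :> Banach;
  inner : hilbert_banach -> hilbert_banach -> C;
  inner_plus : forall x y z, inner (plus x y) z = Cplus (inner x z) (inner y z);
  inner_scal : forall a x z, inner (scal a x) z = Cmult a (inner x z);
  inner_conj : forall x z, inner z x = Cconj (inner x z);
  inner_norm : forall x, inner x x = RtoC (norm x ^ 2)
}.

Arguments inner {_} _ _.

Record BoundedOp (X Z : Normed) := {
  bop_fun :> X -> Z;
  bop_linear : is_linear bop_fun
}.

Definition zero_op (X Z : Normed) : BoundedOp X Z :=
  Build_BoundedOp (is_linear_zero (U := X) (V := Z)).

Definition id_op (X : Normed) : BoundedOp X X :=
  Build_BoundedOp (is_linear_id (V := X)).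

Definition comp_op (X Y Z : Normed) (T : BoundedOp Y Z) (S : BoundedOp X Y) :
  BoundedOp X Z :=
  Build_BoundedOp (is_linear_comp S T (bop_linear S) (bop_linear T)).

Fixpoint prod_op (X : Normed) (F : nat -> BoundedOp X X) (n : nat) :
  BoundedOp X X :=
  match n with
  | O => F O
  | S m => comp_op (prod_op F m) (F (S m))
  end.

(* ||T|| <= K, for K >= 0 *)
Definition opnorm_le (X Z : Normed) (T : BoundedOp X Z) (K : R) : Prop :=
  forall x, norm (T x) <= K * norm x.

Definition is_adjoint (X Z : Hilbert) (T : BoundedOp X Z) (T' : BoundedOp Z X) :
  Prop :=
  forall x z, inner (T x) z = inner x (T' z).

(* A T' as above exists and is unique by the Riesz representation theorem. *)
Definition adjoint (X Z : Hilbert) (T : BoundedOp X Z) : BoundedOp Z X :=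
  epsilon (inhabits (zero_op Z X)) (@is_adjoint X Z T).

Definition boundedly_invertible (X Z : Normed) (T : BoundedOp X Z) : Prop :=
  exists T' : BoundedOp Z X, (forall x, T' (T x) = x) /\ (forall z, T (T' z) = z).

(* A possibly unbounded operator is given by its graph:  [G x z] means that x
   is in the domain of G and G x = z. *)
Definition Graph (X Z : Type) := X -> Z -> Prop.

Definition dom (X Z : Type) (G : Graph X Z) : X -> Prop :=
  fun x => exists z, G x z.

Definition inv_graph (X Z : Type) (G : Graph X Z) : Graph Z X :=
  fun z x => G x z.

(* [comp_graph H G] is H o G with its natural domain. *)
Definition comp_graph (X Y Z : Type) (H : Graph Y Z) (G : Graph X Y) :
  Graph X Z :=
  fun x z => exists y, G x y /\ H y z.

Record linear_operator (X Z : Normed) (G : Graph X Z) : Prop := {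
  graph_fun : forall x z z', G x z -> G x z' -> z = z';
  graph_zero : G zero zero;
  graph_plus : forall x y z w, G x z -> G y w -> G (plus x y) (plus z w);
  graph_scal : forall a x z, G x z -> G (scal a x) (scal a z)
}.

Definition closure (T : UniformSpace) (D : T -> Prop) : T -> Prop :=
  fun x => forall eps : posreal, exists y, D y /\ ball x eps y.

Definition ran (X Z : Type) (f : X -> Z) : Z -> Prop :=
  fun z => exists x, f x = z.

Definition closed_operator (X Z : Normed) (G : Graph X Z) : Prop :=
  closed (T := prod_UniformSpace X Z) (fun p => G (fst p) (snd p)).

Definition densely_defined (X Z : Normed) (G : Graph X Z) : Prop :=
  forall x : X, closure (T := X) (dom G) x.

Definition dissipative (Z : Hilbert) (A : Graph Z Z) : Prop :=
  forall z w, A z w -> Re (inner w z) <= 0.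

Definition pencil (X Z : Normed) (E : BoundedOp X Z) (B : Graph X Z) (lam : C) :
  Graph X Z :=
  fun x z => exists y, B x y /\ z = minus (scal lam (E x)) y.

(* T is an everywhere defined bounded inverse of lam E - B. *)
Definition is_resolvent (X Z : Normed) (E : BoundedOp X Z) (B : Graph X Z)
  (lam : C) (T : BoundedOp Z X) : Prop :=
  forall z x, inv_graph (pencil E B lam) z x <-> T z = x.

Definition rho (X Z : Normed) (E : BoundedOp X Z) (B : Graph X Z) : C -> Prop :=
  fun lam => exists T, is_resolvent E B lam T.

(* (lam E - B)^-1, meaningful for lam in [rho E B] *)
Definition resolvent (X Z : Normed) (E : BoundedOp X Z) (B : Graph X Z)
  (lam : C) : BoundedOp Z X :=
  epsilon (inhabits (zero_op Z X)) (is_resolvent E B lam).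

Record pHDAE (X Z : Hilbert) (E : BoundedOp X Z) (A : Graph Z Z)
  (Q : BoundedOp X Z) : Prop := {
  ph_linear : linear_operator A;
  ph_closed : closed_operator A;
  ph_dense : densely_defined A;
  ph_dissipative : dissipative A;
  ph_ran_closed : closed (T := Z) (ran E);
  ph_Q_invertible : boundedly_invertible Q;
  ph_symmetric : forall x, adjoint E (Q x) = adjoint Q (E x);
  ph_nonneg : forall x,
    Im (inner (adjoint E (Q x)) x) = 0 /\ 0 <= Re (inner (adjoint E (Q x)) x)
}.

Definition graph_AQ (X Z : Normed) (A : Graph Z Z) (Q : BoundedOp X Z) :
  Graph X Z :=
  fun x z => A (Q x) z.

(* The integer exponent p - 1 is -1 for p = 0; the value of [powerRZ] at the
   base 0 is irrelevant, since w' can be increased. *)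
Definition complex_resolvent_bound (X Z : Normed) (E : BoundedOp X Z)
  (B : Graph X Z) (p : nat) : Prop :=
  exists w' K : R, 0 < K /\
    forall lam : C, w' < Re lam ->
      rho E B lam /\
      opnorm_le (resolvent E B lam)
        (K * powerRZ (Cmod lam) (Z.of_nat p - 1)).

Definition is_complex_resolvent_index (X Z : Normed) (E : BoundedOp X Z)
  (B : Graph X Z) (p : nat) : Prop :=
  complex_resolvent_bound E B p /\
  forall p', complex_resolvent_bound E B p' -> (p <= p')%nat.

Definition right_prod (X Z : Normed) (E : BoundedOp X Z) (B : Graph X Z)
  (lam : nat -> R) (q : nat) : BoundedOp X X :=
  prod_op (fun k => comp_op (resolvent E B (RtoC (lam k))) E) q.

Definition left_prod (X Z : Normed) (E : BoundedOp X Z) (B : Graph X Z)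
  (lam : nat -> R) (q : nat) : BoundedOp Z Z :=
  prod_op (fun k => comp_op E (resolvent E B (RtoC (lam k)))) q.

Definition radial (X Z : Normed) (E : BoundedOp X Z) (B : Graph X Z) (q : nat)
  (w0 : R) : Prop :=
  0 < w0 /\
  (forall l : R, w0 < l -> rho E B (RtoC l)) /\
  exists K : R, 0 < K /\
    forall lam : nat -> R, (forall k, (k <= q)%nat -> w0 < lam k) ->
      opnorm_le (right_prod E B lam q)
        (K / prod_f_R0 (fun k => Rabs (lam k - w0)) q) /\
      opnorm_le (left_prod E B lam q)
        (K / prod_f_R0 (fun k => Rabs (lam k - w0)) q).

Record ClosedSubspace (W : Banach) := {
  subspace_mem :> W -> Prop;
  subspace_zero : subspace_mem zero;
  subspace_plus : forall x y,
    subspace_mem x -> subspace_mem y -> subspace_mem (plus x y);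
  subspace_scal : forall (a : C) x, subspace_mem x -> subspace_mem (scal a x);
  subspace_closed : closed (T := W) subspace_mem
}.

Section SubBanach.

Variables (W : Banach) (V : ClosedSubspace W).

Definition sub_car := {x : W | V x}.

Lemma sub_eq (x y : sub_car) : proj1_sig x = proj1_sig y -> x = y.
Proof.
destruct x as [x Hx], y as [y Hy]; simpl; intros ->.
f_equal; apply proof_irrelevance.
Qed.

Lemma subspace_opp (x : W) : V x -> V (opp x).
Proof.
intros Hx; replace (opp x) with (scal (opp one : C_AbsRing) x).
- now apply subspace_scal.
- apply (scal_opp_one (V := W)).
Qed.

Definition sub_plus (x y : sub_car) : sub_car :=
  exist _ (plus (proj1_sig x) (proj1_sig y))
    (subspace_plus (proj2_sig x) (proj2_sig y)).
Definition sub_opp (x : sub_car) : sub_car :=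
  exist _ (opp (proj1_sig x)) (subspace_opp (proj2_sig x)).
Definition sub_zero : sub_car := exist _ zero (subspace_zero V).
Definition sub_scal (a : C) (x : sub_car) : sub_car :=
  exist _ (scal a (proj1_sig x)) (subspace_scal a (proj2_sig x)).

Definition sub_AbelianMonoid_mixin : AbelianMonoid.mixin_of sub_car.
Proof.
apply (AbelianMonoid.Mixin sub_car sub_plus sub_zero);
  intros; apply sub_eq; simpl.
- apply plus_comm.
- apply plus_assoc.
- apply plus_zero_r.
Defined.

Definition sub_AbelianMonoid :=
  AbelianMonoid.Pack sub_car sub_AbelianMonoid_mixin sub_car.

Definition sub_AbelianGroup_mixin : AbelianGroup.mixin_of sub_AbelianMonoid.
Proof.
apply (AbelianGroup.Mixin sub_AbelianMonoid sub_opp).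
intros; apply sub_eq; simpl.
apply (plus_opp_r (G := CompleteNormedModule.AbelianGroup _ W)).
Defined.

Definition sub_AbelianGroup :=
  AbelianGroup.Pack sub_car (AbelianGroup.Class _ _ sub_AbelianGroup_mixin)
    sub_car.

Definition sub_ModuleSpace_mixin :
  ModuleSpace.mixin_of C_AbsRing sub_AbelianGroup.
Proof.
apply (ModuleSpace.Mixin C_AbsRing sub_AbelianGroup sub_scal);
  intros; apply sub_eq; simpl.
- apply scal_assoc.
- apply (scal_one (V := W)).
- apply (scal_distr_l (V := W)).
- apply (scal_distr_r (V := W)).
Defined.

Definition sub_UniformSpace_mixin : UniformSpace.mixin_of sub_car.
Proof.
apply (UniformSpace.Mixin sub_car sub_zero
         (fun x e y => ball (proj1_sig x) e (proj1_sig y))).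
- intros; apply ball_center.
- intros; now apply ball_sym.
- intros; eapply ball_triangle; eassumption.
Defined.

Definition sub_UniformSpace :=
  UniformSpace.Pack sub_car sub_UniformSpace_mixin sub_car.

Definition sub_NormedModuleAux :=
  NormedModuleAux.Pack C_AbsRing sub_car
    (NormedModuleAux.Class C_AbsRing sub_car
       (ModuleSpace.Class C_AbsRing sub_car _ sub_ModuleSpace_mixin)
       sub_UniformSpace_mixin) sub_car.

Definition sub_NormedModule_mixin :
  NormedModule.mixin_of C_AbsRing sub_NormedModuleAux.
Proof.
apply (NormedModule.Mixin C_AbsRing sub_NormedModuleAux
         (fun x : sub_car => norm (proj1_sig x)) (norm_factor (V := W))).
- intros; apply (norm_triangle (V := W)).
- intros; apply (norm_scal (V := W)).
- intros x y eps; apply (norm_compat1 (V := W)).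
- intros x y eps; apply (norm_compat2 (V := W)).
- intros x Hx; apply sub_eq; now apply (norm_eq_zero (V := W)).
Defined.

Definition sub_lim (F : (sub_car -> Prop) -> Prop) : sub_car :=
  epsilon (inhabits sub_zero)
    (fun x => forall eps : posreal, F (ball (M := sub_UniformSpace) x eps)).

Definition sub_CompleteSpace_mixin : CompleteSpace.mixin_of sub_UniformSpace.
Proof.
apply (CompleteSpace.Mixin sub_UniformSpace sub_lim).
- intros F PF cF.
  apply (epsilon_spec (inhabits sub_zero)
    (fun x => forall eps : posreal, F (ball (M := sub_UniformSpace) x eps))).
  set (G := filtermap (fun x : sub_car => proj1_sig x) F).
  assert (PG : ProperFilter G) by (apply filtermap_proper_filter; exact PF).
  assert (HG : forall eps : posreal, G (ball (lim (T := W) G) eps)).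
  { apply complete_cauchy; [exact PG |].
    intros eps; destruct (cF eps) as [x Hx].
    exists (proj1_sig x); exact Hx. }
  assert (HV : V (lim (T := W) G)).
  { apply subspace_closed; intros [eps Heps].
    destruct (filter_ex (F := F) _ (HG eps)) as [x Hx].
    apply (Heps (proj1_sig x) Hx); exact (proj2_sig x). }
  exists (exist _ _ HV); exact HG.
- intros F1 F2 H12 H21.
  replace F2 with F1.
  + intros eps; apply ball_center.
  + apply functional_extensionality; intros P.
    apply propositional_extensionality; split; auto.
Defined.

Definition sub_Banach : Banach :=
  CompleteNormedModule.Pack C_AbsRing sub_car
    (CompleteNormedModule.Class C_AbsRing sub_car
       (NormedModule.Class C_AbsRing sub_car _ sub_NormedModule_mixin)
       sub_CompleteSpace_mixin) sub_car.

End SubBanach.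

Coercion sub_Banach : ClosedSubspace >-> CompleteNormedModule.type.

Definition embed (W : Banach) (V : ClosedSubspace W) (x : V) : W :=
  @proj1_sig W V x.

Lemma minus_plus_plus (G : AbelianGroup) (a b x y : G) :
  minus (plus a b) (plus x y) = plus (minus a x) (minus b y).
Proof.
unfold minus; rewrite opp_plus, <- !plus_assoc; f_equal.
rewrite !plus_assoc; f_equal; apply plus_comm.
Qed.

Section ClosureRan.

Variables (X Z : Banach) (T : BoundedOp X Z).

Let N := closure (T := Z) (ran T).

Lemma closure_ranP (z : Z) :
  N z <-> forall eps : posreal, exists x, norm (minus (T x) z) < eps.
Proof.
split; intros H eps.
- assert (Hd : 0 < eps / norm_factor (V := Z)).
  { apply Rdiv_lt_0_compat; [apply cond_pos | apply norm_factor_gt_0]. }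
  destruct (H (mkposreal _ Hd)) as [y [[x <-] Hx]].
  exists x; apply (norm_compat2 (V := Z)) in Hx; simpl in Hx.
  eapply Rlt_le_trans; [exact Hx |]; right; field.
  apply Rgt_not_eq, norm_factor_gt_0.
- destruct (H eps) as [x Hx].
  exists (T x); split; [now exists x | now apply (norm_compat1 (V := Z))].
Qed.

Lemma closure_ran_zero : N zero.
Proof.
apply closure_ranP; intros eps; exists zero.
rewrite (linear_zero T (bop_linear T)), minus_eq_zero.
apply Rle_lt_trans with 0; [right; apply (norm_zero (V := Z)) | apply cond_pos].
Qed.

Lemma closure_ran_plus (x y : Z) : N x -> N y -> N (plus x y).
Proof.
rewrite !closure_ranP; intros Hx Hy eps.
destruct (Hx (pos_div_2 eps)) as [u Hu], (Hy (pos_div_2 eps)) as [v Hv].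
exists (plus u v); rewrite (linear_plus T (bop_linear T)).
replace (minus (plus (T u) (T v)) (plus x y))
  with (plus (minus (T u) x) (minus (T v) y)).
- eapply Rle_lt_trans; [apply (norm_triangle (V := Z)) |].
  simpl in Hu, Hv; lra.
- symmetry; apply (minus_plus_plus (G := CompleteNormedModule.AbelianGroup _ Z)).
Qed.

Lemma closure_ran_scal (a : C) (x : Z) : N x -> N (scal a x).
Proof.
rewrite !closure_ranP; intros Hx eps.
assert (Ha : 0 < Cmod a + 1) by (generalize (Cmod_ge_0 a); lra).
assert (Hd : 0 < eps / (Cmod a + 1)).
{ apply Rdiv_lt_0_compat; [apply cond_pos | exact Ha]. }
destruct (Hx (mkposreal _ Hd)) as [u Hu]; simpl in Hu.
exists (scal a u); rewrite (linear_scal T (bop_linear T)).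
apply Rle_lt_trans with (Cmod a * norm (minus (T u) x)).
{ eapply Rle_trans; [right | apply (norm_scal (V := Z))].
  f_equal; symmetry; apply (scal_minus_distr_l (V := Z)). }
apply Rle_lt_trans with ((Cmod a + 1) * norm (minus (T u) x)).
- apply Rmult_le_compat_r; [apply (norm_ge_0 (V := Z)) | lra].
- apply Rlt_le_trans with ((Cmod a + 1) * (eps / (Cmod a + 1))).
  + now apply Rmult_lt_compat_l.
  + right; field; lra.
Qed.

Lemma closure_ran_closed : closed (T := Z) N.
Proof.
intros z Hz eps.
apply NNPP; intros Hn; apply Hz.
exists (pos_div_2 eps); intros y Hy Ny.
destruct (Ny (pos_div_2 eps)) as [w [Hw Hyw]].
apply Hn; exists w; split; [exact Hw |].
replace (pos eps) with (pos (pos_div_2 eps) + pos (pos_div_2 eps))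
  by (simpl; lra).
eapply ball_triangle; eassumption.
Qed.

Definition closure_ran : ClosedSubspace Z :=
  Build_ClosedSubspace closure_ran_zero closure_ran_plus closure_ran_scal
    closure_ran_closed.

End ClosureRan.

Definition space_X1 (X Z : Banach) (E : BoundedOp X Z) (B : Graph X Z)
  (lam : nat -> R) (q : nat) : ClosedSubspace X :=
  closure_ran (right_prod E B lam q).

Definition space_Z1 (X Z : Banach) (E : BoundedOp X Z) (B : Graph X Z)
  (lam : nat -> R) (q : nat) : ClosedSubspace Z :=
  closure_ran (left_prod E B lam q).

(* When G maps X1 (intersected with its domain) into Z1, this is the restriction
   of G to X1, with values in Z1. *)
Definition restrict_graph (X Z : Banach) (X1 : ClosedSubspace X)
  (Z1 : ClosedSubspace Z) (G : Graph X Z) : Graph X1 Z1 :=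
  fun x z => G (embed x) (embed z).

Arguments restrict_graph {X Z} X1 Z1 G x z.

Definition graph_of (X Z : Type) (f : X -> Z) : Graph X Z := fun x z => f x = z.

Section RealBanach.

Variable W : Banach.

Definition real_ModuleSpace_mixin :
  ModuleSpace.mixin_of R_AbsRing (CompleteNormedModule.AbelianGroup _ W).
Proof.
apply (ModuleSpace.Mixin R_AbsRing (CompleteNormedModule.AbelianGroup _ W)
         (fun (r : R) (x : W) => scal (RtoC r) x)).
- intros x y u; rewrite (scal_assoc (V := W)); f_equal.
  symmetry; apply RtoC_mult.
- intros u; apply (scal_one (V := W)).
- intros x u v; apply (scal_distr_l (V := W)).
- intros x y u.
  replace (RtoC (plus x y)) with (plus (RtoC x : C_AbsRing) (RtoC y))
    by (symmetry; apply RtoC_plus).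
  apply (scal_distr_r (V := W)).
Defined.

Definition real_NormedModuleAux :=
  NormedModuleAux.Pack R_AbsRing W
    (NormedModuleAux.Class R_AbsRing W
       (ModuleSpace.Class R_AbsRing W _ real_ModuleSpace_mixin)
       (UniformSpace.class (CompleteNormedModule.UniformSpace _ W))) W.

Definition real_NormedModule_mixin :
  NormedModule.mixin_of R_AbsRing real_NormedModuleAux.
Proof.
apply (NormedModule.Mixin R_AbsRing real_NormedModuleAux
         (fun x : W => norm x) (norm_factor (V := W))).
- intros; apply (norm_triangle (V := W)).
- intros l x; change (abs l) with (Rabs l); rewrite <- Cmod_R.
  apply (norm_scal (V := W)).
- intros x y eps; apply (norm_compat1 (V := W)).
- intros x y eps; apply (norm_compat2 (V := W)).
- intros x; apply (norm_eq_zero (V := W)).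
Defined.

(* W regarded as a real Banach space, as required by Coquelicot's integral *)
Definition real_Banach : CompleteNormedModule R_AbsRing :=
  CompleteNormedModule.Pack R_AbsRing W
    (CompleteNormedModule.Class R_AbsRing W
       (NormedModule.Class R_AbsRing W _ real_NormedModule_mixin)
       (CompleteSpace.mixin _
          (CompleteSpace.class (CompleteNormedModule.CompleteSpace _ W)))) W.

Definition is_integral_0_infty (f : R -> W) (v : W) : Prop :=
  is_RInt_gen (V := real_Banach) f (at_point 0) (Rbar_locally p_infty) v.

(* Families (S(t))_{t >= 0} are functions on R whose values at t < 0 play no
   role. *)
Definition strongly_continuous (S : R -> BoundedOp W W) : Prop :=
  forall (w : W) (t : R), 0 <= t ->
    filterlim (fun s => S s w) (within (fun s => 0 <= s) (locally t))
      (locally (S t w)).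

(* G generates a k-times integrated semigroup; k = n - 1 with n >= 1. *)
Definition generates_integrated_semigroup (k : nat) (G : Graph W W) : Prop :=
  linear_operator G /\
  exists (S : R -> BoundedOp W W) (M w0 : R),
    0 < M /\ 0 < w0 /\
    strongly_continuous S /\
    (forall t, 0 <= t -> opnorm_le (S t) (M * exp (w0 * t))) /\
    (forall l : R, w0 < l ->
       rho (id_op W) G (RtoC l) /\
       forall w : W, exists v : W,
         is_integral_0_infty
           (fun t => scal (RtoC (exp (- l * t))) (S t w)) v /\
         resolvent (id_op W) G (RtoC l) w = scal (RtoC (l ^ k)) v).

Definition generates_C0_semigroup (G : Graph W W) : Prop :=
  exists T : R -> BoundedOp W W,
    (forall x, T 0 x = x) /\
    (forall s t, 0 <= s -> 0 <= t -> forall x, T (s + t) x = T s (T t x)) /\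
    strongly_continuous T /\
    (forall x y : W, G x y <->
       filterlim (fun t => scal (RtoC (/ t)) (minus (T t x) x)) (at_right 0)
         (locally y)).

End RealBanach.

(* Main.v *)
(* On X1 the form <Ex, Qy> is an inner product equivalent to the original one.
   It is bounded below there because radiality gives |x| <= K |x + k| for x in X1
   and k in ker E, while E^*Q has closed range.  The dissipativity of A says that
   E_1^{-1}(AQ)_1 is dissipative for this form, so that it generates a bounded
   C0-semigroup, obtained as a limit of backward Euler schemes; (AQ)_1 E_1^{-1} is
   similar to it through E_1.  The iterated integrals of these semigroups are the
   integrated semigroups. *)
Require Import Defs.
From Stdlib Require Import Reals Lra Lia ZArith List Classical ClassicalEpsilon.
From Coquelicot Require Import Coquelicot.

(* The structures are fixed in these notations: inference would give different
   instances according to the shape of the arguments, and [rewrite] and [lra]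
   tell them apart. *)
Notation "x +v y" := (@plus (NormedModule.AbelianMonoid C_AbsRing _) x y)
  (at level 50, left associativity).
Notation "x -v y" := (@minus (NormedModule.AbelianGroup C_AbsRing _) x y)
  (at level 50, left associativity).
Notation "c *c x" := (@scal C_Ring (NormedModule.ModuleSpace C_AbsRing _) c x)
  (at level 40, left associativity).
Notation "r *v x" := (RtoC r *c x) (at level 40, left associativity).
Notation vzero := (@zero (NormedModule.AbelianMonoid C_AbsRing _)).

(** The form <Ex, Qy> is only semidefinite on X; the crux is its coercivity on X1. Write P(l) = (lE
    - B)^-1 E and m = w0 + 1. Radiality bounds ((l - m) P(l))^(q+1) by K for all l > m. These
    operators annihilate ker E and, by the resolvent identity, tend strongly to the identity on X1
    as l grows: this separates X1 from ker E with the constant K. As E^*Q is selfadjoint with closed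
    range, every x has a k in ker E with |x + k| <= c |E^*Q x|; together, |x| <= cK |E^*Q x| on X1.
    In particular E is bounded below on X1, so that its range there, dense in Z1, is all of Z1. A
    bound on single resolvents would not suffice for generation: all powers of l P(l) have to be
    bounded at once. Dissipativity makes l P(l) a contraction for the seminorm of the form, and
    coercivity turns this into one norm bound for all powers. Conjugation with E carries the bound
    to Z1. The semigroup is extended by the identity to negative times, so that two-sided calculus
    on R applies to it. *)

(** * Reflective proof of linear identities between vectors *)

Inductive vexpr :=
| VZero
| VVar (n : nat)
| VPlus (a b : vexpr)
| VOpp (a : vexpr)
| VMinus (a b : vexpr)
| VScal (c : C) (a : vexpr).

Fixpoint vdenote {V : ModuleSpace C_AbsRing} (env : list V) (e : vexpr) : V :=
  match e with
  | VZero => zero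
  | VVar n => nth n env zero
  | VPlus a b => plus (vdenote env a) (vdenote env b)
  | VOpp a => opp (vdenote env a)
  | VMinus a b => minus (vdenote env a) (vdenote env b)
  | VScal c a => scal c (vdenote env a)
  end.

Fixpoint vcoef (e : vexpr) (i : nat) : C :=
  match e with
  | VZero => RtoC 0
  | VVar n => if Nat.eqb n i then RtoC 1 else RtoC 0
  | VPlus a b => Cplus (vcoef a i) (vcoef b i)
  | VOpp a => Copp (vcoef a i)
  | VMinus a b => Cminus (vcoef a i) (vcoef b i)
  | VScal c a => Cmult c (vcoef a i)
  end.

Fixpoint vsum {V : ModuleSpace C_AbsRing} (env : list V) (c : nat -> C) : V :=
  match env with
  | nil => zero
  | v :: l => plus (scal (c 0%nat) v) (vsum l (fun i => c (S i)))
  end.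

(** A recursion rather than a bounded quantifier, so that [cbn] unfolds it into a conjunction of
    concrete scalar equations. *)
Fixpoint veq (n : nat) (c1 c2 : nat -> C) : Prop :=
  match n with
  | O => True
  | S m => c1 0%nat = c2 0%nat /\ veq m (fun i => c1 (S i)) (fun i => c2 (S i))
  end.

Section Reflection.

Variable V : ModuleSpace C_AbsRing.

Lemma vsum_zero (env : list V) (c : nat -> C) :
  (forall i, c i = RtoC 0) -> vsum env c = zero.
Proof.
revert c; induction env as [|v l IH]; intros c Hc; simpl; [easy |].
rewrite Hc, IH by auto.
rewrite (plus_zero_r (G := V)); apply (scal_zero_l (V := V)).
Qed.

Lemma vsum_ext (env : list V) (c d : nat -> C) :
  (forall i, c i = d i) -> vsum env c = vsum env d.
Proof.
revert c d; induction env as [|v l IH]; intros c d Hc; simpl; [easy |].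
rewrite Hc; f_equal; auto.
Qed.

Lemma vsum_plus (env : list V) (c d : nat -> C) :
  vsum env (fun i => Cplus (c i) (d i)) = plus (vsum env c) (vsum env d).
Proof.
revert c d; induction env as [|v l IH]; intros c d; simpl.
- symmetry; apply plus_zero_r.
- rewrite (IH (fun i => c (S i)) (fun i => d (S i))).
  change (Cplus (c 0%nat) (d 0%nat)) with (plus (c 0%nat : C_AbsRing) (d 0%nat)).
  rewrite (scal_distr_r (V := V)), <- !plus_assoc; f_equal.
  rewrite !plus_assoc; f_equal; apply plus_comm.
Qed.

Lemma vsum_scal (env : list V) (a : C) (c : nat -> C) :
  vsum env (fun i => Cmult a (c i)) = scal a (vsum env c).
Proof.
revert c; induction env as [|v l IH]; intros c; simpl.
- symmetry; apply (scal_zero_r (V := V)).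
- rewrite (IH (fun i => c (S i))), (scal_distr_l (V := V)); f_equal.
  symmetry; apply (scal_assoc (V := V)).
Qed.

Lemma vdenoteE (env : list V) (e : vexpr) :
  vdenote env e = vsum env (vcoef e).
Proof.
assert (Hopp : forall c, vsum env (fun i => Copp (c i)) = opp (vsum env c)).
{ intros c; rewrite <- (scal_opp_one (V := V)), <- vsum_scal.
  apply vsum_ext; intros i; change (opp one) with (Copp (RtoC 1)); ring. }
induction e as [|n|a IHa b IHb|a IHa|a IHa b IHb|k a IHa]; simpl.
- symmetry; now apply vsum_zero.
- clear Hopp; revert n; induction env as [|v l IH]; intros [|n]; simpl; try easy.
  + rewrite vsum_zero by easy.
    rewrite (plus_zero_r (G := V)); symmetry; apply (scal_one (V := V)).
  + rewrite IH; change (RtoC 0) with (zero : C_AbsRing) at 2.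
    rewrite (scal_zero_l (V := V)); symmetry; apply plus_zero_l.
- now rewrite vsum_plus, IHa, IHb.
- now rewrite Hopp, IHa.
- unfold minus; rewrite IHa, IHb, <- Hopp, <- vsum_plus; now apply vsum_ext.
- now rewrite vsum_scal, IHa.
Qed.

(** Both sides are the combination of the atoms with their computed coefficients. Only soundness
    matters, so equal coefficients suffice, whatever relations hold between the atoms. *)
Lemma vec_eq (env : list V) (e1 e2 : vexpr) :
  veq (length env) (vcoef e1) (vcoef e2) -> vdenote env e1 = vdenote env e2.
Proof.
rewrite !vdenoteE; generalize (vcoef e1) (vcoef e2).
induction env as [|v l IH]; intros c d; simpl; [easy |].
intros [-> H]; f_equal; now apply IH.
Qed.

End Reflection.

Ltac vlookup x env :=
  lazymatch env with
  | nil => fail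
  | x :: _ => constr:(O)
  | _ :: ?l => let n := vlookup x l in constr:(S n)
  end.

Ltac vadd x env :=
  match env with
  | _ => let _ := vlookup x env in env
  | _ => constr:(x :: env)
  end.

Ltac vcollect e env :=
  lazymatch e with
  | zero => env
  | plus ?a ?b => let env := vcollect a env in vcollect b env
  | minus ?a ?b => let env := vcollect a env in vcollect b env
  | opp ?a => vcollect a env
  | scal _ ?a => vcollect a env
  | _ => vadd e env
  end.

Ltac vreify e env :=
  lazymatch e with
  | zero => constr:(VZero)
  | plus ?a ?b => let a := vreify a env in let b := vreify b env in constr:(VPlus a b)
  | minus ?a ?b => let a := vreify a env in let b := vreify b env in constr:(VMinus a b)
  | opp ?a => let a := vreify a env in constr:(VOpp a)
  | scal ?c ?a => let a := vreify a env in constr:(VScal c a)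
  | _ => let n := vlookup e env in constr:(VVar n)
  end.

Ltac vec_norm :=
  lazymatch goal with
  | |- @eq ?T ?a ?b =>
    let env := vcollect a (@nil T) in
    let env := vcollect b env in
    let ea := vreify a env in
    let eb := vreify b env in
    refine (@vec_eq _ env ea eb _); cbn [veq vcoef Nat.eqb length];
    repeat match goal with |- _ /\ _ => split end; try exact I
  end.

(* Coefficient identities are checked on real and imaginary parts, where
   [RtoC] disappears. *)
Ltac vec :=
  vec_norm;
  (ring || (apply injective_projections; simpl; first [ring | field; try lra])).

(** * Norms, sequential limits and bounded operators *)

Section Vectors.

Context {W : Normed}.
Implicit Types x y z : W.


Lemma norm_rscal_le (r : R) x : norm (r *v x) <= Rabs r * norm x.
Proof. rewrite <- Cmod_R; apply (norm_scal (V := W)). Qed.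

Lemma norm_rscal_le_pos (r : R) x : 0 <= r -> norm (r *v x) <= r * norm x.
Proof.
intros Hr; rewrite <- (Rabs_pos_eq r Hr) at 2; apply norm_rscal_le.
Qed.

(** The norm axiom for scalars is an inequality; applied to [/ r] it yields the converse one. *)
Lemma norm_rscal (r : R) x : 0 <= r -> norm (r *v x) = r * norm x.
Proof.
intros Hr; apply Rle_antisym; [now apply norm_rscal_le_pos |].
destruct (Req_dec r 0) as [-> | Hr0].
- rewrite Rmult_0_l; apply (norm_ge_0 (V := W)).
- assert (Hp : 0 < r) by lra.
  apply Rmult_le_reg_l with (/ r); [now apply Rinv_0_lt_compat |].
  rewrite <- Rmult_assoc, Rinv_l, Rmult_1_l by lra.
  eapply Rle_trans; [| apply norm_rscal_le_pos].
  + right; f_equal; vec.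
  + left; now apply Rinv_0_lt_compat.
Qed.

Lemma norm_nonneg x : 0 <= norm x.
Proof. apply (norm_ge_0 (V := W)). Qed.

Lemma norm_zero_vec : norm (vzero : W) = 0.
Proof. apply (norm_zero (V := W)). Qed.

Lemma norm_plus_le x y : norm (x +v y) <= norm x + norm y.
Proof. apply (norm_triangle (V := W)). Qed.

Lemma norm_minus_sym x y : norm (x -v y) = norm (y -v x).
Proof.
rewrite <- (norm_opp (V := W) (minus x y)); f_equal; vec.
Qed.

Lemma norm_minus_le x y : norm (x -v y) <= norm x + norm y.
Proof.
rewrite <- (norm_opp (V := W) y); apply norm_plus_le.
Qed.

Lemma norm_dist_triangle y x z : norm (x -v z) <= norm (x -v y) + norm (y -v z).
Proof.
replace (x -v z) with ((x -v y) +v (y -v z)) by vec; apply norm_plus_le.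
Qed.

Lemma norm_le_dist x y : norm x <= norm (x -v y) + norm y.
Proof.
replace x with ((x -v y) +v y) at 1 by vec; apply norm_plus_le.
Qed.

Lemma vec_eq_of_dist x y : (forall eps, 0 < eps -> norm (x -v y) < eps) -> x = y.
Proof.
intros H.
assert (H0 : norm (x -v y) = 0).
{ apply Rle_antisym; [apply le_epsilon | apply norm_nonneg].
  intros e He; rewrite Rplus_0_l; now left; apply H. }
apply (norm_eq_zero (V := W)) in H0.
replace x with (x -v y +v y) by vec; rewrite H0; vec.
Qed.

(** Balls of the uniform structure agree with norm balls only up to [norm_factor]; sequences are
    therefore handled through the norm alone. *)
Definition tends (u : nat -> W) (l : W) : Prop :=
  forall eps, 0 < eps -> exists N, forall n, (N <= n)%nat -> norm (u n -v l) < eps.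

Lemma tends_const x : tends (fun _ => x) x.
Proof.
intros eps Heps; exists O; intros n _.
replace (x -v x) with (vzero : W) by vec; now rewrite norm_zero_vec.
Qed.

Lemma tends_le_seq (u : nat -> W) (l : W) (c : nat -> R) :
  (forall n, norm (u n -v l) <= c n) -> is_lim_seq c 0 -> tends u l.
Proof.
intros Hu Hc eps Heps.
destruct (proj2 (is_lim_seq_spec c 0) Hc (mkposreal _ Heps)) as [N HN].
exists N; intros n Hn; specialize (HN n Hn); simpl in HN.
rewrite Rminus_0_r in HN.
eapply Rle_lt_trans; [apply Hu |]; eapply Rle_lt_trans; [apply Rle_abs | exact HN].
Qed.

Lemma tends_plus u v x y :
  tends u x -> tends v y -> tends (fun n => u n +v v n) (x +v y).
Proof.
intros Hu Hv eps Heps.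
destruct (Hu (eps / 2)) as [N HN]; [lra |].
destruct (Hv (eps / 2)) as [P HP]; [lra |].
exists (Nat.max N P); intros n Hn.
specialize (HN n ltac:(lia)); specialize (HP n ltac:(lia)).
replace (u n +v v n -v (x +v y)) with ((u n -v x) +v (v n -v y)) by vec.
eapply Rle_lt_trans; [apply norm_plus_le | lra].
Qed.

Lemma tends_ext_dist u v x :
  tends u x -> tends (fun n => v n -v u n) vzero -> tends v x.
Proof.
intros Hu Hv.
generalize (tends_plus _ _ _ _ Hu Hv); intros H eps Heps.
destruct (H eps Heps) as [N HN]; exists N; intros n Hn.
replace (v n -v x) with (u n +v (v n -v u n) -v (x +v vzero)) by vec.
now apply HN.
Qed.

Lemma tends_norm_le u x (c : nat -> R) (l : R) :
  tends u x -> (forall n, norm (u n) <= c n) -> is_lim_seq c l -> norm x <= l.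
Proof.
intros Hu Hc Hl.
apply le_epsilon; intros e He.
destruct (Hu (e / 2)) as [N HN]; [lra |].
destruct (proj2 (is_lim_seq_spec c l) Hl (mkposreal (e / 2) ltac:(lra))) as [P HP].
specialize (HN (Nat.max N P) ltac:(lia)); specialize (HP (Nat.max N P) ltac:(lia)).
simpl in HP; apply Rabs_def2 in HP.
generalize (norm_le_dist x (u (Nat.max N P))) (Hc (Nat.max N P)).
rewrite norm_minus_sym; lra.
Qed.

Lemma tends_norm_le_const u x (c : R) :
  tends u x -> (forall n, norm (u n) <= c) -> norm x <= c.
Proof.
intros Hu Hc; apply (tends_norm_le u x (fun _ => c)); auto using is_lim_seq_const.
Qed.

Lemma tends_unique u x y : tends u x -> tends u y -> x = y.
Proof.
intros Hx Hy; apply vec_eq_of_dist; intros eps Heps.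
destruct (Hx (eps / 2)) as [N HN]; [lra |].
destruct (Hy (eps / 2)) as [P HP]; [lra |].
specialize (HN (Nat.max N P) ltac:(lia)); specialize (HP (Nat.max N P) ltac:(lia)).
rewrite norm_minus_sym in HN.
generalize (norm_dist_triangle (u (Nat.max N P)) x y); lra.
Qed.

End Vectors.

(** [T] is a bare function because multiplication by a complex scalar is one of the maps to which
    this is applied. *)
Lemma tends_op {V W : Normed} (T : V -> W) u x (M : R) :
  (forall a b, T (a -v b) = T a -v T b) -> (forall a, norm (T a) <= M * norm a) ->
  tends u x -> tends (fun n => T (u n)) (T x).
Proof.
intros HT HM Hu eps Heps.
assert (Hp : 0 < Rabs M + 1) by (generalize (Rabs_pos M); lra).
destruct (Hu (eps / (Rabs M + 1))) as [N HN]; [now apply Rdiv_lt_0_compat |].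
exists N; intros n Hn; specialize (HN n Hn).
rewrite <- HT; eapply Rle_lt_trans; [apply HM |].
apply Rmult_lt_compat_l with (r := Rabs M + 1) in HN; [| exact Hp].
replace ((Rabs M + 1) * (eps / (Rabs M + 1))) with eps in HN by (field; lra).
generalize (norm_nonneg (u n -v x)) (Rle_abs M); nra.
Qed.

Section Operators.

Context {V W : Normed} (T : BoundedOp V W).

Lemma op_plus x y : T (x +v y) = T x +v T y.
Proof. apply (linear_plus T (bop_linear T)). Qed.

Lemma op_scal (a : C) x : T (a *c x) = a *c T x.
Proof. apply (linear_scal T (bop_linear T)). Qed.

Lemma op_minus x y : T (x -v y) = T x -v T y.
Proof. apply (linear_minus T x y (bop_linear T)). Qed.

Lemma op_zero : T vzero = vzero.
Proof. apply (linear_zero T (bop_linear T)). Qed.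

Lemma op_bound : exists M, 0 < M /\ forall x, norm (T x) <= M * norm x.
Proof. apply (linear_norm T (bop_linear T)). Qed.

Lemma tends_bop u x : tends u x -> tends (fun n => T (u n)) (T x).
Proof.
destruct op_bound as [M [_ HM]].
apply (tends_op T u x M op_minus HM).
Qed.

End Operators.

Lemma cauchy_tends {W : Banach} (u : nat -> W) :
  (forall eps, 0 < eps -> exists N, forall n m, (N <= n)%nat -> (N <= m)%nat ->
     norm (u n -v u m) < eps) ->
  exists l, tends u l.
Proof.
intros Hu.
destruct (proj1 (filterlim_locally_cauchy (U := W) (F := eventually) u)) as [l Hl].
- intros eps; destruct (Hu eps (cond_pos eps)) as [N HN].
  exists (fun n => (N <= n)%nat); split; [now exists N |].
  intros n m Hn Hm; apply (norm_compat1 (V := W)); now apply HN.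
- exists l; intros eps Heps.
  assert (Hd : 0 < eps / norm_factor (V := W)).
  { apply Rdiv_lt_0_compat; [easy | apply norm_factor_gt_0]. }
  destruct (proj1 (filterlim_locally (U := W) u l) Hl (mkposreal _ Hd)) as [N HN].
  exists N; intros n Hn; specialize (HN n Hn).
  apply (norm_compat2 (V := W)) in HN; simpl in HN.
  eapply Rlt_le_trans; [exact HN |]; right; field.
  apply Rgt_not_eq, norm_factor_gt_0.
Qed.

Lemma closed_tends {W : Normed} (D : W -> Prop) (u : nat -> W) l :
  closed (T := W) D -> (forall n, D (u n)) -> tends u l -> D l.
Proof.
intros HD Hu Hl; apply HD; intros [eps Heps].
assert (Hd : 0 < eps) by apply cond_pos.
destruct (Hl eps Hd) as [N HN].
apply (Heps (u N)); [| apply Hu].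
apply (norm_compat1 (V := W)); now apply HN.
Qed.

Lemma closure_norm {W : Normed} (D : W -> Prop) (x : W) :
  closure (T := W) D x <-> forall eps, 0 < eps -> exists y, D y /\ norm (y -v x) < eps.
Proof.
split; intros H eps.
- intros Heps.
  assert (Hd : 0 < eps / norm_factor (V := W)).
  { apply Rdiv_lt_0_compat; [easy | apply norm_factor_gt_0]. }
  destruct (H (mkposreal _ Hd)) as [y [Dy Hy]].
  exists y; split; [exact Dy |]; apply (norm_compat2 (V := W)) in Hy; simpl in Hy.
  eapply Rlt_le_trans; [exact Hy |]; right; field.
  apply Rgt_not_eq, norm_factor_gt_0.
- destruct (H eps (cond_pos eps)) as [y [Dy Hy]].
  exists y; split; [exact Dy | now apply (norm_compat1 (V := W))].
Qed.

Lemma tends_dist_le {W : Normed} (u : nat -> W) l x (c : R) N :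
  tends u l -> (forall n, (N <= n)%nat -> norm (u n -v x) <= c) -> norm (l -v x) <= c.
Proof.
intros Hl Hc; apply le_epsilon; intros e He.
destruct (Hl e He) as [P HP].
specialize (HP (Nat.max N P) ltac:(lia)); specialize (Hc (Nat.max N P) ltac:(lia)).
rewrite norm_minus_sym in HP.
generalize (norm_dist_triangle (u (Nat.max N P)) l x); lra.
Qed.

(** The explicit error bound serves the gliding hump; the mere existence of the limit serves the
    dyadic refinement of Euler schemes. *)
Lemma geometric_limit {W : Banach} (u : nat -> W) (c r : R) :
  0 <= r < 1 -> (forall n, norm (u (S n) -v u n) <= c * r ^ n) ->
  exists l, tends u l /\ forall n, norm (l -v u n) <= c * r ^ n / (1 - r).
Proof.
intros Hr Hu.
assert (Hc : 0 <= c).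
{ generalize (Hu O) (norm_nonneg (u 1%nat -v u O)); simpl; lra. }
assert (Hcr : forall n, 0 <= c * r ^ n) by (intros; apply Rmult_le_pos; [lra | apply pow_le; lra]).
(* The factor [1 - r ^ p] is that of the exact geometric sum; it is what lets the induction on p
   close. *)
assert (H : forall n p, norm (u (p + n)%nat -v u n) <= c * r ^ n / (1 - r) * (1 - r ^ p)).
{ intros n p; induction p as [|p IH].
  - simpl (0 + n)%nat; replace (u n -v u n) with (vzero : W) by vec.
    rewrite norm_zero_vec; simpl; lra.
  - eapply Rle_trans; [apply (norm_dist_triangle (u (p + n)%nat)) |].
    specialize (Hu (p + n)%nat); rewrite pow_add in Hu; simpl (S p + n)%nat.
    replace (c * r ^ n / (1 - r) * (1 - r ^ S p)) with
      (c * (r ^ p * r ^ n) + c * r ^ n / (1 - r) * (1 - r ^ p)) by (simpl; field; lra).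
    lra. }
assert (H' : forall n k, (n <= k)%nat -> norm (u k -v u n) <= c * r ^ n / (1 - r)).
{ intros n k Hk; replace k with ((k - n) + n)%nat by lia.
  eapply Rle_trans; [apply H |].
  rewrite <- (Rmult_1_r (c * r ^ n / (1 - r))) at 2.
  apply Rmult_le_compat_l.
  - apply Rmult_le_pos; [apply Hcr | apply Rlt_le, Rinv_0_lt_compat; lra].
  - generalize (pow_le r (k - n) ltac:(lra)); lra. }
destruct (cauchy_tends u) as [l Hl].
- intros eps Heps.
  assert (Hlim : is_lim_seq (fun n => c / (1 - r) * r ^ n) (c / (1 - r) * 0)).
  { apply (is_lim_seq_scal_l _ _ 0), is_lim_seq_geom; rewrite Rabs_pos_eq; lra. }
  rewrite Rmult_0_r in Hlim.
  destruct (proj2 (is_lim_seq_spec _ _) Hlim (mkposreal (eps / 2) ltac:(lra))) as [N HN].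
  specialize (HN N (Nat.le_refl _)); simpl in HN; apply Rabs_def2 in HN.
  exists N; intros n k Hn Hk.
  generalize (H' N n Hn) (H' N k Hk) (norm_dist_triangle (u N) (u n) (u k)).
  rewrite (norm_minus_sym (u N) (u k)).
  replace (c * r ^ N / (1 - r)) with (c / (1 - r) * r ^ N) by (field; lra).
  lra.
- exists l; split; [exact Hl |]; intros n; now apply (tends_dist_le u l _ _ n Hl), H'.
Qed.

(** * Pseudo-resolvents with a radiality bound *)

Lemma iter_comm {A : Type} (f g : A -> A) n x :
  (forall y, f (g y) = g (f y)) -> Nat.iter n f (g x) = g (Nat.iter n f x).
Proof. intros H; symmetry; apply Nat.iter_swap_gen; auto. Qed.

Lemma iter_minus {W : Normed} (f : W -> W) n x y :
  (forall a b, f (a -v b) = f a -v f b) ->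
  Nat.iter n f (x -v y) = Nat.iter n f x -v Nat.iter n f y.
Proof.
intros H; induction n as [|n IH]; simpl; [easy |]; now rewrite IH, H.
Qed.

Lemma iter_rscal {W : Normed} (f : W -> W) n (r : R) x :
  (forall s a, f (s *v a) = s *v f a) ->
  Nat.iter n f (r *v x) = r *v Nat.iter n f x.
Proof.
intros H; induction n as [|n IH]; simpl; [easy |]; now rewrite IH, H.
Qed.

Lemma iter_zero {W : Normed} (T : BoundedOp W W) n : Nat.iter n T vzero = vzero.
Proof. induction n as [|n IH]; simpl; [easy |]; rewrite IH; apply op_zero. Qed.

Lemma iter_add_apply {A : Type} (f : A -> A) m n x :
  Nat.iter m f (Nat.iter n f x) = Nat.iter (m + n) f x.
Proof. symmetry; apply Nat.iter_add. Qed.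

Section PseudoResolvent.

Context {V : Normed}.
Variables (P : R -> BoundedOp V V) (w0 K : R) (q : nat).
Hypothesis resolvent_identity : forall l m, w0 < l -> w0 < m ->
  forall x, P l x -v P m x = (m - l) *v P l (P m x).
Hypothesis K_pos : 0 < K.
Hypothesis radial_bound : forall lam : nat -> R,
  (forall k, (k <= q)%nat -> w0 < lam k) ->
  opnorm_le (prod_op (fun k => P (lam k)) q)
    (K / prod_f_R0 (fun k => Rabs (lam k - w0)) q).

(** For distinct parameters, the resolvent identity in its two orders expresses the same difference
    through either product, and [m - l] divides out. *)
Lemma pseudo_comm l m x : w0 < l -> w0 < m -> P l (P m x) = P m (P l x).
Proof.
intros Hl Hm; destruct (Req_dec l m) as [-> | Hlm]; [easy |].
generalize (resolvent_identity l m Hl Hm x) (resolvent_identity m l Hm Hl x).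
intros H1 H2.
replace (P l (P m x)) with (/ (m - l) *v ((m - l) *v P l (P m x))).
2: { vec. }
rewrite <- H1.
replace (P l x -v P m x) with (opp (P m x -v P l x)) by vec.
rewrite H2; vec.
Qed.

(** Radiality allows q + 1 independent parameters; the estimates use only two values, arranged in
    two blocks. [prod_op F n] has n + 1 factors, whence the exponents. *)
Lemma prod_op_two_blocks (F : nat -> BoundedOp V V) (S T : BoundedOp V V) n j y :
  (j <= n + 1)%nat -> (forall k, (k < j)%nat -> F k = S) ->
  (forall k, (j <= k <= n)%nat -> F k = T) ->
  prod_op F n y = Nat.iter j S (Nat.iter (n + 1 - j) T y).
Proof.
revert j y; induction n as [|n IH]; intros j y Hj HS HT.
- destruct j as [|[|j]]; simpl; [now rewrite HT by lia | now rewrite HS by lia | lia].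
- change (prod_op F (Datatypes.S n) y) with (prod_op F n (F (Datatypes.S n) y)).
  destruct (Nat.eq_dec j (Datatypes.S n + 1)) as [-> | Hne].
  + rewrite (IH (n + 1)%nat); [| lia | intros; apply HS; lia | intros; lia].
    rewrite HS by lia.
    replace (n + 1 - (n + 1))%nat with 0%nat by lia.
    replace (Datatypes.S n + 1 - (Datatypes.S n + 1))%nat with 0%nat by lia.
    replace (Datatypes.S n + 1)%nat with (n + 1 + 1)%nat by lia.
    now rewrite <- (iter_add_apply _ (n + 1) 1).
  + rewrite (IH j); [| lia | auto | intros; apply HT; lia].
    rewrite HT by lia.
    replace (Datatypes.S n + 1 - j)%nat with ((n + 1 - j) + 1)%nat by lia.
    now rewrite <- (iter_add_apply _ (n + 1 - j) 1).
Qed.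

Lemma prod_f_R0_two_blocks (F : nat -> R) (s t : R) n j :
  (j <= n + 1)%nat -> (forall k, (k < j)%nat -> F k = s) ->
  (forall k, (j <= k <= n)%nat -> F k = t) ->
  prod_f_R0 F n = s ^ j * t ^ (n + 1 - j).
Proof.
revert j; induction n as [|n IH]; intros j Hj HS HT.
- destruct j as [|[|j]]; simpl; [rewrite HT by lia; ring | rewrite HS by lia; ring | lia].
- change (prod_f_R0 F (S n)) with (prod_f_R0 F n * F (S n)).
  destruct (Nat.eq_dec j (S n + 1)) as [-> | Hne].
  + rewrite (IH (n + 1)%nat); [| lia | intros; apply HS; lia | intros; lia].
    rewrite HS by lia.
    replace (n + 1 - (n + 1))%nat with 0%nat by lia.
    replace (S n + 1 - (S n + 1))%nat with 0%nat by lia.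
    replace (S n + 1)%nat with (S (n + 1)) by lia; simpl; ring.
  + rewrite (IH j); [| lia | auto | intros; apply HT; lia].
    rewrite HT by lia.
    replace (S n + 1 - j)%nat with (S (n + 1 - j))%nat by lia; simpl; ring.
Qed.

(* The second parameter is normalised so that its factors in the radiality
   bound are 1. *)
Let m := w0 + 1.

Lemma iter_two_bound l j i y : w0 < l -> (j + i = q + 1)%nat ->
  norm (Nat.iter j (P l) (Nat.iter i (P m) y)) <= K / (l - w0) ^ j * norm y.
Proof.
intros Hl Hji.
generalize (radial_bound (fun k => if (k <? j)%nat then l else m)); intros H.
assert (Hlam : forall k, (k <= q)%nat -> w0 < (if (k <? j)%nat then l else m)).
{ intros k _; unfold m; destruct (k <? j)%nat; lra. }
specialize (H Hlam y).
rewrite (prod_op_two_blocks _ (P l) (P m) q j) in H.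
- rewrite (prod_f_R0_two_blocks _ (l - w0) 1 q j) in H.
  + rewrite pow1, Rmult_1_r in H; replace i with (q + 1 - j)%nat by lia; exact H.
  + lia.
  + intros k Hk; apply Nat.ltb_lt in Hk; rewrite Hk; apply Rabs_pos_eq; lra.
  + intros k Hk; replace (k <? j)%nat with false by (symmetry; apply Nat.ltb_ge; lia).
    replace (m - w0) with 1 by (unfold m; ring); apply Rabs_R1.
- lia.
- intros k Hk; apply Nat.ltb_lt in Hk; now rewrite Hk.
- intros k Hk; replace (k <? j)%nat with false by (symmetry; apply Nat.ltb_ge; lia); easy.
Qed.

(** By the resolvent identity [D l] is (l - m) P(l) P(m), so its power q + 1 is the scaled power of
    P(l) acting on the range of P(m)^(q+1). Expanded as a difference instead, the same power is
    P(m)^(q+1) plus products containing some P(l), which are O(1 / (l - w0)). *)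
Let D (l : R) (x : V) : V := P m x -v P l x.

Lemma D_minus l a b : D l (a -v b) = D l a -v D l b.
Proof. unfold D; rewrite !op_minus; vec. Qed.

Lemma D_comm l x : w0 < l -> D l (P l x) = P l (D l x).
Proof.
intros Hl; unfold D; rewrite op_minus; f_equal; apply pseudo_comm; unfold m; lra.
Qed.

(** Splitting one factor [D l] turns it into either a P(m) or a P(l). The total i + j + k stays
    equal to q + 1, the number of factors for which radiality gives a bound, and 2 ^ i counts the
    products. Since l - w0 >= 1, further factors P(l) only help. *)
Lemma iter_D_bound l i j k y : w0 + 1 <= l -> (i + j + k = q + 1)%nat -> (1 <= j)%nat ->
  norm (Nat.iter j (P l) (Nat.iter i (D l) (Nat.iter k (P m) y)))
    <= 2 ^ i * (K / (l - w0)) * norm y.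
Proof.
intros Hl; revert j k; induction i as [|i IH]; intros j k Hs Hj.
- simpl; rewrite Rmult_1_l.
  eapply Rle_trans; [apply iter_two_bound; [lra | lia] |].
  apply Rmult_le_compat_r; [apply norm_nonneg |].
  apply Rmult_le_compat_l; [lra |].
  apply Rinv_le_contravar; [lra |].
  rewrite <- (pow_1 (l - w0)) at 1; apply Rle_pow; [lra | lia].
- replace (S i) with (i + 1)%nat by lia; rewrite <- iter_add_apply; simpl (Nat.iter 1 _ _).
  unfold D at 2.
  rewrite (iter_minus (D l)) by apply D_minus.
  rewrite (iter_minus (P l)) by apply op_minus.
  rewrite (iter_comm (D l) (P l)) by (intros; apply D_comm; lra).
  eapply Rle_trans; [apply norm_minus_le |].
  change (P m (Nat.iter k (P m) y)) with (Nat.iter (S k) (P m) y).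
  rewrite (iter_comm (P l) (P l) j) by easy.
  change (P l (Nat.iter j (P l) (Nat.iter i (D l) (Nat.iter k (P m) y))))
    with (Nat.iter (S j) (P l) (Nat.iter i (D l) (Nat.iter k (P m) y))).
  generalize (IH j (S k) ltac:(lia) Hj) (IH (S j) k ltac:(lia) ltac:(lia)).
  rewrite pow_add; simpl (2 ^ 1); lra.
Qed.

(** The factors [D l] are replaced by P(m) one at a time. Each replacement leaves an error with one
    factor P(l), and 2 ^ i + 2 ^ i adds up to the next constant. *)
Lemma iter_D_dist l i k y : w0 + 1 <= l -> (i + k = q + 1)%nat ->
  norm (Nat.iter i (D l) (Nat.iter k (P m) y) -v Nat.iter (q + 1) (P m) y)
    <= 2 ^ i * (K / (l - w0)) * norm y.
Proof.
intros Hl; revert k; induction i as [|i IH]; intros k Hs.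
- replace k with (q + 1)%nat by lia; simpl.
  replace (Nat.iter (q + 1) (P m) y -v Nat.iter (q + 1) (P m) y) with (vzero : V) by vec.
  rewrite norm_zero_vec, Rmult_1_l; apply Rmult_le_pos; [| apply norm_nonneg].
  apply Rlt_le, Rdiv_lt_0_compat; lra.
- replace (S i) with (i + 1)%nat by lia; rewrite <- iter_add_apply; simpl (Nat.iter 1 _ _).
  unfold D at 2.
  rewrite (iter_minus (D l)) by apply D_minus.
  change (P m (Nat.iter k (P m) y)) with (Nat.iter (S k) (P m) y).
  generalize (IH (S k) ltac:(lia)) (iter_D_bound l i 1 k y Hl ltac:(lia) ltac:(lia)).
  simpl (Nat.iter 1 _ _).
  rewrite <- (iter_comm (D l) (P l)) by (intros; apply D_comm; lra).
  intros H1 H2.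
  replace (Nat.iter i (D l) (Nat.iter (S k) (P m) y)
    -v Nat.iter i (D l) (P l (Nat.iter k (P m) y)) -v Nat.iter (q + 1) (P m) y)
  with ((Nat.iter i (D l) (Nat.iter (S k) (P m) y) -v Nat.iter (q + 1) (P m) y)
    -v Nat.iter i (D l) (P l (Nat.iter k (P m) y))) by vec.
  eapply Rle_trans; [apply norm_minus_le |].
  rewrite pow_add; simpl (2 ^ 1); lra.
Qed.

Lemma iter_D_eq l n y : w0 < l ->
  Nat.iter n (D l) y = (l - m) ^ n *v Nat.iter n (P l) (Nat.iter n (P m) y).
Proof.
intros Hl; revert y; induction n as [|n IH]; intros y; simpl; [vec |].
assert (HD : forall x, D l x = (l - m) *v P l (P m x)).
{ intros x; unfold D; rewrite resolvent_identity by (unfold m; lra).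
  f_equal; apply pseudo_comm; unfold m; lra. }
rewrite HD, IH, !op_scal.
rewrite (iter_comm (P l) (P m)) by (intros; apply pseudo_comm; unfold m; lra).
vec.
Qed.

(** Radiality with q + 1 equal parameters. The scale is [l - m], as it comes out of [iter_D_eq], and
    is smaller than the [l - w0] of the hypothesis. *)
Lemma radial_scaled_bound l y : m < l ->
  norm ((l - m) ^ (q + 1) *v Nat.iter (q + 1) (P l) y) <= K * norm y.
Proof.
intros Hl; rewrite norm_rscal by (apply pow_le; lra).
generalize (iter_two_bound l (q + 1) 0 y ltac:(unfold m in *; lra) ltac:(lia)); simpl.
intros H.
assert (Hp : 0 < (l - w0) ^ (q + 1)) by (apply pow_lt; unfold m in *; lra).
assert (Hle : (l - m) ^ (q + 1) <= (l - w0) ^ (q + 1)).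
{ apply pow_incr; unfold m in *; lra. }
eapply Rle_trans; [apply Rmult_le_compat_l; [apply pow_le; lra | exact H] |].
replace (K * norm y) with ((l - w0) ^ (q + 1) * (K / (l - w0) ^ (q + 1) * norm y))
  by (field; lra).
apply Rmult_le_compat_r; [| exact Hle].
apply Rmult_le_pos; [apply Rlt_le, Rdiv_lt_0_compat; lra | apply norm_nonneg].
Qed.

Lemma prod_op_comm (lam : nat -> R) n l y : w0 < l ->
  (forall k, (k <= n)%nat -> w0 < lam k) ->
  prod_op (fun k => P (lam k)) n (P l y) = P l (prod_op (fun k => P (lam k)) n y).
Proof.
intros Hl; revert y; induction n as [|n IH]; intros y Hlam; simpl.
- apply pseudo_comm; auto.
- rewrite <- IH by auto; f_equal; apply pseudo_comm; auto.
Qed.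

(** The resolvent identity writes P(lam k) x as P(l) applied to x + (l - lam k) P(lam k) x, so a
    factor can change its parameter without leaving the range. This is why the closures of these
    ranges do not depend on the parameters. *)
Lemma prod_op_ran (lam : nat -> R) n l y : w0 < l ->
  (forall k, (k <= n)%nat -> w0 < lam k) ->
  exists y', prod_op (fun k => P (lam k)) n y = Nat.iter (n + 1) (P l) y'.
Proof.
intros Hl.
assert (Hfac : forall k x, w0 < lam k -> exists x', P (lam k) x = P l x').
{ intros k x Hk; exists (x +v (l - lam k) *v P (lam k) x).
  generalize (resolvent_identity l (lam k) Hl Hk x); intros H.
  rewrite op_plus, op_scal.
  set (u := P (lam k) x) in *.
  replace ((l - lam k) *v P l u) with (opp ((lam k - l) *v P l u)) by vec.
  rewrite <- H; vec. }
revert y; induction n as [|n IH]; intros y Hlam; simpl.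
- destruct (Hfac 0%nat y) as [y' Hy']; [auto | now exists y'].
- destruct (Hfac (S n) y) as [x Hx]; [auto |].
  destruct (IH x) as [y' Hy']; [auto |].
  exists y'; rewrite Hx, prod_op_comm by auto; now rewrite Hy'.
Qed.

Section Convergence.

Variables (lam : nat -> R).
Hypothesis Hlam : forall k, (k <= q)%nat -> w0 < lam k.

Let V1 := closure (T := V) (ran (prod_op (fun k => P (lam k)) q)).

(** The scaled powers are uniformly bounded, so convergence on the dense range of P(m)^(q+1), where
    it has the rate 1 / (l - w0), is enough. *)
Lemma radial_strong_limit x eps : V1 x -> 0 < eps ->
  exists L, m < L /\ forall l, L <= l ->
    norm ((l - m) ^ (q + 1) *v Nat.iter (q + 1) (P l) x -v x) < eps.
Proof.
intros Hx Heps.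
(* Shares of [eps]: K for the operator applied to x - v, one for its error at v, one for v - x. *)
assert (HK : 0 < K + 2) by lra.
destruct (proj1 (closure_norm _ _) Hx (eps / (K + 2))) as [v [[y0 Hy0] Hv]];
  [now apply Rdiv_lt_0_compat |].
destruct (prod_op_ran lam q m y0) as [y Hy]; [unfold m; lra | easy |].
rewrite Hy in Hy0; clear Hy y0.
set (C := 2 ^ (q + 1) * K * norm y).
assert (HC : 0 <= C).
{ apply Rmult_le_pos; [| apply norm_nonneg].
  apply Rmult_le_pos; [apply pow_le |]; lra. }
(* Beyond this point C / (l - w0) is less than eps / (K + 2). *)
exists (m + 1 + C * (K + 2) / eps).
assert (HCe : 0 <= C * (K + 2) / eps).
{ apply Rmult_le_pos; [apply Rmult_le_pos; lra |].
  apply Rlt_le, Rinv_0_lt_compat; lra. }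
split; [lra |]; intros l Hl.
assert (Hml : m < l) by lra.
set (A := fun z : V => (l - m) ^ (q + 1) *v Nat.iter (q + 1) (P l) z).
assert (HA : norm (A v -v v) <= C / (l - w0)).
{ unfold A; rewrite <- Hy0, <- iter_D_eq by (unfold m in *; lra).
  generalize (iter_D_dist l (q + 1) 0 y ltac:(unfold m in *; lra) ltac:(lia)); simpl.
  unfold C, Rdiv; intros H; eapply Rle_trans; [exact H |]; right; ring. }
assert (HA2 : norm (A (x -v v)) <= K * norm (v -v x)).
{ rewrite (norm_minus_sym v x); now apply radial_scaled_bound. }
assert (HC2 : C / (l - w0) < eps / (K + 2)).
{ apply Rmult_lt_reg_r with ((l - w0) * (K + 2)); [apply Rmult_lt_0_compat; unfold m in *; lra |].
  replace (C / (l - w0) * ((l - w0) * (K + 2))) with (C * (K + 2)) by (field; unfold m in *; lra).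
  replace (eps / (K + 2) * ((l - w0) * (K + 2))) with (eps * (l - w0)) by (field; lra).
  replace (C * (K + 2)) with (eps * (C * (K + 2) / eps)) by (field; lra).
  apply Rmult_lt_compat_l; unfold m in *; lra. }
fold (A x).
replace (A x -v x) with (A (x -v v) +v (A v -v v) +v (v -v x)).
2: { unfold A; rewrite iter_minus by apply op_minus; vec. }
eapply Rle_lt_trans; [apply norm_plus_le |].
eapply Rle_lt_trans; [apply Rplus_le_compat_r, norm_plus_le |].
apply Rlt_le_trans with ((K + 2) * (eps / (K + 2))); [| right; field; lra].
assert (K * norm (v -v x) <= K * (eps / (K + 2))) by (apply Rmult_le_compat_l; lra).
lra.
Qed.

(** The scaled power does not see k, has norm at most K, and is close to the identity at x. *)
Lemma radial_kernel_bound x k : V1 x -> (forall l, w0 < l -> P l k = vzero) ->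
  norm x <= K * norm (x +v k).
Proof.
intros Hx Hk; apply le_epsilon; intros e He.
destruct (radial_strong_limit x e Hx He) as [L [HL H]].
specialize (H L (Rle_refl _)).
replace x with (x +v k -v k) in H at 1 by vec.
rewrite iter_minus in H by apply op_minus.
replace (Nat.iter (q + 1) (P L) k) with (vzero : V) in H.
- generalize (radial_scaled_bound L (x +v k) HL); intros H2.
  rewrite (minus_zero_r (G := V)) in H.
  set (u := (L - m) ^ (q + 1) *v Nat.iter (q + 1) (P L) (x +v k)) in *.
  generalize (norm_le_dist x u); rewrite norm_minus_sym; lra.
- rewrite Nat.add_1_r, Nat.iter_succ_r, Hk by (unfold m in *; lra).
  symmetry; apply iter_zero.
Qed.

End Convergence.

End PseudoResolvent.

(** * Hilbert spaces *)

Lemma discriminant_le (a b c : R) :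
  0 <= c -> (forall t, 0 <= a + 2 * t * b + t ^ 2 * c) -> b ^ 2 <= a * c.
Proof.
intros Hc H; destruct (Req_dec c 0) as [-> | Hc0].
- destruct (Req_dec b 0) as [-> | Hb]; [lra |].
  (* For [c = 0] the polynomial is affine in t, and here it takes the value -1. *)
  generalize (H (- (a + 1) / (2 * b))).
  replace (a + 2 * (- (a + 1) / (2 * b)) * b + (- (a + 1) / (2 * b)) ^ 2 * 0)
    with (-1) by (field; lra); lra.
- generalize (H (- b / c)).
  replace (a + 2 * (- b / c) * b + (- b / c) ^ 2 * c) with ((a * c - b ^ 2) / c)
    by (field; lra).
  intros H'; apply Rmult_le_compat_r with (r := c) in H'; [| lra].
  replace ((a * c - b ^ 2) / c * c) with (a * c - b ^ 2) in H' by (field; lra); lra.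
Qed.

Section HilbertSpace.

Context {X : Hilbert}.
Implicit Types x y z : X.

(* The real part of an inner product determines it. *)
Definition rinner x y : R := Re (inner x y).

Lemma rinner_sym x y : rinner x y = rinner y x.
Proof. unfold rinner; now rewrite (inner_conj y x). Qed.

Lemma rinner_plus_l x y z : rinner (x +v y) z = rinner x z + rinner y z.
Proof. exact (f_equal Re (inner_plus x y z)). Qed.

Lemma inner_cscal (a : C) x z : inner (a *c x) z = Cmult a (inner x z).
Proof. exact (inner_scal a x z). Qed.

Lemma rinner_rscal_l (r : R) x z : rinner (r *v x) z = r * rinner x z.
Proof. unfold rinner, Re; rewrite inner_cscal; simpl; ring. Qed.

Lemma rinner_minus_l x y z : rinner (x -v y) z = rinner x z - rinner y z.
Proof.
replace (x -v y) with (x +v (-1) *v y) by vec.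
rewrite rinner_plus_l, rinner_rscal_l; ring.
Qed.

Lemma rinner_plus_r x y z : rinner z (x +v y) = rinner z x + rinner z y.
Proof. rewrite !(rinner_sym z); apply rinner_plus_l. Qed.

Lemma rinner_rscal_r (r : R) x z : rinner z (r *v x) = r * rinner z x.
Proof. rewrite !(rinner_sym z); apply rinner_rscal_l. Qed.

Lemma rinner_minus_r x y z : rinner z (x -v y) = rinner z x - rinner z y.
Proof. rewrite !(rinner_sym z); apply rinner_minus_l. Qed.

Lemma rinner_self x : rinner x x = norm x ^ 2.
Proof. unfold rinner; now rewrite (inner_norm x). Qed.

Lemma rinner_sqr_le x y : rinner x y ^ 2 <= norm x ^ 2 * norm y ^ 2.
Proof.
apply discriminant_le; [apply pow2_ge_0 |]; intros t.
generalize (pow2_ge_0 (norm (x +v t *v y))).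
rewrite <- !rinner_self, !rinner_plus_l, !rinner_plus_r, !rinner_rscal_l, !rinner_rscal_r.
rewrite (rinner_sym y x); lra.
Qed.

Lemma rinner_le x y : Rabs (rinner x y) <= norm x * norm y.
Proof.
apply Rsqr_incr_0; [| apply Rabs_pos | apply Rmult_le_pos; apply norm_nonneg].
rewrite <- Rsqr_abs; unfold Rsqr; generalize (rinner_sqr_le x y); simpl; lra.
Qed.

Lemma rinner_ext x y : (forall z, rinner x z = rinner y z) -> x = y.
Proof.
intros H; apply vec_eq_of_dist; intros eps Heps.
assert (H0 : norm (x -v y) ^ 2 = 0).
{ rewrite <- rinner_self, rinner_minus_l, H; ring. }
rewrite <- Rsqr_pow2 in H0; apply Rsqr_0_uniq in H0.
lra.
Qed.

(** Minimisation of |y|^2 - 2 f(y) over Y. With f a product with x this gives orthogonal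
    projections, with Y the whole space it gives adjoints. Real functionals suffice, since [rinner]
    determines the inner product. *)
Lemma riesz_subspace (Y : X -> Prop) (f : X -> R) (c : R) :
  closed (T := X) Y -> Y vzero -> (forall x y, Y x -> Y y -> Y (x +v y)) ->
  (forall (r : R) x, Y x -> Y (r *v x)) ->
  (forall x y, f (x +v y) = f x + f y) -> (forall r x, f (r *v x) = r * f x) ->
  (forall x, Rabs (f x) <= c * norm x) ->
  exists v, Y v /\ forall y, Y y -> rinner v y = f y.
Proof.
intros HY Y0 Yp Ys fp fs fc.
set (phi := fun y : X => norm y ^ 2 - 2 * f y).
assert (Hphi : forall y, - c ^ 2 <= phi y).
{ intros y; unfold phi; generalize (Rle_abs (f y)) (fc y) (pow2_ge_0 (norm y - c)); nra. }
(* A supremum of [- phi], so that [- m] is the infimum of [phi] on Y. *)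
destruct (completeness (fun r => exists y, Y y /\ r = - phi y)) as [m [Hub Hlub]].
{ exists (c ^ 2); intros r [y [_ ->]]; generalize (Hphi y); lra. }
{ exists (- phi vzero), vzero; auto. }
assert (Hm : forall y, Y y -> - m <= phi y).
{ intros y Hy; generalize (Hub (- phi y)); intros H.
  assert (- phi y <= m) by (apply H; now exists y); lra. }
assert (Hseq : forall n, exists y, Y y /\ phi y < - m + / INR (S n)).
{ intros n; apply NNPP; intros Hn.
  assert (Hp : 0 < / INR (S n)) by (apply Rinv_0_lt_compat, lt_0_INR; lia).
  assert (m <= m - / INR (S n)); [| lra].
  apply Hlub; intros r [y [Hy ->]].
  apply Rnot_lt_le; intros Hlt; apply Hn; exists y; split; [exact Hy | lra]. }
set (u := fun n => proj1_sig (constructive_indefinite_description _ (Hseq n))).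
assert (Hu : forall n, Y (u n) /\ phi (u n) < - m + / INR (S n)).
{ intros n; apply (proj2_sig (constructive_indefinite_description _ (Hseq n))). }
assert (Hinv : forall eps, 0 < eps -> exists N, forall n, (N <= n)%nat -> / INR (S n) < eps).
{ intros eps Heps; destruct (archimed_cor1 eps Heps) as [N [HN HN0]].
  exists N; intros n Hn; eapply Rle_lt_trans; [| exact HN].
  apply Rinv_le_contravar; [now apply lt_0_INR | apply le_INR; lia]. }
(* The parallelogram law, in which the linear parts cancel: near-minimisers are close to each other
   because their midpoint is no better than the infimum. *)
assert (Hpar : forall x y, norm (x -v y) ^ 2
  = 2 * phi x + 2 * phi y - 4 * phi ((/ 2) *v (x +v y))).
{ intros x y; unfold phi; rewrite fs, fp, <- !rinner_self.
  rewrite !rinner_minus_l, !rinner_minus_r, !rinner_rscal_l, !rinner_rscal_r.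
  rewrite !rinner_plus_l, !rinner_plus_r, (rinner_sym y x); field. }
destruct (cauchy_tends u) as [v Hv].
{ intros eps Heps.
  destruct (Hinv (eps ^ 2 / 4)) as [N HN]; [apply Rdiv_lt_0_compat; [apply pow_lt |]; lra |].
  exists N; intros n k Hn Hk.
  assert (Hmid : - m <= phi ((/ 2) *v (u n +v u k))) by (apply Hm, Ys, Yp; apply Hu).
  assert (norm (u n -v u k) ^ 2 < eps ^ 2).
  { rewrite Hpar; generalize (proj2 (Hu n)) (proj2 (Hu k)) (HN n Hn) (HN k Hk); lra. }
  apply Rsqr_incrst_0; [unfold Rsqr; lra | apply norm_nonneg | lra]. }
exists v; split; [now apply (closed_tends Y u); [| intros; apply Hu |] |].
intros y Hy.
(* Minimality along v + t y: a nonnegative quadratic in t without constant term has no linear term.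
   It is obtained as a limit along the minimising sequence. *)
assert (Hq : forall t, 0 <= 0 + 2 * t * (rinner v y - f y) + t ^ 2 * norm y ^ 2).
{ intros t; apply le_epsilon; intros e He.
  assert (Hd : 0 < 4 * (Rabs t + 1) * (norm y + 1)).
  { generalize (Rabs_pos t) (norm_nonneg y); nra. }
  destruct (Hinv (e / 2)) as [N HN]; [lra |].
  destruct (Hv (e / (4 * (Rabs t + 1) * (norm y + 1)))) as [P HP];
    [now apply Rdiv_lt_0_compat |].
  set (n := Nat.max N P).
  specialize (HN n ltac:(lia)); specialize (HP n ltac:(lia)).
  assert (H1 : 0 <= / INR (S n) + 2 * t * (rinner (u n) y - f y) + t ^ 2 * norm y ^ 2).
  { generalize (Hm (u n +v t *v y)) (proj2 (Hu n)); intros H2 H3.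
    specialize (H2 (Yp _ _ (proj1 (Hu n)) (Ys _ _ Hy))).
    unfold phi in H2, H3; rewrite fp, fs, <- rinner_self in H2.
    rewrite !rinner_plus_l, !rinner_plus_r, !rinner_rscal_l, !rinner_rscal_r, !rinner_self,
      (rinner_sym y (u n)) in H2; lra. }
  assert (H2 : Rabs (t * rinner (u n -v v) y) <= e / 4).
  { rewrite Rabs_mult; generalize (rinner_le (u n -v v) y); intros H3.
    apply Rmult_lt_compat_r with (r := 4 * (Rabs t + 1) * (norm y + 1)) in HP; [| exact Hd].
    replace (e / (4 * (Rabs t + 1) * (norm y + 1)) * (4 * (Rabs t + 1) * (norm y + 1)))
      with e in HP by (field; generalize (Rabs_pos t) (norm_nonneg y); lra).
    generalize (Rabs_pos t) (norm_nonneg y) (norm_nonneg (u n -v v)); intros.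
    assert (Rabs t * Rabs (rinner (u n -v v) y) <= Rabs t * (norm (u n -v v) * norm y))
      by (apply Rmult_le_compat_l; lra).
    assert (Rabs t * norm y <= (Rabs t + 1) * (norm y + 1)) by nra.
    assert (norm (u n -v v) * (Rabs t * norm y)
      <= norm (u n -v v) * ((Rabs t + 1) * (norm y + 1))) by (apply Rmult_le_compat_l; lra).
    lra. }
  rewrite rinner_minus_l in H2; apply Rabs_le_between in H2; lra. }
apply discriminant_le in Hq; [| apply pow2_ge_0].
assert (Hz : rinner v y - f y = 0).
{ apply Rsqr_0_uniq; unfold Rsqr; generalize (pow2_ge_0 (rinner v y - f y)); lra. }
lra.
Qed.

Lemma orthogonal_decomposition (Y : X -> Prop) x :
  closed (T := X) Y -> Y vzero -> (forall x y, Y x -> Y y -> Y (x +v y)) ->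
  (forall (r : R) x, Y x -> Y (r *v x)) ->
  exists y, Y y /\ forall z, Y z -> rinner (x -v y) z = 0.
Proof.
intros HY Y0 Yp Ys.
destruct (riesz_subspace Y (rinner x) (norm x)) as [v [Hv H]]; auto.
- intros; apply rinner_plus_r.
- intros; apply rinner_rscal_r.
- intros; apply rinner_le.
- exists v; split; [exact Hv |]; intros z Hz; rewrite rinner_minus_l, (H z Hz); ring.
Qed.

(* Gliding hump, in the style of Sokal's proof of the uniform boundedness
   principle. *)
Lemma selfadjoint_closed_range_bound (H : BoundedOp X X) :
  (forall x y, rinner (H x) y = rinner x (H y)) -> closed (T := X) (ran H) ->
  exists c, 0 < c /\ forall y, ran H y -> norm y <= c * norm (H y).
Proof.
intros Hsym Hcl; apply NNPP; intros Hno.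
(* If the bound fails for the constant 6 ^ n, the normalised counterexample is such a vector. *)
assert (Hu : forall n, exists u, ran H u /\ norm u = 1 /\ norm (H u) <= (/ 6) ^ n).
{ intros n; apply NNPP; intros Hn; apply Hno; exists (6 ^ n).
  split; [apply pow_lt; lra |]; intros y [x Hx].
  apply Rnot_lt_le; intros Hlt; apply Hn.
  assert (Hy : 0 < norm y).
  { eapply Rle_lt_trans; [| exact Hlt].
    apply Rmult_le_pos; [apply pow_le; lra | apply norm_nonneg]. }
  exists (/ norm y *v y); split; [| split].
  - exists (/ norm y *v x); now rewrite op_scal, Hx.
  - rewrite norm_rscal by (apply Rlt_le, Rinv_0_lt_compat; lra); field; lra.
  - rewrite op_scal, norm_rscal by (apply Rlt_le, Rinv_0_lt_compat; lra).
    rewrite pow_inv.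
    assert (H6 : 0 < 6 ^ n) by (apply pow_lt; lra).
    apply Rmult_le_reg_l with (norm y * 6 ^ n); [now apply Rmult_lt_0_compat |].
    replace (norm y * 6 ^ n * (/ norm y * norm (H y))) with (6 ^ n * norm (H y)) by (field; lra).
    replace (norm y * 6 ^ n * / 6 ^ n) with (norm y) by (field; lra); lra. }
set (u := fun n => proj1_sig (constructive_indefinite_description _ (Hu n))).
assert (Hu' : forall n, ran H (u n) /\ norm (u n) = 1 /\ norm (H (u n)) <= (/ 6) ^ n).
{ intros n; apply (proj2_sig (constructive_indefinite_description _ (Hu n))). }
clearbody u; clear Hu Hno.
(* The sign makes the n-th term push the product with [u n] away from 0, so that its modulus is at
   least 3^-n just after that step. *)
set (sg := fun (z : X) n => if Rle_dec 0 (rinner z (u n)) then 1 else -1).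
set (z := fix z n := match n with
  | O => vzero
  | S k => z k +v (sg (z k) k * (/ 3) ^ k) *v u k end).
assert (Hsg : forall x n, Rabs (sg x n) = 1).
{ intros x n; unfold sg; destruct (Rle_dec _ _); [apply Rabs_R1 |].
  rewrite Rabs_left; lra. }
assert (H3 : forall n, 0 < (/ 3) ^ n) by (intros; apply pow_lt; lra).
(* The tail after step n is at most (/ 3) ^ (n + 1) / (1 - / 3), half of what the sign has
   secured. *)
destruct (geometric_limit z 1 (/ 3)) as [l [Hl Hln]]; [lra | |].
{ intros n; simpl.
  replace (z n +v (sg (z n) n * (/ 3) ^ n) *v u n -v z n)
    with ((sg (z n) n * (/ 3) ^ n) *v u n) by vec.
  eapply Rle_trans; [apply norm_rscal_le |].
  rewrite (proj1 (proj2 (Hu' n))), Rabs_mult, Hsg, Rabs_pos_eq; [lra | left; apply H3]. }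
assert (Hzran : forall n, ran H (z n)).
{ induction n as [|n [x Hx]]; simpl; [exists vzero; apply op_zero |].
  destruct (proj1 (Hu' n)) as [x' Hx'].
  exists (x +v (sg (z n) n * (/ 3) ^ n) *v x'); now rewrite op_plus, op_scal, Hx, Hx'. }
destruct (closed_tends (ran H) z l Hcl Hzran Hl) as [x Hx].
(* The limit is H x, as the range is closed. Its product with [u n] is at most |x| 6^-n by symmetry
   and at least 3^-n / 2 by construction. *)
assert (Hbig : forall n, 2 ^ n <= 2 * norm x).
{ intros n.
  assert (Hz1 : (/ 3) ^ n <= Rabs (rinner (z (S n)) (u n))).
  { simpl; rewrite rinner_plus_l, rinner_rscal_l, rinner_self, (proj1 (proj2 (Hu' n))).
    specialize (H3 n); unfold sg; destruct (Rle_dec 0 (rinner (z n) (u n))).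
    - rewrite Rabs_pos_eq; lra.
    - rewrite Rabs_left; lra. }
  assert (Hz2 : Rabs (rinner (l -v z (S n)) (u n)) <= (/ 3) ^ n / 2).
  { eapply Rle_trans; [apply rinner_le |]; rewrite (proj1 (proj2 (Hu' n))).
    generalize (Hln (S n)); simpl ((/ 3) ^ S n); lra. }
  assert (Hz3 : Rabs (rinner l (u n)) <= norm x * (/ 6) ^ n).
  { rewrite <- Hx, Hsym; eapply Rle_trans; [apply rinner_le |].
    apply Rmult_le_compat_l; [apply norm_nonneg | apply Hu']. }
  rewrite rinner_minus_l in Hz2.
  assert (Hz4 : (/ 3) ^ n / 2 <= norm x * (/ 6) ^ n).
  { generalize (Rabs_triang_inv (rinner (z (S n)) (u n)) (rinner (z (S n)) (u n) - rinner l (u n))).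
    rewrite (Rabs_minus_sym (rinner (z (S n)) (u n)) (rinner l (u n))).
    replace (rinner (z (S n)) (u n) - (rinner (z (S n)) (u n) - rinner l (u n)))
      with (rinner l (u n)) by ring; lra. }
  replace (/ 6) with (/ 3 * / 2) in Hz4 by field.
  rewrite Rpow_mult_distr, (pow_inv 2) in Hz4.
  assert (H2 : 0 < 2 ^ n) by (apply pow_lt; lra).
  specialize (H3 n).
  apply Rmult_le_reg_l with ((/ 3) ^ n / 2 / 2 ^ n).
  { apply Rdiv_lt_0_compat; lra. }
  replace ((/ 3) ^ n / 2 / 2 ^ n * 2 ^ n) with ((/ 3) ^ n / 2) by (field; lra).
  replace ((/ 3) ^ n / 2 / 2 ^ n * (2 * norm x)) with (norm x * ((/ 3) ^ n * / 2 ^ n))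
    by (field; lra); lra. }
destruct (Pow_x_infinity 2 ltac:(rewrite Rabs_pos_eq; lra) (2 * norm x + 1)) as [N HN].
specialize (HN N (Nat.le_refl _)); specialize (Hbig N).
rewrite Rabs_pos_eq in HN by (apply pow_le; lra); lra.
Qed.

(** Let y be the orthogonal projection of x on the range. Then y - x is orthogonal to the range,
    hence in the kernel by symmetry, and the lower bound applies to y, for which H y = H x. *)
Lemma selfadjoint_kernel_decomposition (H : BoundedOp X X) :
  (forall x y, rinner (H x) y = rinner x (H y)) -> closed (T := X) (ran H) ->
  exists c, 0 < c /\ forall x, exists k, H k = vzero /\ norm (x +v k) <= c * norm (H x).
Proof.
intros Hsym Hcl.
destruct (selfadjoint_closed_range_bound H Hsym Hcl) as [c [Hc Hb]].
exists c; split; [exact Hc |]; intros x.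
destruct (orthogonal_decomposition (ran H) x Hcl) as [y [Hy Hxy]].
- exists vzero; apply op_zero.
- intros a b [a' <-] [b' <-]; exists (a' +v b'); apply op_plus.
- intros r a [a' <-]; exists (r *v a'); apply op_scal.
- exists (y -v x).
  assert (Hk : H (y -v x) = vzero).
  { apply rinner_ext; intros v; rewrite Hsym.
    replace (y -v x) with ((-1) *v (x -v y)) by vec.
    replace (vzero : X) with (0 *v x) by vec.
    rewrite !rinner_rscal_l, Hxy by (now exists v); ring. }
  split; [exact Hk |].
  replace (x +v (y -v x)) with y by vec.
  replace (H x) with (H y); [now apply Hb |].
  rewrite op_minus in Hk.
  replace (H y) with (H y -v H x +v H x) by vec; rewrite Hk; vec.
Qed.

End HilbertSpace.

(** The imaginary part of <a, b> is the real part of <a, i b>, and [T] commutes with multiplication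
    by i. *)
Lemma inner_of_rinner {X Z : Hilbert} (T : BoundedOp X Z) (v : X) (z : Z) :
  (forall x, rinner v x = rinner z (T x)) -> forall x, inner v x = inner z (T x).
Proof.
assert (Him : forall (Y : Hilbert) (a b : Y), Im (inner a b) = rinner a (Ci *c b)).
{ intros Y a b; unfold rinner.
  rewrite (inner_conj (Ci *c b) a), inner_cscal, (inner_conj a b).
  unfold Re, Im; simpl; ring. }
intros H x; apply injective_projections; [apply H |].
generalize (Him X v x) (Him Z z (T x)); unfold Im; intros -> ->.
rewrite <- op_scal; apply H.
Qed.

(** The choice in [adjoint] is justified by the Riesz representation of x -> Re <z, T x>; uniqueness
    of the representing vector makes it linear in z. *)
Lemma adjoint_is_adjoint {X Z : Hilbert} (T : BoundedOp X Z) : is_adjoint T (adjoint T).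
Proof.
unfold adjoint; apply epsilon_spec.
destruct (op_bound T) as [M [HM0 HM]].
assert (Hv : forall z : Z, exists v : X, forall x, rinner v x = rinner z (T x)).
{ intros z.
  destruct (riesz_subspace (fun _ : X => True) (fun x => rinner z (T x)) (norm z * M))
    as [v [_ Hv]]; auto.
  - now intros x _.
  - intros; rewrite op_plus; apply rinner_plus_r.
  - intros; rewrite op_scal; apply rinner_rscal_r.
  - intros x; eapply Rle_trans; [apply rinner_le |]; rewrite Rmult_assoc.
    apply Rmult_le_compat_l; [apply norm_nonneg | apply HM].
  - exists v; auto. }
set (f := fun z => proj1_sig (constructive_indefinite_description _ (Hv z))).
assert (Hf : forall z x, inner (f z) x = inner z (T x)).
{ intros z; apply inner_of_rinner.
  apply (proj2_sig (constructive_indefinite_description _ (Hv z))). }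
clearbody f.
assert (Hr : forall z x, rinner (f z) x = rinner z (T x)) by (intros; unfold rinner; now rewrite Hf).
assert (Hlin : is_linear f).
{ split.
  - intros x y; apply rinner_ext; intros v.
    rewrite rinner_plus_l, !Hr; apply rinner_plus_l.
  - intros k x; apply rinner_ext; intros v; rewrite Hr; unfold rinner.
    rewrite !inner_cscal; now rewrite Hf.
  - exists M; split; [exact HM0 |]; intros z.
    (* From |f z|^2 = Re <z, T (f z)> <= M |z| |f z|, divided by |f z| when that is nonzero. *)
    destruct (Rle_lt_or_eq_dec _ _ (norm_nonneg (f z))) as [Hp | Hz].
    + apply Rmult_le_reg_r with (norm (f z)); [exact Hp |].
      generalize (rinner_self (f z)) (Rle_abs (rinner z (T (f z)))) (rinner_le z (T (f z))).
      rewrite Hr; intros H1 H2 H3.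
      assert (norm z * norm (T (f z)) <= norm z * (M * norm (f z)))
        by (apply Rmult_le_compat_l; [apply norm_nonneg | apply HM]).
      simpl in H1; lra.
    + rewrite <- Hz; apply Rmult_le_pos; [lra | apply norm_nonneg]. }
exists (Build_BoundedOp Hlin); intros x z; simpl.
rewrite (inner_conj z (T x)), <- Hf; symmetry; apply inner_conj.
Qed.

Lemma rinner_adjoint {X Z : Hilbert} (T : BoundedOp X Z) x z :
  rinner (T x) z = rinner x (adjoint T z).
Proof. unfold rinner; now rewrite adjoint_is_adjoint. Qed.

(** * Generation of semigroups *)

Definition nat_floor (x : R) : nat := Z.to_nat (Int_part x).

Lemma nat_floor_spec x : 0 <= x -> INR (nat_floor x) <= x < INR (nat_floor x) + 1.
Proof.
intros Hx; destruct (base_Int_part x) as [H1 H2].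
assert (Hz : (0 <= Int_part x)%Z).
{ apply Z.lt_succ_r, lt_IZR; rewrite succ_IZR; lra. }
unfold nat_floor; rewrite INR_IZR_INZ, Z2Nat.id by exact Hz; lra.
Qed.

Definition scal_op {W : Normed} (r : R) (T : BoundedOp W W) : BoundedOp W W :=
  Build_BoundedOp
    (is_linear_comp T (fun x => r *v x) (bop_linear T)
       (is_linear_scal_r (V := W) (RtoC r) Cmult_comm)).

Lemma filterlim_norm_iff {T : Type} {W : Normed} (F : (T -> Prop) -> Prop) {FF : Filter F}
  (f : T -> W) (y : W) :
  filterlim f F (locally y) <-> forall eps, 0 < eps -> F (fun t => norm (f t -v y) < eps).
Proof.
split.
- intros H eps Heps.
  assert (Hd : 0 < eps / norm_factor (V := W)).
  { apply Rdiv_lt_0_compat; [easy | apply norm_factor_gt_0]. }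
  generalize (proj1 (filterlim_locally f y) H (mkposreal _ Hd)); apply filter_imp.
  intros t Ht; apply (norm_compat2 (V := W)) in Ht; simpl in Ht.
  eapply Rlt_le_trans; [exact Ht |]; right; field.
  apply Rgt_not_eq, norm_factor_gt_0.
- intros H; apply filterlim_locally; intros eps.
  generalize (H eps (cond_pos eps)); apply filter_imp.
  intros t; apply (norm_compat1 (V := W)).
Qed.

Lemma is_derive_of_dist {W : Banach} (f : R -> W) (t : R) (l : W) :
  (forall e, 0 < e -> exists d, 0 < d /\ forall s, Rabs (s - t) < d ->
     norm (f s -v f t -v (s - t) *v l) <= e * Rabs (s - t)) ->
  is_derive (V := real_Banach W) f t l.
Proof.
intros H; split; [apply (is_linear_scal_l (V := real_Banach W)) |].
intros x Hx e.
apply (is_filter_lim_locally_unique (V := R_NormedModule)) in Hx; subst x.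
destruct (H e (cond_pos e)) as [d [Hd Hs]].
exists (mkposreal d Hd); intros s Hst; apply Hs; exact Hst.
Qed.

(** Derivatives are taken in the real space underlying [W], where multiplication by c is a bounded
    linear map and not a scalar; hence the chain rule. *)
Lemma is_derive_cscal {W : Banach} (c : C) (f : R -> W) (t : R) (l : W) :
  is_derive (V := real_Banach W) f t l ->
  is_derive (V := real_Banach W) (fun s => c *c f s) t (c *c l).
Proof.
intros H.
assert (Hc : is_linear (U := real_Banach W) (V := real_Banach W) (fun x : W => c *c x)).
{ split.
  - intros x y; apply (scal_distr_l (V := W)).
  - intros r x; change (c *c (r *v x) = r *v (c *c x)); vec.
  - exists (Cmod c + 1); split; [generalize (Cmod_ge_0 c); lra |].
    change (forall x : W, norm (c *c x) <= (Cmod c + 1) * norm x); intros x.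
    assert (H1 : norm (c *c x) <= Cmod c * norm x) by apply (norm_scal (V := W)).
    generalize (norm_nonneg x); lra. }
generalize (@filterdiff_comp' R_AbsRing (AbsRing_NormedModule R_AbsRing) (real_Banach W)
  (real_Banach W) f (fun x : W => c *c x) t _ _ H (filterdiff_linear _ Hc)).
intros H1; eapply filterdiff_ext_lin; [exact H1 |]; intros r; change (c *c (r *v l) = r *v (c *c l)); vec.
Qed.

(** A single term of the exponential series is below its sum. *)
Lemma pow_le_exp (n : nat) (t : R) : 0 <= t -> t ^ n <= INR (fact n) * exp t.
Proof.
intros Ht; generalize (exp_ge_taylor t n Ht); intros H.
assert (Hf : 0 < INR (fact n)) by apply INR_fact_lt_0.
apply Rmult_le_reg_l with (/ INR (fact n)); [now apply Rinv_0_lt_compat |].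
rewrite <- Rmult_assoc, Rinv_l, Rmult_1_l by lra.
apply Rle_trans with (t ^ n / INR (fact n)); [right; unfold Rdiv; ring |].
eapply Rle_trans; [| exact H].
destruct n as [|n]; [simpl; lra |].
rewrite tech5.
assert (0 <= sum_f_R0 (fun k => t ^ k / INR (fact k)) n); [| lra].
apply cond_pos_sum; intros k; apply Rmult_le_pos; [now apply pow_le |].
apply Rlt_le, Rinv_0_lt_compat, INR_fact_lt_0.
Qed.

(** The threshold is explicit because exp (k b) >= 1 + k b. *)
Lemma exp_decay (c k eps : R) : 0 <= c -> 0 < k -> 0 < eps ->
  exists B, 0 < B /\ forall b, B <= b -> c * exp (- k * b) < eps.
Proof.
intros Hc Hk He; exists ((c + 1) / (eps * k)); split.
{ apply Rdiv_lt_0_compat; [lra |]; now apply Rmult_lt_0_compat. }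
intros b Hb.
assert (Hkb : 1 + k * b <= exp (k * b)) by apply exp_ineq1_le.
assert (Hb2 : c + 1 <= eps * (k * b)).
{ apply Rmult_le_compat_l with (r := eps * k) in Hb; [| nra].
  replace (eps * k * ((c + 1) / (eps * k))) with (c + 1) in Hb by (field; lra); lra. }
replace (- k * b) with (- (k * b)) by ring; rewrite exp_Ropp.
apply Rmult_lt_reg_r with (exp (k * b)); [apply exp_pos |].
rewrite Rmult_assoc, Rinv_l by (apply Rgt_not_eq, exp_pos); nra.
Qed.

Lemma is_derive_exp (l t : R) : is_derive (fun s => exp (- l * s)) t (- l * exp (- l * t)).
Proof. auto_derive; [easy | ring]. Qed.

Lemma continuous_exp_scal (l t : R) : continuous (fun s => exp (- l * s)) t.
Proof.
apply (ex_derive_continuous (V := R_NormedModule)); eexists; apply is_derive_exp.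
Qed.

(** * Iterated integrals and their Laplace transforms *)

Section IntegratedSemigroup.

Context {W : Banach}.
Variables (T : R -> BoundedOp W W) (M : R).
Hypothesis M_pos : 0 <= M.
Hypothesis T_bound : forall t x, norm (T t x) <= M * norm x.
Hypothesis T_cont : forall x t, continuous (U := real_Banach W) (fun s => T s x) t.

(** For j >= 1, the integral of (t - s)^(j-1) / (j-1)! T(s) x over [0, t]. The recursive form suits
    integration by parts; negative t are included so that derivatives at 0 are two-sided. *)
Fixpoint iterated_integral (j : nat) (t : R) (x : W) : W :=
  match j with
  | O => T t x
  | S k => RInt (V := real_Banach W) (fun s => iterated_integral k s x) 0 t
  end.

Lemma iterated_integral_0 j x : iterated_integral (S j) 0 x = vzero.
Proof. apply (RInt_point (V := real_Banach W)). Qed.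

(** Continuity is a hypothesis here because its inductive proof uses this statement one level
    below. *)
Lemma iterated_integral_correct j x :
  (forall t, continuous (U := real_Banach W) (fun s => iterated_integral j s x) t) ->
  forall t, is_RInt (V := real_Banach W) (fun s => iterated_integral j s x) 0 t
    (iterated_integral (S j) t x).
Proof.
intros H t; apply (RInt_correct (V := real_Banach W)).
apply (ex_RInt_continuous (V := real_Banach W)); intros; apply H.
Qed.

Lemma iterated_integral_cont j x t :
  continuous (U := real_Banach W) (fun s => iterated_integral j s x) t.
Proof.
revert t; induction j as [|j IH]; intros t; [apply T_cont |].
apply (ex_derive_continuous (V := real_Banach W)).
exists (iterated_integral j t x); apply (is_derive_RInt (V := real_Banach W)
  (fun s => iterated_integral j s x) (fun s => iterated_integral (S j) s x) 0); [| apply IH].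
apply filter_forall; intros s; now apply iterated_integral_correct.
Qed.

Lemma iterated_integral_RInt j x t :
  is_RInt (V := real_Banach W) (fun s => iterated_integral j s x) 0 t
    (iterated_integral (S j) t x).
Proof. apply iterated_integral_correct, iterated_integral_cont. Qed.

Lemma iterated_integral_derive j x t :
  is_derive (V := real_Banach W) (fun s => iterated_integral (S j) s x) t
    (iterated_integral j t x).
Proof.
apply (is_derive_RInt (V := real_Banach W)
  (fun s => iterated_integral j s x) (fun s => iterated_integral (S j) s x) 0); [| apply iterated_integral_cont].
apply filter_forall; intros s; apply iterated_integral_RInt.
Qed.

Lemma iterated_integral_bound j t x :
  norm (iterated_integral j t x) <= M * Rabs t ^ j * norm x.
Proof.
revert t; induction j as [|j IH]; intros t.
- simpl; rewrite Rmult_1_r; apply T_bound.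
- replace (M * Rabs t ^ S j * norm x) with (Rabs (t - 0) * (M * Rabs t ^ j * norm x))
    by (rewrite Rminus_0_r; simpl; ring).
  refine (norm_RInt_le_const_abs (V := real_Banach W) _ 0 t _ _ _ (iterated_integral_RInt j x t)).
  intros s Hs; eapply Rle_trans; [apply IH |].
  apply Rmult_le_compat_r; [apply norm_nonneg |].
  apply Rmult_le_compat_l; [exact M_pos |].
  apply pow_incr; split; [apply Rabs_pos |].
  unfold Rmin, Rmax in Hs; destruct (Rle_dec 0 t);
    unfold Rabs; destruct (Rcase_abs s), (Rcase_abs t); lra.
Qed.

Lemma iterated_integral_linear j t : is_linear (iterated_integral j t).
Proof.
revert t; induction j as [|j IH]; intros t; [apply (bop_linear (T t)) |].
split.
- intros x y; apply (is_RInt_unique (V := real_Banach W)).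
  apply (is_RInt_ext (V := real_Banach W))
    with (fun s => iterated_integral j s x +v iterated_integral j s y).
  { intros s _; symmetry; apply (linear_plus _ (IH s)). }
  apply (is_RInt_plus (V := real_Banach W)); apply iterated_integral_RInt.
(* A complex scalar is not a scalar of the real integral. Instead c times the next integral is
   recognised as an antiderivative, and the fundamental theorem of calculus gives the value. *)
- intros c x; apply (is_RInt_unique (V := real_Banach W)).
  apply (is_RInt_ext (V := real_Banach W)) with (fun s => c *c iterated_integral j s x).
  { intros s _; symmetry; apply (linear_scal _ (IH s)). }
  assert (E : c *c iterated_integral (S j) t x
    = c *c iterated_integral (S j) t x -v c *c iterated_integral (S j) 0 x)
    by (rewrite iterated_integral_0; vec).
  change (is_RInt (V := real_Banach W) (fun s => c *c iterated_integral j s x) 0 t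
    (c *c iterated_integral (S j) t x)); rewrite E.
  apply (is_RInt_derive (V := real_Banach W) (fun s => c *c iterated_integral (S j) s x)
    (fun s => c *c iterated_integral j s x)).
  + intros s _; apply is_derive_cscal, iterated_integral_derive.
  + intros s _; apply (continuous_ext (T := R_UniformSpace) (U := real_Banach W)
      (fun s => iterated_integral j s (c *c x))).
    * intros r; apply (linear_scal _ (IH r)).
    * apply iterated_integral_cont.
- exists (M * Rabs t ^ S j + 1); split.
  + generalize (Rmult_le_pos _ _ M_pos (pow_le _ (S j) (Rabs_pos t))); lra.
  + intros x; generalize (iterated_integral_bound (S j) t x) (norm_nonneg x); lra.
Qed.

Definition integrated (j : nat) (t : R) : BoundedOp W W :=
  Build_BoundedOp (iterated_integral_linear j t).

(** From t^j <= j! exp t. The added 1 keeps the constant positive even when M = 0. *)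
Lemma integrated_exp_bound j t x : 0 <= t ->
  norm (integrated j t x) <= (M * INR (fact j) + 1) * exp (1 * t) * norm x.
Proof.
intros Ht; eapply Rle_trans; [apply iterated_integral_bound |].
rewrite (Rabs_pos_eq t), Rmult_1_l by exact Ht.
apply Rmult_le_compat_r; [apply norm_nonneg |].
generalize (Rmult_le_compat_l M _ _ M_pos (pow_le_exp j t Ht)) (exp_pos t); lra.
Qed.

Section Laplace.

Variables (l : R) (x v : W).
Hypothesis l_gt1 : 1 < l.
Hypothesis laplace_T : forall b, 0 <= b ->
  is_RInt (V := real_Banach W) (fun t => exp (- l * t) *v T t x) 0 b
    (v -v exp (- l * b) *v T b v).

(** Integration by parts: each further integration of T divides the Laplace transform by l. The
    partial integrals are carried along explicitly, so that the limit can be taken at each level. *)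
Lemma integrated_laplace_partial j : exists P : R -> W,
  (forall b, 0 <= b -> is_RInt (V := real_Banach W)
     (fun t => exp (- l * t) *v iterated_integral j t x) 0 b (P b)) /\
  (forall eps, 0 < eps -> exists B, 0 < B /\
     forall b, B <= b -> norm (P b -v (/ l ^ j) *v v) < eps).
Proof.
induction j as [|j [P [HP HPlim]]].
- exists (fun b => v -v exp (- l * b) *v T b v); split; [exact laplace_T |].
  intros eps Heps.
  destruct (exp_decay (M * norm v) l eps) as [B [HB0 HB]]; [| lra | easy |].
  { apply Rmult_le_pos; [exact M_pos | apply norm_nonneg]. }
  exists B; split; [exact HB0 |]; intros b Hb.
  replace (v -v exp (- l * b) *v T b v -v (/ l ^ 0) *v v)
    with ((- exp (- l * b)) *v T b v) by vec.
  eapply Rle_lt_trans; [apply norm_rscal_le |].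
  rewrite Rabs_Ropp, Rabs_pos_eq by apply Rlt_le, exp_pos.
  specialize (HB b Hb).
  generalize (Rmult_le_compat_l _ _ _ (Rlt_le _ _ (exp_pos (- l * b))) (T_bound b v)); lra.
(* Boundary terms of the antiderivative - exp (- l t) / l, and the remaining integral, which is the
   previous level. *)
- exists (fun b => (- / l * exp (- l * b)) *v iterated_integral (S j) b x
      -v (- / l * exp (- l * 0)) *v iterated_integral (S j) 0 x -v (- / l) *v P b).
  split.
  + intros b Hb.
    apply (is_RInt_scal_derive_l (V := real_Banach W) (fun t => - / l * exp (- l * t))
      (fun t => iterated_integral (S j) t x) (fun t => exp (- l * t))
      (fun t => iterated_integral j t x) 0 b ((- / l) *v P b)).
    * intros t _; auto_derive; [easy | field; lra].
    * intros t _; apply iterated_integral_derive.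
    * intros t _; apply continuous_exp_scal.
    * intros t _; apply iterated_integral_cont.
    * apply (is_RInt_ext (V := real_Banach W))
        with (fun t => (- / l) *v (exp (- l * t) *v iterated_integral j t x)).
      { intros t _.
        change ((- / l) *v (exp (- l * t) *v iterated_integral j t x)
          = (- / l * exp (- l * t)) *v iterated_integral j t x); vec. }
      exact (is_RInt_scal (V := real_Banach W) _ 0 b (- / l) _ (HP b Hb)).
  + intros eps Heps.
    destruct (HPlim (eps / 2)) as [B1 [HB1 H1]]; [lra |].
    assert (HC : 0 <= M * INR (fact (S j)) * norm x).
    { apply Rmult_le_pos; [| apply norm_nonneg].
      apply Rmult_le_pos; [exact M_pos | apply pos_INR]. }
    (* The iterated integral grows at most like exp b, so the boundary term decays at the rate l -
       1. *)
    destruct (exp_decay (M * INR (fact (S j)) * norm x) (l - 1) (eps / 2) HC)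
      as [B2 [HB2 H2]]; [lra | lra |].
    exists (Rmax B1 B2); split; [apply Rlt_le_trans with B1; [lra | apply Rmax_l] |].
    intros b Hb; generalize (Rmax_l B1 B2) (Rmax_r B1 B2); intros Hb1 Hb2.
    specialize (H1 b ltac:(lra)); specialize (H2 b ltac:(lra)).
    assert (Hl : 0 < / l < 1).
    { split; [apply Rinv_0_lt_compat; lra |].
      rewrite <- Rinv_1; apply Rinv_lt_contravar; lra. }
    assert (Hlj : l ^ j <> 0) by (apply pow_nonzero; lra).
    rewrite iterated_integral_0.
    replace ((- / l * exp (- l * b)) *v iterated_integral (S j) b x
      -v (- / l * exp (- l * 0)) *v vzero -v (- / l) *v P b -v (/ l ^ S j) *v v)
      with ((- / l * exp (- l * b)) *v iterated_integral (S j) b x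
        +v (/ l) *v (P b -v (/ l ^ j) *v v)) by (simpl pow; vec).
    eapply Rle_lt_trans; [apply norm_plus_le |].
    replace eps with (eps / 2 + eps / 2) by field.
    apply Rplus_le_lt_compat.
    * eapply Rle_trans; [apply norm_rscal_le |].
      replace (- / l * exp (- l * b)) with (- (/ l * exp (- l * b))) by ring.
      assert (Hep : 0 < exp (- l * b)) by apply exp_pos.
      rewrite Rabs_Ropp, Rabs_pos_eq by (apply Rmult_le_pos; lra).
      assert (Hi := iterated_integral_bound (S j) b x).
      assert (Hp := pow_le_exp (S j) b ltac:(lra)).
      rewrite (Rabs_pos_eq b) in Hi by lra.
      apply Rle_trans with (exp (- l * b) * (M * (INR (fact (S j)) * exp b) * norm x)).
      { apply Rmult_le_compat; [apply Rmult_le_pos; lra | apply norm_nonneg | |].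
        - rewrite <- (Rmult_1_l (exp (- l * b))) at 2; apply Rmult_le_compat_r; lra.
        - eapply Rle_trans; [exact Hi |]; apply Rmult_le_compat_r; [apply norm_nonneg |].
          apply Rmult_le_compat_l; [exact M_pos | exact Hp]. }
      replace (exp (- (l - 1) * b)) with (exp (- l * b) * exp b) in H2
        by (rewrite <- exp_plus; f_equal; ring).
      left; eapply Rle_lt_trans; [| exact H2]; right; ring.
    * rewrite norm_rscal by lra.
      generalize (norm_nonneg (P b -v (/ l ^ j) *v v)); nra.
Qed.

Lemma integrated_laplace j :
  is_integral_0_infty (fun t => exp (- l * t) *v integrated j t x) ((/ l ^ j) *v v).
Proof.
destruct (integrated_laplace_partial j) as [P [HP Hlim]].
apply (filterlimi_lim_ext_loc (fun ab : R * R => (P (snd ab) : real_Banach W))).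
- exists (fun r => r = 0) (fun r => 0 < r); [easy | now exists 0 |].
  intros r b -> Hb; apply HP; simpl; lra.
- apply (filterlim_comp _ _ _ snd P _ (Rbar_locally p_infty)); [apply filterlim_snd |].
  apply (proj2 (filterlim_norm_iff (W := W) (Rbar_locally p_infty) P _)).
  intros eps Heps; destruct (Hlim eps Heps) as [B [_ HB]].
  exists B; intros b Hb; apply HB; lra.
Qed.

End Laplace.
End IntegratedSemigroup.

Lemma resolvent_spec {X Z : Normed} (E : BoundedOp X Z) (B : Graph X Z) (l : C) :
  rho E B l -> is_resolvent E B l (resolvent E B l).
Proof. intros H; unfold resolvent; now apply epsilon_spec. Qed.

Lemma resolvent_unique {X Z : Normed} (E : BoundedOp X Z) (B : Graph X Z) (l : C) T z :
  is_resolvent E B l T -> resolvent E B l z = T z.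
Proof.
intros HT; apply (resolvent_spec E B l (ex_intro _ T HT)); now apply HT.
Qed.

(** * Hille-Yosida generation by backward Euler schemes *)

Section HilleYosida.

Context {W : Banach}.
Variables (G : Graph W W) (Rs : R -> BoundedOp W W) (a M : R).
Hypothesis a_pos : 0 < a.
Hypothesis M_pos : 0 <= M.
Hypothesis G_linear : linear_operator G.
Hypothesis res_dom : forall l u, a < l -> G (Rs l u) (l *v Rs l u -v u).
Hypothesis res_inv : forall l x y, a < l -> G x y -> Rs l (l *v x -v y) = x.
Hypothesis res_bound : forall l n x, a < l ->
  norm (Nat.iter n (Rs l) x) <= M / l ^ n * norm x.
Hypothesis G_dense : forall x, closure (T := W) (dom G) x.

Lemma graph_rscal (r : R) x y : G x y -> G (r *v x) (r *v y).
Proof. apply (graph_scal G_linear). Qed.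

Lemma res_inv_eq l x y : a < l -> G x y -> l *v Rs l x = x +v Rs l y.
Proof.
intros Hl H; generalize (res_inv l x y Hl H).
rewrite op_minus, op_scal; intros E; rewrite <- E at 2; vec.
Qed.

Lemma res_graph l x y : a < l -> G x y -> G (Rs l x) (Rs l y).
Proof.
intros Hl H; generalize (res_dom l x Hl).
rewrite (res_inv_eq l x y Hl H).
now replace (x +v Rs l y -v x) with (Rs l y) by vec.
Qed.

Lemma res_identity l m x : a < l -> a < m ->
  Rs l x -v Rs m x = (m - l) *v Rs l (Rs m x).
Proof.
intros Hl Hm; generalize (res_inv l _ _ Hl (res_dom m x Hm)).
rewrite !op_minus, !op_scal; intros H.
set (v := Rs l (Rs m x)) in *; rewrite <- H; vec.
Qed.

Lemma res_comm l m x : a < l -> a < m -> Rs l (Rs m x) = Rs m (Rs l x).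
Proof.
apply (pseudo_comm Rs a); intros; now apply res_identity.
Qed.

(* The mesh is dyadic, so that consecutive approximations are comparable. *)
Definition freq (k : nat) : R := (a + 1) * 2 ^ k.

Lemma freq_gt k : a < freq k.
Proof.
unfold freq; generalize (pow_R1_Rle 2 k ltac:(lra)); nra.
Qed.

Lemma freq_pos k : 0 < freq k.
Proof. generalize (freq_gt k); lra. Qed.

Lemma freq_S k : freq (S k) = 2 * freq k.
Proof. unfold freq; simpl; ring. Qed.

Lemma freq_inv_lim (c : R) : is_lim_seq (fun k => c / freq k) 0.
Proof.
apply is_lim_seq_ext with (fun k => c / (a + 1) * (/ 2) ^ k).
{ intros k; unfold freq; rewrite pow_inv; field; split; [apply pow_nonzero |]; lra. }
replace (Finite 0) with (Rbar_mult (c / (a + 1)) 0) by (simpl; f_equal; ring).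
apply is_lim_seq_scal_l, is_lim_seq_geom; rewrite Rabs_pos_eq; lra.
Qed.

(* One backward Euler step, of length [/ freq k]. *)
Definition euler (k : nat) : BoundedOp W W := scal_op (freq k) (Rs (freq k)).

Lemma eulerE k x : euler k x = freq k *v Rs (freq k) x.
Proof. easy. Qed.

Opaque euler.

(** Stability: the resolvent bound for all powers makes M independent of both the mesh and the
    number of steps. *)
Lemma euler_bound k n x : norm (Nat.iter n (euler k) x) <= M * norm x.
Proof.
assert (H : Nat.iter n (euler k) x = freq k ^ n *v Nat.iter n (Rs (freq k)) x).
{ induction n as [|n IH]; [simpl; vec |].
  rewrite !Nat.iter_succ, IH, eulerE, op_scal; simpl pow; vec. }
assert (Hp : 0 < freq k ^ n) by (apply pow_lt, freq_pos).
rewrite H, norm_rscal by lra.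
apply Rle_trans with (freq k ^ n * (M / freq k ^ n * norm x)).
- apply Rmult_le_compat_l; [lra | apply res_bound, freq_gt].
- right; field; lra.
Qed.

Lemma euler_comm k x l : a < l -> Rs l (euler k x) = euler k (Rs l x).
Proof.
intros Hl; rewrite !eulerE, op_scal; now rewrite res_comm by (auto using freq_gt).
Qed.

Lemma euler_graph k x y : G x y -> G (euler k x) (euler k y).
Proof. intros H; apply graph_rscal, res_graph; [apply freq_gt | exact H]. Qed.

Lemma euler_dom k x : exists y, G (euler k x) y.
Proof. eexists; apply graph_rscal, res_dom, freq_gt. Qed.

(** As [euler k y] is G (euler k x), this is the implicit step u = x + h G u with h = / freq k. *)
Lemma euler_step k x y : G x y -> euler k x = x +v (/ freq k) *v euler k y.
Proof.
intros H; rewrite !eulerE, (res_inv_eq _ x y (freq_gt k) H).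
generalize (freq_pos k); intros; vec.
Qed.

Lemma euler_iter_step k n x y : G x y ->
  Nat.iter (S n) (euler k) x -v Nat.iter n (euler k) x
    = (/ freq k) *v Nat.iter (S n) (euler k) y.
Proof.
intros H; rewrite !Nat.iter_succ_r, (euler_step k x y H).
set (f := (euler k : W -> W)).
replace (x +v / freq k *v f y) with (x -v (- / freq k) *v f y) by vec.
rewrite (iter_minus f) by (apply op_minus).
rewrite (iter_rscal f) by (intros; apply op_scal).
vec.
Qed.

Lemma euler_dist k n x y : G x y ->
  norm (Nat.iter n (euler k) x -v x) <= INR n / freq k * (M * norm y).
Proof.
intros H; induction n as [|n IH].
- simpl; replace (x -v x) with (vzero : W) by vec; rewrite norm_zero_vec; lra.
- eapply Rle_trans; [apply (norm_dist_triangle (Nat.iter n (euler k) x)) |].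
  rewrite (euler_iter_step k n x y H), S_INR.
  assert (Hf : 0 < / freq k) by (apply Rinv_0_lt_compat, freq_pos).
  rewrite norm_rscal by lra.
  generalize (Rmult_le_compat_l (/ freq k) _ _ ltac:(lra) (euler_bound k (S n) y)).
  unfold Rdiv in *; lra.
Qed.

(** The increment after n steps is h times the sum of the iterates of y, each within e of y. The
    bound N stays fixed so that the induction keeps its hypothesis on them. *)
Lemma euler_taylor k n N x y e : G x y -> (n <= N)%nat ->
  (forall j, (j <= N)%nat -> norm (Nat.iter j (euler k) y -v y) <= e) ->
  norm (Nat.iter n (euler k) x -v x -v (INR n / freq k) *v y) <= INR n / freq k * e.
Proof.
intros H Hn He; induction n as [|n IH].
- replace (Nat.iter 0 (euler k) x -v x -v (INR 0 / freq k) *v y) with (vzero : W).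
  2: { simpl Nat.iter; simpl INR; generalize (freq_pos k); intros; vec. }
  rewrite norm_zero_vec; simpl; lra.
- assert (Hf : 0 < / freq k) by (apply Rinv_0_lt_compat, freq_pos).
  replace (Nat.iter (S n) (euler k) x -v x -v (INR (S n) / freq k) *v y) with
    ((Nat.iter n (euler k) x -v x -v (INR n / freq k) *v y)
      +v (/ freq k) *v (Nat.iter (S n) (euler k) y -v y)).
  + eapply Rle_trans; [apply norm_plus_le |].
    rewrite norm_rscal, S_INR by lra.
    generalize (IH ltac:(lia)) (Rmult_le_compat_l (/ freq k) _ _ ltac:(lra) (He (S n) Hn)).
    unfold Rdiv; lra.
  + generalize (euler_iter_step k n x y H); rewrite S_INR.
    set (u := Nat.iter (S n) (euler k) x); set (v := Nat.iter n (euler k) x).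
    set (w := Nat.iter (S n) (euler k) y); intros E.
    replace u with (v +v (u -v v)) by vec; rewrite E.
    generalize (freq_pos k); intros; vec.
Qed.

Lemma euler_tends x : tends (fun k => euler k x) x.
Proof.
intros eps Heps.
assert (HM : 0 < M + 2) by lra.
destruct (proj1 (closure_norm _ _) (G_dense x) (eps / (M + 2))) as [v [[y Hy] Hv]];
  [now apply Rdiv_lt_0_compat |].
destruct (proj2 (is_lim_seq_spec _ _) (freq_inv_lim (M * norm y))
  (mkposreal (eps / (M + 2)) (Rdiv_lt_0_compat _ _ Heps HM))) as [N HN].
exists N; intros n Hn; specialize (HN n Hn); simpl in HN.
rewrite Rminus_0_r in HN; apply Rabs_def2 in HN.
replace (euler n x -v x) with (euler n (x -v v) +v (euler n v -v v) +v (v -v x)).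
2: { rewrite op_minus; vec. }
eapply Rle_lt_trans; [apply norm_plus_le |].
eapply Rle_lt_trans; [apply Rplus_le_compat_r, norm_plus_le |].
generalize (euler_dist n 1 v y Hy) (euler_bound n 1 (x -v v)); simpl.
rewrite (norm_minus_sym x v); intros H1 H2.
replace (1 / freq n * (M * norm y)) with (M * norm y / freq n) in H1
  by (generalize (freq_pos n); intros; field; lra).
assert (M * norm (v -v x) <= M * (eps / (M + 2))) by (apply Rmult_le_compat_l; lra).
apply Rlt_le_trans with ((M + 2) * (eps / (M + 2))); [lra | right; field; lra].
Qed.

(** A backward step lands in the domain of G, so two steps land in the domain of G^2, and both stay
    close to x on a fine mesh. *)
Lemma dom2_dense x eps : 0 < eps -> exists v y z, G v y /\ G y z /\ norm (v -v x) < eps.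
Proof.
intros Heps.
assert (HM : 0 < M + 1) by lra.
destruct (euler_tends x (eps / (M + 1))) as [N HN]; [now apply Rdiv_lt_0_compat |].
specialize (HN N (Nat.le_refl _)); cbv beta in HN.
destruct (euler_dom N x) as [y Hy].
destruct (euler_dom N y) as [z Hz].
exists (euler N (euler N x)), (euler N y), z; split; [| split].
- now apply euler_graph.
- exact Hz.
- replace (euler N (euler N x) -v x) with (euler N (euler N x -v x) +v (euler N x -v x)).
  2: { rewrite op_minus; vec. }
  eapply Rle_lt_trans; [apply norm_plus_le |].
  generalize (euler_bound N 1 (euler N x -v x)); simpl; intros H1.
  assert (M * norm (euler N x -v x) <= M * (eps / (M + 1))) by (apply Rmult_le_compat_l; lra).
  apply Rlt_le_trans with ((M + 1) * (eps / (M + 1))); [lra | right; field; lra].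
Qed.

(** Local error of one step against two half steps: expanding all of them twice with [euler_step],
    the orders 0 and 1 in h cancel, and z = G^2 x remains with h^2. *)
Lemma euler_refine k x y z : G x y -> G y z ->
  euler k x -v euler (S k) (euler (S k) x)
    = (/ freq k ^ 2) *v (euler k z -v (/ 2) *v euler (S k) z
        -v (/ 4) *v euler (S k) (euler (S k) z)).
Proof.
intros Hx Hy.
generalize (freq_pos k) (freq_S k); intros Hf HS.
rewrite (euler_step (S k) x y Hx), (op_plus (euler (S k))), op_scal.
rewrite (euler_step k x y Hx), (euler_step (S k) x y Hx).
rewrite (euler_step k y z Hy), (euler_step (S k) y z Hy).
rewrite (op_plus (euler (S k))), op_scal, (euler_step (S k) y z Hy).
rewrite HS; simpl pow; vec.
Qed.

(** The n local errors are propagated by stability. The induction moves on to x', so the hypothesis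
    bounds all iterates of z: those of the new z are later iterates of the old. The factor (M + 1) B
    covers M B + B / 2 + B / 4. *)
Lemma euler_double k n x y z B : G x y -> G y z ->
  (forall j, norm (Nat.iter j (euler (S k)) z) <= B) ->
  norm (Nat.iter n (euler k) x -v Nat.iter (2 * n) (euler (S k)) x)
    <= INR n * (M * (/ freq k ^ 2 * ((M + 1) * B))).
Proof.
revert x y z; induction n as [|n IH]; intros x y z Hx Hy HB.
- simpl; replace (x -v x) with (vzero : W) by vec; rewrite norm_zero_vec; lra.
- replace (2 * S n)%nat with (S (S (2 * n))) by lia.
  rewrite !Nat.iter_succ_r.
  set (x' := euler (S k) (euler (S k) x)).
  replace (Nat.iter n (euler k) (euler k x) -v Nat.iter (2 * n) (euler (S k)) x') with
    (Nat.iter n (euler k) (euler k x -v x')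
     +v (Nat.iter n (euler k) x' -v Nat.iter (2 * n) (euler (S k)) x')).
  2: { rewrite (iter_minus (euler k)) by apply op_minus; vec. }
  eapply Rle_trans; [apply norm_plus_le |].
  assert (H1 : norm (euler k x -v x') <= / freq k ^ 2 * ((M + 1) * B)).
  { unfold x'; rewrite (euler_refine k x y z Hx Hy).
    rewrite norm_rscal by (apply Rlt_le, Rinv_0_lt_compat, pow_lt, freq_pos).
    apply Rmult_le_compat_l; [apply Rlt_le, Rinv_0_lt_compat, pow_lt, freq_pos |].
    eapply Rle_trans; [apply norm_minus_le |].
    eapply Rle_trans; [apply Rplus_le_compat_r, norm_minus_le |].
    rewrite !norm_rscal by lra.
    generalize (HB 0%nat) (HB 1%nat) (HB 2%nat) (euler_bound k 1 z); simpl; intros.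
    assert (M * norm z <= M * B) by (apply Rmult_le_compat_l; lra).
    generalize (norm_nonneg (euler (S k) z)); lra. }
  assert (H2 := euler_bound k n (euler k x -v x')).
  assert (H3 := Rmult_le_compat_l M _ _ M_pos H1).
  assert (H4 := IH x' _ _ (euler_graph _ _ _ (euler_graph _ _ _ Hx))
    (euler_graph _ _ _ (euler_graph _ _ _ Hy))).
  rewrite S_INR; apply Rle_trans with
    (M * (/ freq k ^ 2 * ((M + 1) * B)) + INR n * (M * (/ freq k ^ 2 * ((M + 1) * B)))).
  + apply Rplus_le_compat; [lra | apply H4].
    intros j; rewrite <- !Nat.iter_succ_r; apply HB.
  + right; ring.
Qed.

(** [Rmax 0 t] freezes the scheme at the identity for negative times; the limit is then continuous
    on all of R. *)
Definition steps (k : nat) (t : R) : nat := nat_floor (Rmax 0 t * freq k).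

Lemma steps_spec k t : INR (steps k t) <= Rmax 0 t * freq k < INR (steps k t) + 1.
Proof.
apply nat_floor_spec, Rmult_le_pos; [apply Rmax_l | apply Rlt_le, freq_pos].
Qed.

Lemma steps_time k t : 0 <= INR (steps k t) / freq k <= Rmax 0 t.
Proof.
destruct (steps_spec k t) as [H _]; generalize (freq_pos k); intros Hf.
split; [apply Rmult_le_pos; [apply pos_INR | apply Rlt_le, Rinv_0_lt_compat; lra] |].
apply Rmult_le_reg_r with (freq k); [lra |].
replace (INR (steps k t) / freq k * freq k) with (INR (steps k t)) by (field; lra); exact H.
Qed.

Lemma steps_S k t : steps (S k) t = (2 * steps k t)%nat \/ steps (S k) t = (2 * steps k t + 1)%nat.
Proof.
generalize (steps_spec k t) (steps_spec (S k) t); rewrite freq_S; intros [H1 H2] [H3 H4].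
assert (H5 : (2 * steps k t < steps (S k) t + 1)%nat).
{ apply INR_lt; rewrite plus_INR, mult_INR; simpl (INR 2); simpl (INR 1); lra. }
assert (H6 : (steps (S k) t < 2 * steps k t + 2)%nat).
{ apply INR_lt; rewrite plus_INR, mult_INR; simpl (INR 2); lra. }
lia.
Qed.

Lemma steps_plus k s t : 0 <= s -> 0 <= t ->
  steps k (s + t) = (steps k s + steps k t)%nat \/
  steps k (s + t) = (steps k s + steps k t + 1)%nat.
Proof.
intros Hs Ht; generalize (steps_spec k s) (steps_spec k t) (steps_spec k (s + t)).
rewrite !Rmax_right by lra; intros [H1 H2] [H3 H4] [H5 H6].
assert (H7 : (steps k s + steps k t < steps k (s + t) + 1)%nat).
{ apply INR_lt; rewrite !plus_INR; simpl (INR 1); lra. }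
assert (H8 : (steps k (s + t) < steps k s + steps k t + 2)%nat).
{ apply INR_lt; rewrite !plus_INR; simpl (INR 2); lra. }
lia.
Qed.

Definition approx (k : nat) (t : R) (x : W) : W := Nat.iter (steps k t) (euler k) x.

Lemma approx_minus k t x y : approx k t (x -v y) = approx k t x -v approx k t y.
Proof. apply (iter_minus (euler k)), op_minus. Qed.

Lemma approx_bound k t x : norm (approx k t x) <= M * norm x.
Proof. apply euler_bound. Qed.

(** Halving the mesh costs n local errors of order h^2, where n h <= t, and possibly one extra step,
    of size h M |y|. Both are of order h, a multiple of 2^-k. *)
Lemma approx_S_dist k t x y z : G x y -> G y z ->
  norm (approx (S k) t x -v approx k t x)
    <= (Rmax 0 t * (M * ((M + 1) * (M * norm z))) + M * norm y) / (a + 1) * (/ 2) ^ k.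
Proof.
intros Hx Hy; unfold approx; set (n := steps k t).
generalize (freq_pos k); intros Hf.
assert (H1 : norm (Nat.iter n (euler k) x -v Nat.iter (2 * n) (euler (S k)) x)
  <= Rmax 0 t * (M * ((M + 1) * (M * norm z))) / freq k).
{ eapply Rle_trans; [apply (euler_double k n x y z (M * norm z) Hx Hy) |].
  - intros j; apply euler_bound.
  - generalize (proj2 (steps_time k t)); fold n; intros H.
    replace (INR n * (M * (/ freq k ^ 2 * ((M + 1) * (M * norm z)))))
      with (INR n / freq k * (M * ((M + 1) * (M * norm z)) / freq k)) by (field; lra).
    replace (Rmax 0 t * (M * ((M + 1) * (M * norm z))) / freq k)
      with (Rmax 0 t * (M * ((M + 1) * (M * norm z)) / freq k)) by (field; lra).
    apply Rmult_le_compat_r; [| exact H].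
    apply Rmult_le_pos; [| apply Rlt_le, Rinv_0_lt_compat; lra].
    generalize (norm_nonneg z); intros.
    repeat (apply Rmult_le_pos; try lra). }
assert (H2 : norm (Nat.iter (steps (S k) t) (euler (S k)) x -v Nat.iter (2 * n) (euler (S k)) x)
  <= M * norm y / freq k).
{ assert (Hy0 : 0 <= M * norm y) by (apply Rmult_le_pos; [lra | apply norm_nonneg]).
  assert (Hq : 0 <= / freq k) by (apply Rlt_le, Rinv_0_lt_compat; lra).
  destruct (steps_S k t) as [-> | ->]; fold n.
  - replace (Nat.iter (2 * n) (euler (S k)) x -v Nat.iter (2 * n) (euler (S k)) x)
      with (vzero : W) by vec.
    rewrite norm_zero_vec; unfold Rdiv; now apply Rmult_le_pos.
  - rewrite Nat.add_1_r, (euler_iter_step (S k) (2 * n) x y Hx), freq_S.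
    rewrite norm_rscal by (apply Rlt_le, Rinv_0_lt_compat; lra).
    generalize (euler_bound (S k) (S (2 * n)) y); intros H.
    replace (M * norm y / freq k) with (/ (2 * freq k) * (2 * (M * norm y))) by (field; lra).
    apply Rmult_le_compat_l; [apply Rlt_le, Rinv_0_lt_compat |]; lra. }
eapply Rle_trans; [apply (norm_dist_triangle (Nat.iter (2 * n) (euler (S k)) x)) |].
rewrite (norm_minus_sym (Nat.iter (2 * n) (euler (S k)) x)).
replace ((Rmax 0 t * (M * ((M + 1) * (M * norm z))) + M * norm y) / (a + 1) * (/ 2) ^ k)
  with ((Rmax 0 t * (M * ((M + 1) * (M * norm z))) + M * norm y) / freq k).
- unfold Rdiv in *; lra.
- unfold freq; rewrite pow_inv; field; split; [apply pow_nonzero |]; lra.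
Qed.

(** Geometric convergence on the domain of G^2, then density and stability. In 2 M + 2, each of two
    indices contributes M for x - v and 1 for the distance to the limit at v. *)
Lemma approx_converges t x : exists l, tends (fun k => approx k t x) l.
Proof.
apply cauchy_tends; intros eps Heps.
assert (HM : 0 < 2 * M + 2) by lra.
destruct (dom2_dense x (eps / (2 * M + 2))) as [v [y [z [Hv [Hy Hd]]]]];
  [now apply Rdiv_lt_0_compat |].
destruct (geometric_limit (fun k => approx k t v) _ (/ 2) ltac:(lra)
  (fun k => approx_S_dist k t v y z Hv Hy)) as [l [Hl _]].
destruct (Hl (eps / (2 * M + 2))) as [N HN]; [now apply Rdiv_lt_0_compat |].
exists N; intros n m Hn Hm.
generalize (HN n Hn) (HN m Hm); cbv beta; rewrite (norm_minus_sym (approx m t v)).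
generalize (approx_bound n t (x -v v)) (approx_bound m t (v -v x)).
rewrite !approx_minus, (norm_minus_sym x v); intros H1 H2 H3 H4.
replace (approx n t x -v approx m t x) with
  ((approx n t x -v approx n t v) +v ((approx n t v -v l) +v (l -v approx m t v))
   +v (approx m t v -v approx m t x)) by vec.
eapply Rle_lt_trans; [apply norm_plus_le |].
eapply Rle_lt_trans; [apply Rplus_le_compat_r, norm_plus_le |].
eapply Rle_lt_trans; [apply Rplus_le_compat_r, Rplus_le_compat_l, norm_plus_le |].
assert (M * norm (v -v x) <= M * (eps / (2 * M + 2))) by (apply Rmult_le_compat_l; lra).
apply Rlt_le_trans with ((2 * M + 2) * (eps / (2 * M + 2))); [lra | right; field; lra].
Qed.

Definition semi (t : R) (x : W) : W :=
  proj1_sig (constructive_indefinite_description _ (approx_converges t x)).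

Lemma semi_tends t x : tends (fun k => approx k t x) (semi t x).
Proof. apply (proj2_sig (constructive_indefinite_description _ (approx_converges t x))). Qed.

Lemma semi_bound t x : norm (semi t x) <= M * norm x.
Proof. apply (tends_norm_le_const _ _ _ (semi_tends t x)); intros; apply approx_bound. Qed.

Lemma semi_linear t : is_linear (semi t).
Proof.
split.
- intros x y; apply (tends_unique _ _ _ (semi_tends t (x +v y))).
  assert (H : forall k, approx k t (x +v y) = approx k t x +v approx k t y).
  { intros k; unfold approx; induction (steps k t) as [|n IH]; [easy |].
    now rewrite !Nat.iter_succ, IH, op_plus. }
  intros eps Heps.
  destruct (tends_plus _ _ _ _ (semi_tends t x) (semi_tends t y) eps Heps) as [N HN].
  exists N; intros n Hn; rewrite H; now apply HN.
- intros c x; apply (tends_unique _ _ _ (semi_tends t (c *c x))).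
  assert (H : forall k, approx k t (c *c x) = c *c approx k t x).
  { intros k; unfold approx; induction (steps k t) as [|n IH]; [easy |].
    now rewrite !Nat.iter_succ, IH, op_scal. }
  generalize (tends_op (fun v : W => c *c v) _ _ (Cmod c)
    ltac:(intros; cbv beta; vec) (fun v => norm_scal (V := W) c v) (semi_tends t x)).
  intros Hc eps Heps; destruct (Hc eps Heps) as [N HN].
  exists N; intros n Hn; rewrite H; now apply HN.
- exists (M + 1); split; [lra |]; intros x.
  generalize (semi_bound t x) (norm_nonneg x); lra.
Qed.

Definition semigroup (t : R) : BoundedOp W W := Build_BoundedOp (semi_linear t).

Lemma semigroup_tends t x : tends (fun k => approx k t x) (semigroup t x).
Proof. apply semi_tends. Qed.

Lemma semigroup_bound t x : norm (semigroup t x) <= M * norm x.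
Proof. apply semi_bound. Qed.

Opaque semigroup.

Lemma semigroup_le0 t x : t <= 0 -> semigroup t x = x.
Proof.
intros Ht; apply (tends_unique _ _ _ (semigroup_tends t x)).
assert (H : forall k, approx k t x = x).
{ intros k; unfold approx; replace (steps k t) with 0%nat; [easy |].
  generalize (proj1 (steps_spec k t)); rewrite Rmax_left, Rmult_0_l by easy; intros H0.
  destruct (steps k t) as [|n]; [easy |].
  generalize (pos_INR n); rewrite S_INR in H0; lra. }
intros eps Heps; exists 0%nat; intros n _; rewrite H.
replace (x -v x) with (vzero : W) by vec; now rewrite norm_zero_vec.
Qed.

(** Step counts are additive up to one step, and by stability one extra step disappears in the
    limit. Stability also allows the limit inside the outer approximation. *)
Lemma semigroup_plus s t x : 0 <= s -> 0 <= t ->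
  semigroup (s + t) x = semigroup s (semigroup t x).
Proof.
intros Hs Ht; symmetry; apply (tends_unique (fun k => approx k s (approx k t x))).
- intros eps Heps.
  assert (HM : 0 < M + 1) by lra.
  destruct (semigroup_tends t x (eps / (M + 1))) as [N HN]; [now apply Rdiv_lt_0_compat |].
  destruct (semigroup_tends s (semigroup t x) (eps / (M + 1))) as [N' HN'];
    [now apply Rdiv_lt_0_compat |].
  exists (Nat.max N N'); intros n Hn.
  specialize (HN n ltac:(lia)); specialize (HN' n ltac:(lia)); cbv beta in HN, HN'.
  eapply Rle_lt_trans; [apply (norm_dist_triangle (approx n s (semigroup t x))) |].
  rewrite <- approx_minus.
  generalize (approx_bound n s (approx n t x -v semigroup t x)); intros H1.
  assert (M * norm (approx n t x -v semigroup t x) <= M * (eps / (M + 1)))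
    by (apply Rmult_le_compat_l; lra).
  apply Rlt_le_trans with ((M + 1) * (eps / (M + 1))); [lra | right; field; lra].
- apply (tends_ext_dist _ _ _ (semigroup_tends (s + t) x)); intros eps Heps.
  assert (HM : 0 < M + 1) by lra.
  destruct (euler_tends x (eps / (M + 1))) as [N HN]; [now apply Rdiv_lt_0_compat |].
  exists N; intros n Hn; specialize (HN n Hn); cbv beta in HN.
  replace (approx n s (approx n t x) -v approx n (s + t) x -v vzero)
    with (approx n s (approx n t x) -v approx n (s + t) x) by vec.
  unfold approx; rewrite iter_add_apply.
  destruct (steps_plus n s t Hs Ht) as [-> | ->].
  + match goal with |- norm (?u -v ?u) < _ => replace (u -v u) with (vzero : W) by vec end.
    now rewrite norm_zero_vec.
  + rewrite norm_minus_sym, Nat.add_1_r, Nat.iter_succ_r.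
    rewrite <- (iter_minus (euler n)) by apply op_minus.
    generalize (euler_bound n (steps n s + steps n t) (euler n x -v x)); intros H1.
    assert (M * norm (euler n x -v x) <= M * (eps / (M + 1)))
      by (apply Rmult_le_compat_l; lra).
    assert (He : 0 < eps / (M + 1)) by now apply Rdiv_lt_0_compat.
    apply Rlt_le_trans with ((M + 1) * (eps / (M + 1))); [lra | right; field; lra].
Qed.

Lemma semigroup_res_comm l t x : a < l -> Rs l (semigroup t x) = semigroup t (Rs l x).
Proof.
intros Hl; apply (tends_unique (fun k => approx k t (Rs l x))); [| apply semigroup_tends].
intros eps Heps.
destruct (tends_bop (Rs l) _ _ (semigroup_tends t x) eps Heps) as [N HN].
exists N; intros n Hn; unfold approx.
rewrite iter_comm by (intros; symmetry; now apply euler_comm).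
now apply HN.
Qed.

Lemma semigroup_dist t x y : G x y -> norm (semigroup t x -v x) <= Rmax 0 t * (M * norm y).
Proof.
intros H; apply (tends_dist_le _ _ _ _ 0 (semigroup_tends t x)); intros k _.
eapply Rle_trans; [apply (euler_dist _ _ _ _ H) |].
apply Rmult_le_compat_r; [apply Rmult_le_pos; [lra | apply norm_nonneg] |].
apply steps_time.
Qed.

Lemma semigroup_small x eps : 0 < eps ->
  exists d, 0 < d /\ forall t, t < d -> norm (semigroup t x -v x) < eps.
Proof.
intros Heps.
assert (HM : 0 < M + 2) by lra.
assert (He : 0 < eps / (M + 2)) by now apply Rdiv_lt_0_compat.
destruct (proj1 (closure_norm _ _) (G_dense x) _ He) as [v [[y Hy] Hv]].
assert (Hy1 : 0 < M * norm y + 1).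
{ generalize (Rmult_le_pos _ _ M_pos (norm_nonneg y)); lra. }
exists (eps / (M + 2) / (M * norm y + 1)); split; [now apply Rdiv_lt_0_compat |].
intros t Ht.
assert (H3 : Rmax 0 t * (M * norm y) <= eps / (M + 2)).
{ apply Rle_trans with (eps / (M + 2) / (M * norm y + 1) * (M * norm y + 1));
    [| right; field; lra].
  assert (0 < eps / (M + 2) / (M * norm y + 1)) by now apply Rdiv_lt_0_compat.
  generalize (Rmult_le_pos _ _ M_pos (norm_nonneg y)); intros.
  assert (Rmax 0 t <= eps / (M + 2) / (M * norm y + 1)) by (apply Rmax_lub; lra).
  apply Rmult_le_compat; try lra; apply Rmax_l. }
replace (semigroup t x -v x) with
  (semigroup t (x -v v) +v (semigroup t v -v v) +v (v -v x)) by (rewrite op_minus; vec).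
eapply Rle_lt_trans; [apply norm_plus_le |].
eapply Rle_lt_trans; [apply Rplus_le_compat_r, norm_plus_le |].
generalize (semigroup_dist t v y Hy) (semigroup_bound t (x -v v)).
rewrite (norm_minus_sym x v); intros H1 H2.
assert (M * norm (v -v x) <= M * (eps / (M + 2))) by (apply Rmult_le_compat_l; lra).
apply Rlt_le_trans with ((M + 2) * (eps / (M + 2))); [lra | right; field; lra].
Qed.

(** T(s) x - T(t) x = T(s) (x - T(t - s) x) for 0 <= s <= t, so continuity at 0 spreads
    uniformly. *)
Lemma semigroup_uniform x eps : 0 < eps ->
  exists d, 0 < d /\ forall s t, Rabs (s - t) < d ->
    norm (semigroup s x -v semigroup t x) < eps.
Proof.
intros Heps.
assert (HM : 0 < M + 1) by lra.
assert (He : 0 < eps / (M + 1)) by now apply Rdiv_lt_0_compat.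
destruct (semigroup_small x _ He) as [d [Hd H]].
exists d; split; [exact Hd |].
assert (Hpos : forall s t, 0 <= s <= t -> t - s < d ->
  norm (semigroup s x -v semigroup t x) < eps).
{ intros s t Hst Ht; replace t with (s + (t - s)) by ring.
  rewrite semigroup_plus by lra; rewrite <- op_minus.
  eapply Rle_lt_trans; [apply semigroup_bound |].
  rewrite norm_minus_sym; specialize (H (t - s) Ht).
  assert (M * norm (semigroup (t - s) x -v x) <= M * (eps / (M + 1)))
    by (apply Rmult_le_compat_l; lra).
  apply Rlt_le_trans with ((M + 1) * (eps / (M + 1))); [lra | right; field; lra]. }
assert (Hle : forall s t, s <= t -> t - s < d -> norm (semigroup s x -v semigroup t x) < eps).
{ intros s t Hst Ht; destruct (Rle_dec 0 s) as [Hs | Hs]; [apply Hpos; lra |].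
  rewrite (semigroup_le0 s) by lra.
  destruct (Rle_dec 0 t) as [Ht0 | Ht0].
  - rewrite <- (semigroup_le0 0 x) at 1 by lra; apply Hpos; lra.
  - rewrite (semigroup_le0 t) by lra.
    replace (x -v x) with (vzero : W) by vec; now rewrite norm_zero_vec. }
intros s t Hst; apply Rabs_def2 in Hst.
destruct (Rle_dec s t); [apply Hle; lra |].
rewrite norm_minus_sym; apply Hle; lra.
Qed.

(** The discrete Taylor estimate holds with constants independent of the mesh, because iterates of y
    stay near y up to time t on every mesh; it therefore passes to the limit. *)
Lemma semigroup_taylor x y e : G x y -> 0 < e ->
  exists d, 0 < d /\ forall t, 0 <= t < d ->
    norm (semigroup t x -v x -v t *v y) <= e * t.
Proof.
intros H He.
assert (HM : 0 < M + 2) by lra.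
assert (He1 : 0 < e / (M + 2)) by now apply Rdiv_lt_0_compat.
destruct (proj1 (closure_norm _ _) (G_dense y) _ He1) as [v [[z Hz] Hv]].
assert (Hz1 : 0 < M * norm z + 1).
{ generalize (Rmult_le_pos _ _ M_pos (norm_nonneg z)); lra. }
exists (e / (M + 2) / (M * norm z + 1)); split; [now apply Rdiv_lt_0_compat |].
intros t [Ht0 Ht].
assert (H3 : t * (M * norm z) <= e / (M + 2)).
{ apply Rle_trans with (e / (M + 2) / (M * norm z + 1) * (M * norm z + 1));
    [| right; field; lra].
  generalize (Rmult_le_pos _ _ M_pos (norm_nonneg z)); intros.
  apply Rmult_le_compat; lra. }
assert (Hk : forall k, norm (approx k t x -v x -v (INR (steps k t) / freq k) *v y) <= t * e).
{ intros k; generalize (steps_time k t); rewrite (Rmax_right 0 t) by lra; intros Hst.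
  eapply Rle_trans; [apply (euler_taylor k (steps k t) (steps k t) x y e H (Nat.le_refl _)) |].
  - intros j Hj.
    replace (Nat.iter j (euler k) y -v y) with
      (Nat.iter j (euler k) (y -v v) +v (Nat.iter j (euler k) v -v v) +v (v -v y)).
    2: { rewrite (iter_minus (euler k)) by apply op_minus; vec. }
    eapply Rle_trans; [apply norm_plus_le |].
    eapply Rle_trans; [apply Rplus_le_compat_r, norm_plus_le |].
    generalize (euler_dist k j v z Hz) (euler_bound k j (y -v v)).
    rewrite (norm_minus_sym y v); intros H1 H2.
    assert (H4 : INR j / freq k * (M * norm z) <= t * (M * norm z)).
    { apply Rmult_le_compat_r; [generalize (norm_nonneg z); nra |].
      apply Rle_trans with (INR (steps k t) / freq k); [| lra].
      apply Rmult_le_compat_r; [apply Rlt_le, Rinv_0_lt_compat, freq_pos | now apply le_INR]. }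
    assert (M * norm (v -v y) <= M * (e / (M + 2))) by (apply Rmult_le_compat_l; lra).
    apply Rle_trans with ((M + 2) * (e / (M + 2))); [lra | right; field; lra].
  - apply Rmult_le_compat_r; lra. }
(* The time elapsed after [steps k t] steps falls short of t by less than one step, which accounts
   for the error |y| / freq k. *)
assert (Hlim : tends (fun k => approx k t x -v x -v (INR (steps k t) / freq k) *v y)
  (semigroup t x -v x -v t *v y)).
{ apply (tends_ext_dist (fun k => approx k t x +v (opp x -v t *v y))).
  - replace (semigroup t x -v x -v t *v y) with (semigroup t x +v (opp x -v t *v y)) by vec.
    apply tends_plus; [apply semigroup_tends | apply tends_const].
  - apply tends_le_seq with (fun k => norm y / freq k); [| apply freq_inv_lim].
    intros k; generalize (freq_pos k) (steps_spec k t); rewrite (Rmax_right 0 t) by lra.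
    intros Hf Hs.
    replace (approx k t x -v x -v INR (steps k t) / freq k *v y
       -v (approx k t x +v (opp x -v t *v y)) -v vzero)
      with ((t - INR (steps k t) / freq k) *v y) by vec.
    eapply Rle_trans; [apply norm_rscal_le |].
    rewrite Rmult_comm; apply Rmult_le_compat_l; [apply norm_nonneg |].
    replace (t - INR (steps k t) / freq k) with ((t * freq k - INR (steps k t)) / freq k)
      by (field; lra).
    assert (0 < / freq k) by (apply Rinv_0_lt_compat; lra).
    apply Rabs_le_between; unfold Rdiv; split; nra. }
rewrite Rmult_comm; now apply (tends_norm_le_const _ _ _ Hlim).
Qed.

Lemma semigroup_strongly_continuous : strongly_continuous semigroup.
Proof.
intros x t _; apply (proj2 (filterlim_norm_iff (W := W) _ _ _)); intros eps Heps.
destruct (semigroup_uniform x eps Heps) as [d [Hd H]].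
exists (mkposreal d Hd); intros s Hs _; apply H; exact Hs.
Qed.

(** For the converse, the resolvent is applied to the difference quotient at x. It commutes with the
    semigroup and maps into the domain, where the derivative is known, so Rs l y = l Rs l x - x.
    Hence x = Rs l (l x - y) lies in the domain, with image y. *)
Lemma semigroup_generator x y : G x y <->
  filterlim (fun t => scal (RtoC (/ t)) (minus (semigroup t x) x)) (at_right 0) (locally y).
Proof.
assert (Hto : forall x y, G x y -> forall eps, 0 < eps ->
  at_right 0 (fun t => norm ((/ t) *v (semigroup t x -v x) -v y) < eps)).
{ clear x y; intros x y H eps Heps.
  destruct (semigroup_taylor x y (eps / 2) H ltac:(lra)) as [d [Hd Hs]].
  exists (mkposreal d Hd); intros t Ht Ht0.
  change (Rabs (t - 0) < d) in Ht; rewrite Rminus_0_r in Ht; apply Rabs_def2 in Ht.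
  replace ((/ t) *v (semigroup t x -v x) -v y) with ((/ t) *v (semigroup t x -v x -v t *v y))
    by vec.
  assert (Hi : 0 < / t) by now apply Rinv_0_lt_compat.
  rewrite norm_rscal by lra.
  apply Rle_lt_trans with (/ t * (eps / 2 * t)).
  - apply Rmult_le_compat_l; [lra | apply Hs; lra].
  - replace (/ t * (eps / 2 * t)) with (eps / 2) by (field; lra); lra. }
split.
- intros H; apply (proj2 (filterlim_norm_iff (W := W) _ _ _)); now apply Hto.
- intros H; generalize (proj1 (filterlim_norm_iff (W := W) (at_right 0) _ y) H); clear H; intros H.
  set (l := a + 1); assert (Hl : a < l) by (unfold l; lra).
  assert (HR : Rs l y = l *v Rs l x -v x).
  { destruct (op_bound (Rs l)) as [K [HK0 HK]].
    apply vec_eq_of_dist; intros eps Heps.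
    assert (He : 0 < eps / (K + 1)) by (apply Rdiv_lt_0_compat; lra).
    generalize (filter_and _ _ (H _ He) (Hto _ _ (res_dom l x Hl) _ He)); intros HF.
    destruct (filter_ex _ HF) as [t [H1 H2]].
    rewrite <- (semigroup_res_comm l t x Hl), <- op_minus, <- op_scal in H2.
    eapply Rle_lt_trans; [apply (norm_dist_triangle (Rs l ((/ t) *v (semigroup t x -v x)))) |].
    rewrite (norm_minus_sym (Rs l y)), <- op_minus.
    assert (H3 := HK ((/ t) *v (semigroup t x -v x) -v y)).
    change (norm ((/ t) *v (semigroup t x -v x) -v y) < eps / (K + 1)) in H1.
    assert (K * norm (/ t *v (semigroup t x -v x) -v y) <= K * (eps / (K + 1)))
      by (apply Rmult_le_compat_l; lra).
    apply Rlt_le_trans with ((K + 1) * (eps / (K + 1))); [lra | right; field; lra]. }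
  generalize (res_dom l (l *v x -v y) Hl).
  rewrite op_minus, op_scal, HR.
  replace (l *v Rs l x -v (l *v Rs l x -v x)) with x by vec.
  now replace (l *v x -v (l *v x -v y)) with y by vec.
Qed.

Lemma hille_yosida_C0 : generates_C0_semigroup G.
Proof.
exists semigroup; split; [| split; [| split]].
- intros x; apply semigroup_le0; lra.
- intros s t Hs Ht x; now apply semigroup_plus.
- exact semigroup_strongly_continuous.
- exact semigroup_generator.
Qed.

(** Extended by the identity, the orbit has left derivative 0 and right derivative y at 0. The term
    with [Rmin s 0] vanishes for s >= 0 and supplies the left slope, so that the derivative is
    two-sided. *)
Lemma semigroup_derive x y t : G x y -> 0 <= t ->
  is_derive (V := real_Banach W) (fun s => semigroup s x +v Rmin s 0 *v y) t (semigroup t y).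
Proof.
intros H Ht; apply is_derive_of_dist; intros e He.
assert (HM : 0 < M + 1) by lra.
assert (He1 : 0 < e / (M + 1)) by now apply Rdiv_lt_0_compat.
destruct (semigroup_taylor x y _ H He1) as [d1 [Hd1 H1]].
destruct (semigroup_uniform y _ He1) as [d2 [Hd2 H2]].
(* For t > 0 the radius is at most t, so that s stays positive; negative s occur only at t = 0. *)
set (d := if Rle_dec t 0 then Rmin d1 d2 else Rmin t (Rmin d1 d2)).
exists d; split.
{ unfold d, Rmin; repeat destruct (Rle_dec _ _); lra. }
intros s Hs.
assert (Hd : d <= d1 /\ d <= d2 /\ (0 < t -> d <= t)).
{ unfold d, Rmin; repeat destruct (Rle_dec _ _); lra. }
assert (HeM : (M + 1) * (e / (M + 1)) = e) by (field; lra).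
rewrite (Rmin_right t 0) by lra.
destruct (Rle_dec t s) as [Hts | Hts].
- rewrite (Rmin_right s 0) by lra; rewrite Rabs_pos_eq in * by lra.
  replace s with (t + (s - t)) at 1 by ring; rewrite semigroup_plus by lra.
  replace (semigroup t (semigroup (s - t) x) +v 0 *v y -v (semigroup t x +v 0 *v y)
    -v (s - t) *v semigroup t y)
    with (semigroup t (semigroup (s - t) x -v x -v (s - t) *v y))
    by (rewrite !op_minus, op_scal; vec).
  eapply Rle_trans; [apply semigroup_bound |].
  generalize (Rmult_le_compat_l _ _ _ M_pos (H1 (s - t) ltac:(lra))); intros H3.
  assert (0 <= e / (M + 1) * (s - t)) by (apply Rmult_le_pos; lra).
  replace (e * (s - t)) with ((M + 1) * (e / (M + 1) * (s - t))) by (rewrite <- HeM at 2; ring).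
  lra.
- assert (Hst : Rabs (s - t) = t - s) by (rewrite Rabs_left; lra).
  rewrite Hst in *.
  destruct (Rle_dec 0 s) as [Hs0 | Hs0].
  + rewrite (Rmin_right s 0) by lra.
    (* From the left, T(s) acts on the Taylor remainder for the time t - s. The derivative then
       appears at s instead of t, which uniform continuity of the orbit of y corrects. *)
    replace t with (s + (t - s)) at 1 by ring; rewrite semigroup_plus by lra.
    replace (semigroup s x +v 0 *v y -v (semigroup s (semigroup (t - s) x) +v 0 *v y)
        -v (s - t) *v semigroup t y)
      with (opp (semigroup s (semigroup (t - s) x -v x -v (t - s) *v y))
        -v (t - s) *v (semigroup s y -v semigroup t y))
      by (rewrite !op_minus, op_scal; vec).
    eapply Rle_trans; [apply norm_minus_le |].
    rewrite norm_rscal by lra; rewrite (norm_opp (V := W)).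
    generalize (Rmult_le_compat_l _ _ _ M_pos (H1 (t - s) ltac:(lra)))
      (semigroup_bound s (semigroup (t - s) x -v x -v (t - s) *v y)); intros H3 H4.
    assert (H5 : norm (semigroup s y -v semigroup t y) <= e / (M + 1)).
    { left; apply H2; rewrite Hst; lra. }
    apply Rmult_le_compat_l with (r := t - s) in H5; [| lra].
    replace (e * (t - s)) with ((M + 1) * (e / (M + 1) * (t - s))) by (rewrite <- HeM at 2; ring).
    lra.
  + assert (t = 0) by lra; subst t.
    rewrite !semigroup_le0 by lra; rewrite (Rmin_left s 0) by lra.
    replace (x +v s *v y -v (x +v 0 *v y) -v (s - 0) *v y) with (vzero : W) by vec.
    rewrite norm_zero_vec; apply Rmult_le_pos; lra.
Qed.

Lemma semigroup_cont x t : continuous (U := real_Banach W) (fun s => semigroup s x) t.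
Proof.
apply (proj2 (filterlim_norm_iff (W := W) (locally t) (fun s => semigroup s x) _)).
intros eps Heps; destruct (semigroup_uniform x eps Heps) as [d [Hd H]].
exists (mkposreal d Hd); intros s Hs; apply H; exact Hs.
Qed.

(** As x = l v - G v, the integrand is the derivative of - exp (- l t) T(t) v; [phi] stands for T(t)
    v because it is differentiable at 0 from both sides. *)
Lemma semigroup_laplace l x b : a < l -> 0 <= b ->
  is_RInt (V := real_Banach W) (fun t => exp (- l * t) *v semigroup t x) 0 b
    (Rs l x -v exp (- l * b) *v semigroup b (Rs l x)).
Proof.
intros Hl Hb.
set (v := Rs l x); set (y := l *v v -v x).
set (phi := fun s => semigroup s v +v Rmin s 0 *v y).
replace (v -v exp (- l * b) *v semigroup b v)
  with ((- exp (- l * b)) *v phi b -v (- exp (- l * 0)) *v phi 0).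
2: { unfold phi; rewrite !Rmin_right, (semigroup_le0 0), Rmult_0_r, exp_0 by lra; vec. }
assert (Hv : G v y) by now apply res_dom.
apply (is_RInt_ext (V := real_Banach W))
  with (fun t => (l * exp (- l * t)) *v phi t +v (- exp (- l * t)) *v semigroup t y).
{ intros t Ht; rewrite Rmin_left, Rmax_right in Ht by lra.
  change ((l * exp (- l * t)) *v phi t +v (- exp (- l * t)) *v semigroup t y
    = exp (- l * t) *v semigroup t x).
  unfold phi, y; rewrite Rmin_right, op_minus, op_scal by lra; vec. }
apply (is_RInt_scal_derive (V := real_Banach W) (fun t => - exp (- l * t)) phi
  (fun t => l * exp (- l * t)) (fun t => semigroup t y)).
- intros t _; auto_derive; [easy | ring].
- intros t Ht; rewrite Rmin_left in Ht by lra; apply semigroup_derive; [exact Hv | lra].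
- intros t _; apply (ex_derive_continuous (V := R_NormedModule)); auto_derive; easy.
- intros t _; apply semigroup_cont.
Qed.

Lemma generator_resolvent l : a < l -> is_resolvent (id_op W) G (RtoC l) (Rs l).
Proof.
intros Hl z x; split.
- intros [y [Hy ->]]; exact (res_inv l x y Hl Hy).
- intros <-; exists (l *v Rs l z -v z); split; [now apply res_dom |].
  change (z = l *v Rs l z -v (l *v Rs l z -v z)); vec.
Qed.

Lemma hille_yosida_integrated k : generates_integrated_semigroup k G.
Proof.
split; [exact G_linear |].
set (S := integrated semigroup M M_pos semigroup_bound semigroup_cont k).
(* The rate a + 1 exceeds both a, beyond which resolvents exist, and 1, the growth rate of the
   iterated integrals. *)
exists S, (M * INR (fact k) + 1), (a + 1).
split; [| split; [| split; [| split]]].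
- generalize (Rmult_le_pos _ _ M_pos (pos_INR (fact k))); lra.
- lra.
- intros x t _; eapply filterlim_filter_le_1; [apply filter_le_within |].
  apply (iterated_integral_cont semigroup semigroup_cont k x t).
- intros t Ht x; eapply Rle_trans; [now apply integrated_exp_bound |].
  apply Rmult_le_compat_r; [apply norm_nonneg |].
  apply Rmult_le_compat_l.
  + generalize (Rmult_le_pos _ _ M_pos (pos_INR (fact k))); lra.
  + destruct (Rle_lt_or_eq_dec _ _ Ht) as [H0 | <-].
    * left; apply exp_increasing; nra.
    * rewrite !Rmult_0_r; lra.
- intros l Hl.
  assert (Hres := generator_resolvent l ltac:(lra)).
  split; [now exists (Rs l) |]; intros x.
  exists ((/ l ^ k) *v Rs l x); split.
  + apply integrated_laplace; [lra |].
    intros b Hb; apply semigroup_laplace; lra.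
  + rewrite (resolvent_unique _ _ _ _ x Hres).
    assert (l ^ k <> 0) by (apply pow_nonzero; lra).
    change (Rs l x = l ^ k *v (/ l ^ k *v Rs l x)); vec.
Qed.

End HilleYosida.

(** * The port-Hamiltonian pencil *)

Lemma closed_of_closure {W : Normed} (D : W -> Prop) :
  (forall x, closure (T := W) D x -> D x) -> closed (T := W) D.
Proof.
intros H x Hx; apply H; intros eps; apply NNPP; intros Hn; apply Hx.
exists eps; intros y Hy HD; apply Hn; now exists y.
Qed.

Lemma closed_closure {W : Normed} (D : W -> Prop) x :
  closed (T := W) D -> closure (T := W) D x -> D x.
Proof.
intros H Hx; apply H; intros [eps He].
destruct (Hx eps) as [y [Dy Hy]]; exact (He y Hy Dy).
Qed.

Lemma closure_map {V W : Normed} (T : BoundedOp V W) (D : V -> Prop) (D' : W -> Prop) x :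
  (forall y, D y -> D' (T y)) -> closure (T := V) D x -> closure (T := W) D' (T x).
Proof.
intros H Hx; apply closure_norm; intros eps Heps.
destruct (op_bound T) as [M [HM0 HM]].
destruct (proj1 (closure_norm _ _) Hx (eps / M)) as [y [Dy Hy]];
  [now apply Rdiv_lt_0_compat |].
exists (T y); split; [now apply H |].
rewrite <- op_minus; eapply Rle_lt_trans; [apply HM |].
apply Rmult_lt_compat_l with (r := M) in Hy; [| exact HM0].
replace (M * (eps / M)) with eps in Hy by (field; lra); exact Hy.
Qed.

(** * Generation on a closed invariant subspace *)

Section SubspaceGeneration.

Context {V : Banach}.
Variables (V1 : ClosedSubspace V) (P : R -> BoundedOp V V) (w0 M : R) (G : Graph V1 V1).
Hypothesis w0_pos : 0 < w0.
Hypothesis M_pos : 0 <= M.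
Hypothesis G_linear : linear_operator G.
Hypothesis P_inv : forall l, w0 < l -> forall x, V1 x -> V1 (P l x).
Hypothesis P_dom : forall l (u v : V1), w0 < l -> embed v = P l (embed u) ->
  G v (l *v v -v u).
Hypothesis P_left : forall l (x y : V1), w0 < l -> G x y ->
  P l (l *v embed x -v embed y) = embed x.
Hypothesis P_bound : forall l n x, w0 < l -> V1 x ->
  norm (Nat.iter n (P l) x) <= M / l ^ n * norm x.
Hypothesis P_dense : forall x eps, V1 x -> 0 < eps ->
  exists l u, w0 < l /\ V1 u /\ norm (P l u -v x) < eps.

Lemma restricted_linear l (h : w0 < l) :
  is_linear (fun x : V1 => exist _ (P l (embed x)) (P_inv l h _ (proj2_sig x)) : V1).
Proof.
split.
- intros x y; apply sub_eq; apply (op_plus (P l)).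
- intros k x; apply sub_eq; apply (op_scal (P l)).
- destruct (op_bound (P l)) as [K [HK0 HK]].
  exists K; split; [exact HK0 |]; intros x; apply HK.
Qed.

(** The zero operator is a default for l <= w0, where invariance of [V1] is not given. *)
Definition restricted (l : R) : BoundedOp V1 V1 :=
  match Rlt_dec w0 l with
  | left h => Build_BoundedOp (restricted_linear l h)
  | right _ => zero_op V1 V1
  end.

Lemma embed_restricted l x : w0 < l -> embed (restricted l x) = P l (embed x).
Proof.
intros Hl; unfold restricted; destruct (Rlt_dec w0 l) as [h | h]; [easy | lra].
Qed.

Lemma embed_iter_restricted l n x : w0 < l ->
  embed (Nat.iter n (restricted l) x) = Nat.iter n (P l) (embed x).
Proof.
intros Hl; induction n as [|n IH]; [easy |].
rewrite !Nat.iter_succ, <- IH; now apply embed_restricted.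
Qed.

Lemma restricted_dom l (u : V1) : w0 < l -> G (restricted l u) (l *v restricted l u -v u).
Proof. intros Hl; apply P_dom; [exact Hl | now apply embed_restricted]. Qed.

Lemma restricted_inv l (x y : V1) : w0 < l -> G x y -> restricted l (l *v x -v y) = x.
Proof.
intros Hl H; apply sub_eq.
etransitivity; [apply (embed_restricted l _ Hl) |]; now apply P_left.
Qed.

Lemma restricted_bound l n (x : V1) : w0 < l ->
  norm (Nat.iter n (restricted l) x) <= M / l ^ n * norm x.
Proof.
intros Hl; change (norm (embed (Nat.iter n (restricted l) x)) <= M / l ^ n * norm (embed x)).
rewrite embed_iter_restricted by exact Hl; apply P_bound; [exact Hl | apply (proj2_sig x)].
Qed.

Lemma subspace_dom_dense (x : V1) : closure (T := V1) (dom G) x.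
Proof.
apply (closure_norm (W := V1)); intros eps Heps.
destruct (P_dense (embed x) eps (proj2_sig x) Heps) as [l [u [Hl [Hu H]]]].
exists (restricted l (exist _ u Hu)); split; [eexists; now apply restricted_dom |].
change (norm (embed (restricted l (exist _ u Hu)) -v embed x) < eps).
now rewrite embed_restricted.
Qed.

Lemma subspace_generates_C0 : generates_C0_semigroup G.
Proof.
exact (hille_yosida_C0 G restricted w0 M w0_pos M_pos G_linear restricted_dom restricted_inv
  restricted_bound subspace_dom_dense).
Qed.

Lemma subspace_generates_integrated k : generates_integrated_semigroup k G.
Proof.
exact (hille_yosida_integrated G restricted w0 M w0_pos M_pos G_linear restricted_dom
  restricted_inv restricted_bound subspace_dom_dense k).
Qed.

End SubspaceGeneration.

(** * Resolvents of the pencil *)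

Section Pencil.

Context {X Z : Normed}.
Variables (E : BoundedOp X Z) (B : Graph X Z) (w0 : R).
Hypothesis pencil_rho : forall l, w0 < l -> rho E B (RtoC l).

Definition pres (l : R) : BoundedOp Z X := resolvent E B (RtoC l).
Definition right_res (l : R) : BoundedOp X X := comp_op (pres l) E.
Definition left_res (l : R) : BoundedOp Z Z := comp_op E (pres l).

Lemma pres_graph l z : w0 < l -> B (pres l z) (l *v E (pres l z) -v z).
Proof.
intros Hl.
destruct (proj2 (resolvent_spec E B _ (pencil_rho l Hl) z (pres l z)) eq_refl) as [y [Hy Hz]].
replace (l *v E (pres l z) -v z) with y; [exact Hy |].
change (z = l *v E (pres l z) -v y) in Hz.
rewrite Hz at 2; vec.
Qed.

Lemma pres_inv l x y : w0 < l -> B x y -> pres l (l *v E x -v y) = x.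
Proof.
intros Hl H; apply (resolvent_spec E B _ (pencil_rho l Hl)).
now exists y.
Qed.

Lemma pres_identity l m z : w0 < l -> w0 < m ->
  pres l z -v pres m z = (m - l) *v pres l (E (pres m z)).
Proof.
intros Hl Hm; generalize (pres_inv l _ _ Hl (pres_graph m z Hm)).
rewrite !op_minus, !op_scal; intros H.
set (u := pres l (E (pres m z))) in *; set (v := pres m z) in *; rewrite <- H; vec.
Qed.

Lemma right_res_identity l m : w0 < l -> w0 < m -> forall x,
  right_res l x -v right_res m x = (m - l) *v right_res l (right_res m x).
Proof. intros Hl Hm x; now apply (pres_identity l m (E x)). Qed.

Lemma left_res_identity l m : w0 < l -> w0 < m -> forall z,
  left_res l z -v left_res m z = (m - l) *v left_res l (left_res m z).
Proof.
intros Hl Hm z; change (E (pres l z) -v E (pres m z) = (m - l) *v E (pres l (E (pres m z)))).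
now rewrite <- op_minus, pres_identity, op_scal.
Qed.

Lemma pres_swap l m z : w0 < l -> w0 < m -> pres l (E (pres m z)) = pres m (E (pres l z)).
Proof.
intros Hl Hm; destruct (Req_dec l m) as [-> | Hlm]; [easy |].
generalize (pres_identity l m z Hl Hm) (pres_identity m l z Hm Hl).
set (u := pres l (E (pres m z))); set (v := pres m (E (pres l z))); intros H1 H2.
replace u with (/ (m - l) *v ((m - l) *v u)) by vec.
rewrite <- H1; replace (pres l z -v pres m z) with (opp (pres m z -v pres l z)) by vec.
rewrite H2; vec.
Qed.

(** E (lE - B)^-1 E reads as E after a right resolvent or as a left resolvent after E. This
    intertwining sends X1 into Z1; the next lemma gives the way back. *)
Lemma E_prod (lam : nat -> R) n x :
  E (prod_op (fun k => right_res (lam k)) n x) = prod_op (fun k => left_res (lam k)) n (E x).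
Proof.
revert x; induction n as [|n IH]; intros x; [easy |].
exact (IH (right_res (lam (S n)) x)).
Qed.

Lemma pres_prod (lam : nat -> R) n l z : w0 < l -> (forall k, (k <= n)%nat -> w0 < lam k) ->
  pres l (prod_op (fun k => left_res (lam k)) n z)
    = prod_op (fun k => right_res (lam k)) n (pres l z).
Proof.
intros Hl; revert z; induction n as [|n IH]; intros z Hlam.
- apply pres_swap; auto.
- change (pres l (prod_op (fun k => left_res (lam k)) n (left_res (lam (S n)) z))
    = prod_op (fun k => right_res (lam k)) n (right_res (lam (S n)) (pres l z))).
  rewrite IH by auto; f_equal; apply pres_swap; auto.
Qed.

Lemma left_iter_E l n x : Nat.iter n (left_res l) (E x) = E (Nat.iter n (right_res l) x).
Proof.
induction n as [|n IH]; [easy |]; rewrite !Nat.iter_succ, IH; easy.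
Qed.

End Pencil.

(** * The Hamiltonian form *)

Section PortHamiltonian.

Context {X Z : Hilbert}.
Variables (E Q : BoundedOp X Z) (A : Graph Z Z).
Hypothesis pH : pHDAE E A Q.

Let B : Graph X Z := graph_AQ A Q.

(* The form [rinner x (energy y)] is the (possibly degenerate) Hamiltonian
   inner product. *)
Definition energy : BoundedOp X X := comp_op (adjoint Q) E.

Lemma energy_form x y : rinner (E x) (Q y) = rinner x (energy y).
Proof.
rewrite rinner_adjoint; f_equal; apply (ph_symmetric pH).
Qed.

Lemma energy_sym x y : rinner (energy x) y = rinner x (energy y).
Proof.
rewrite <- energy_form, (rinner_sym (energy x) y); change (energy x) with (adjoint Q (E x)).
rewrite <- rinner_adjoint; apply rinner_sym.
Qed.

Lemma energy_nonneg x : 0 <= rinner x (energy x).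
Proof.
rewrite rinner_sym; change (energy x) with (adjoint Q (E x)).
rewrite <- (ph_symmetric pH); apply (ph_nonneg pH).
Qed.

Lemma energy_cauchy_schwarz x y :
  rinner x (energy y) ^ 2 <= rinner x (energy x) * rinner y (energy y).
Proof.
apply discriminant_le; [apply energy_nonneg |]; intros t.
generalize (energy_nonneg (x +v t *v y)).
rewrite op_plus, op_scal, !rinner_plus_l, !rinner_plus_r, !rinner_rscal_l, !rinner_rscal_r.
rewrite <- (energy_sym y x), (rinner_sym (energy y) x); lra.
Qed.

(** With H = E^*Q, Cauchy-Schwarz for the form at H x and x gives |H x|^4 <= <H x, H H x> <x, H x>
    <= c |H x|^2 <x, H x>. *)
Lemma energy_lower : exists c, 0 < c /\
  forall x, norm (energy x) ^ 2 <= c * rinner x (energy x).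
Proof.
destruct (op_bound energy) as [c [Hc H]]; exists c; split; [exact Hc |]; intros x.
generalize (energy_cauchy_schwarz (energy x) x) (energy_nonneg x).
set (h := energy x) in *; rewrite (rinner_self h).
assert (H1 : rinner h (energy h) <= c * norm h ^ 2).
{ eapply Rle_trans; [apply Rle_abs |]; eapply Rle_trans; [apply rinner_le |].
  generalize (Rmult_le_compat_l _ _ _ (norm_nonneg h) (H h)); simpl; lra. }
intros H2 H3; fold h in H3.
destruct (Rle_lt_or_eq_dec _ _ (pow2_ge_0 (norm h))) as [Hp | <-];
  [| apply Rmult_le_pos; lra].
apply Rmult_le_reg_l with (norm h ^ 2); [exact Hp |].
generalize (Rmult_le_compat_r _ _ _ H3 H1); simpl in *; lra.
Qed.

Lemma energy_upper : exists c, 0 < c /\ forall x, rinner x (energy x) <= c * norm x ^ 2.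
Proof.
destruct (op_bound energy) as [c [Hc H]]; exists c; split; [exact Hc |]; intros x.
eapply Rle_trans; [apply Rle_abs |]; eapply Rle_trans; [apply rinner_le |].
generalize (Rmult_le_compat_l _ _ _ (norm_nonneg x) (H x)); simpl; lra.
Qed.

Lemma adjoint_Q_inverse : exists T : BoundedOp X Z,
  (forall z, T (adjoint Q z) = z) /\ (forall x, adjoint Q (T x) = x).
Proof.
destruct (ph_Q_invertible pH) as [Q' [H1 H2]].
exists (adjoint Q'); split.
- intros z; apply rinner_ext; intros v; rewrite rinner_sym, <- !rinner_adjoint, H2.
  apply rinner_sym.
- intros x; apply rinner_ext; intros v; rewrite rinner_sym, <- !rinner_adjoint, H1.
  apply rinner_sym.
Qed.

Lemma energy_kernel x : energy x = vzero -> E x = vzero.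
Proof.
intros H; destruct adjoint_Q_inverse as [T [HT _]].
rewrite <- (HT (E x)); change (adjoint Q (E x)) with (energy x); rewrite H; apply op_zero.
Qed.

(** The range is the image of ran E under the isomorphism Q^*, so closedness of ran E carries
    over. *)
Lemma energy_ran_closed : closed (T := X) (ran energy).
Proof.
destruct adjoint_Q_inverse as [T [HT HT']].
apply (closed_of_closure (W := X)); intros x Hx.
destruct (closed_closure (W := Z) (ran E) (T x) (ph_ran_closed pH)) as [y Hy].
- apply (closure_map T (ran energy)); [| exact Hx].
  intros y [v <-]; exists v; symmetry; apply HT.
- exists y; change (energy y) with (adjoint Q (E y)); now rewrite Hy, HT'.
Qed.

Lemma graph_AQ_linear : linear_operator B.
Proof.
split; unfold B, graph_AQ.
- intros x; apply (graph_fun (ph_linear pH)).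
- rewrite (op_zero Q); apply (graph_zero (ph_linear pH)).
- intros x y z w H1 H2; generalize (graph_plus (ph_linear pH) H1 H2).
  now rewrite <- (op_plus Q).
- intros k x z H; generalize (graph_scal (ph_linear pH) k H).
  now rewrite <- (op_scal Q).
Qed.

(** * Estimates on X1 and Z1 from radiality and dissipativity *)

Section Radial.

Variables (q : nat) (w0 K : R) (lam : nat -> R).
Hypothesis w0_pos : 0 < w0.
Hypothesis pencil_rho : forall l, w0 < l -> rho E B (RtoC l).
Hypothesis K_pos : 0 < K.
Hypothesis radial_bounds : forall mu : nat -> R, (forall k, (k <= q)%nat -> w0 < mu k) ->
  opnorm_le (right_prod E B mu q) (K / prod_f_R0 (fun k => Rabs (mu k - w0)) q) /\
  opnorm_le (left_prod E B mu q) (K / prod_f_R0 (fun k => Rabs (mu k - w0)) q).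
Hypothesis Hlam : forall k, (k <= q)%nat -> w0 < lam k.

Let Pr := right_res E B.
Let Pl := left_res E B.

Let X1 := space_X1 E B lam q.
Let Z1 := space_Z1 E B lam q.

Lemma right_limit x eps : X1 x -> 0 < eps -> exists L, w0 + 1 < L /\ forall l, L <= l ->
  norm ((l - (w0 + 1)) ^ (q + 1) *v Nat.iter (q + 1) (Pr l) x -v x) < eps.
Proof.
apply (radial_strong_limit Pr w0 K q).
- exact (right_res_identity E B w0 pencil_rho).
- exact K_pos.
- intros mu Hmu; exact (proj1 (radial_bounds mu Hmu)).
- exact Hlam.
Qed.

Lemma left_limit z eps : Z1 z -> 0 < eps -> exists L, w0 + 1 < L /\ forall l, L <= l ->
  norm ((l - (w0 + 1)) ^ (q + 1) *v Nat.iter (q + 1) (Pl l) z -v z) < eps.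
Proof.
apply (radial_strong_limit Pl w0 K q).
- exact (left_res_identity E B w0 pencil_rho).
- exact K_pos.
- intros mu Hmu; exact (proj2 (radial_bounds mu Hmu)).
- exact Hlam.
Qed.

Lemma X1_right_res l x : w0 < l -> X1 x -> X1 (Pr l x).
Proof.
intros Hl; apply (closure_map (Pr l) (ran (right_prod E B lam q)) (ran (right_prod E B lam q))).
intros y [v <-]; exists (Pr l v).
apply (prod_op_comm Pr w0); auto; exact (right_res_identity E B w0 pencil_rho).
Qed.

Lemma Z1_left_res l z : w0 < l -> Z1 z -> Z1 (Pl l z).
Proof.
intros Hl; apply (closure_map (Pl l) (ran (left_prod E B lam q)) (ran (left_prod E B lam q))).
intros y [v <-]; exists (Pl l v).
apply (prod_op_comm Pl w0); auto; exact (left_res_identity E B w0 pencil_rho).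
Qed.

Lemma E_X1 x : X1 x -> Z1 (E x).
Proof.
apply (closure_map E (ran (right_prod E B lam q)) (ran (left_prod E B lam q))).
intros y [v <-]; exists (E v); symmetry; apply (E_prod E B).
Qed.

Lemma pres_Z1 l z : w0 < l -> Z1 z -> X1 (pres E B l z).
Proof.
intros Hl; apply (closure_map (pres E B l) (ran (left_prod E B lam q)) (ran (right_prod E B lam q))).
intros y [v <-]; exists (pres E B l v); symmetry.
now apply (pres_prod E B w0).
Qed.

(** The decomposition provides a kernel element k, and radiality removes it, because the kernel of
    [energy] lies in that of E, on which every right resolvent vanishes. *)
Lemma X1_energy_bound : exists c, 0 < c /\
  forall x, X1 x -> norm x <= c * norm (energy x).
Proof.
destruct (selfadjoint_kernel_decomposition energy energy_sym energy_ran_closed)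
  as [c [Hc H]].
exists (K * c); split; [now apply Rmult_lt_0_compat |]; intros x Hx.
destruct (H x) as [k [Hk Hn]].
apply Rle_trans with (K * norm (x +v k)).
- apply (radial_kernel_bound Pr w0 K q) with (lam := lam).
  + exact (right_res_identity E B w0 pencil_rho).
  + exact K_pos.
  + intros mu Hmu; exact (proj1 (radial_bounds mu Hmu)).
  + exact Hlam.
  + exact Hx.
  + intros l Hl; change (Pr l k) with (pres E B l (E k)).
    rewrite (energy_kernel k Hk); apply op_zero.
- rewrite Rmult_assoc; apply Rmult_le_compat_l; [lra | exact Hn].
Qed.

Lemma X1_E_bound : exists c, 0 < c /\ forall x, X1 x -> norm x <= c * norm (E x).
Proof.
destruct X1_energy_bound as [c [Hc H]], (op_bound (adjoint Q)) as [M [HM0 HM]].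
exists (c * M); split; [now apply Rmult_lt_0_compat |]; intros x Hx.
eapply Rle_trans; [now apply H |]; rewrite Rmult_assoc.
apply Rmult_le_compat_l; [lra | apply HM].
Qed.

(** The scaled powers of left resolvents approximate z by images under E of elements of X1; the
    lower bound for E makes these preimages a Cauchy sequence. *)
Lemma E_X1_onto z : Z1 z -> exists x, X1 x /\ E x = z.
Proof.
intros Hz; destruct X1_E_bound as [c [Hc Hb]].
assert (Happ : forall n, exists x, X1 x /\ norm (E x -v z) < / INR (S n)).
{ intros n; assert (Hn : 0 < / INR (S n)) by (apply Rinv_0_lt_compat, lt_0_INR; lia).
  destruct (left_limit z _ Hz Hn) as [L [HL H]]; specialize (H L (Rle_refl _)).
  assert (Hit : forall m, Z1 (Nat.iter m (Pl L) z)).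
  { induction m as [|m IH]; [exact Hz |].
    rewrite Nat.iter_succ; apply Z1_left_res; [lra | exact IH]. }
  (* The outermost factor E of the power q + 1 is split off, leaving q left resolvents under
     [pres]. *)
  exists ((L - (w0 + 1)) ^ (q + 1) *v pres E B L (Nat.iter q (Pl L) z)); split.
  - apply (subspace_scal (c := X1)), pres_Z1; [lra | apply Hit].
  - rewrite op_scal, Nat.add_1_r; rewrite Nat.add_1_r, Nat.iter_succ in H; exact H. }
set (u := fun n => proj1_sig (constructive_indefinite_description _ (Happ n))).
assert (Hu : forall n, X1 (u n) /\ norm (E (u n) -v z) < / INR (S n)).
{ intros n; apply (proj2_sig (constructive_indefinite_description _ (Happ n))). }
clearbody u.
assert (Hinv : forall eps, 0 < eps -> exists N, forall n, (N <= n)%nat -> / INR (S n) < eps).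
{ intros eps Heps; destruct (archimed_cor1 eps Heps) as [N [HN HN0]].
  exists N; intros n Hn; eapply Rle_lt_trans; [| exact HN].
  apply Rinv_le_contravar; [now apply lt_0_INR | apply le_INR; lia]. }
assert (HEu : tends (fun n => E (u n)) z).
{ intros eps Heps; destruct (Hinv eps Heps) as [N HN]; exists N; intros n Hn.
  eapply Rlt_trans; [apply Hu | now apply HN]. }
destruct (cauchy_tends u) as [x Hx].
{ intros eps Heps; destruct (HEu (eps / (2 * c))) as [N HN];
    [apply Rdiv_lt_0_compat; lra |].
  exists N; intros n m Hn Hm.
  assert (Hnm : X1 (u n -v u m)).
  { replace (u n -v u m) with (u n +v (-1) *v u m) by vec.
    apply (subspace_plus (c := X1)); [apply Hu | apply (subspace_scal (c := X1)), Hu]. }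
  eapply Rle_lt_trans; [now apply Hb |]; rewrite op_minus.
  specialize (HN n Hn) as H1; specialize (HN m Hm) as H2; cbv beta in H1, H2.
  rewrite (norm_minus_sym (E (u m))) in H2.
  assert (H3 := norm_dist_triangle z (E (u n)) (E (u m))).
  apply Rlt_le_trans with (c * (2 * (eps / (2 * c)))); [| right; field; lra].
  apply Rmult_lt_compat_l; lra. }
exists x; split.
- apply (closed_tends X1 u); [exact (@subspace_closed X X1) | apply Hu | exact Hx].
- apply (tends_unique (fun n => E (u n))); [now apply tends_bop | exact HEu].
Qed.

(** For v = P(l) x, A Q v = l E v - E x; pairing with Q v gives l <v, v> <= <x, v> in the form.
    Cauchy-Schwarz and division by <v, v> do the rest. *)
Lemma energy_dissipation l x : w0 < l ->
  l ^ 2 * rinner (Pr l x) (energy (Pr l x)) <= rinner x (energy x).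
Proof.
intros Hl; set (v := Pr l x).
assert (Hv : B v (l *v E v -v E x)) by exact (pres_graph E B w0 pencil_rho l (E x) Hl).
assert (Hd : rinner (l *v E v -v E x) (Q v) <= 0) by exact (ph_dissipative pH Hv).
rewrite rinner_minus_l, rinner_rscal_l, !energy_form in Hd.
generalize (energy_nonneg x) (energy_nonneg v) (energy_cauchy_schwarz x v).
set (a := rinner v (energy v)) in *; set (b := rinner x (energy v)) in *.
set (d := rinner x (energy x)); intros Hd0 Ha Hb.
destruct (Rle_lt_or_eq_dec _ _ Ha) as [Hp | <-]; [| lra].
apply Rmult_le_reg_r with a; [exact Hp |].
eapply Rle_trans; [| exact Hb].
replace (l ^ 2 * a * a) with ((l * a) ^ 2) by ring.
apply pow_incr; split; [apply Rmult_le_pos |]; lra.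
Qed.

Lemma energy_dissipation_iter l n x : w0 < l ->
  (l ^ n) ^ 2 * rinner (Nat.iter n (Pr l) x) (energy (Nat.iter n (Pr l) x))
    <= rinner x (energy x).
Proof.
intros Hl; induction n as [|n IH]; [simpl; lra |].
eapply Rle_trans; [| exact IH]; rewrite Nat.iter_succ.
replace ((l ^ S n) ^ 2) with ((l ^ n) ^ 2 * l ^ 2) by (simpl; ring).
rewrite Rmult_assoc; apply Rmult_le_compat_l; [apply pow2_ge_0 |].
now apply energy_dissipation.
Qed.

(** Only the seminorm of the form contracts, so it is compared with the norm once before and once
    after all n steps; the constant therefore does not depend on n. *)
Lemma right_iter_bound : exists M, 0 <= M /\ forall l n x, w0 < l -> X1 x ->
  norm (Nat.iter n (Pr l) x) <= M / l ^ n * norm x.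
Proof.
destruct X1_energy_bound as [c1 [Hc1 H1]], energy_lower as [c2 [Hc2 H2]],
  energy_upper as [c3 [Hc3 H3]].
assert (Hc : 0 < c1 ^ 2 * c2 * c3).
{ repeat apply Rmult_lt_0_compat; try lra. }
(* The estimate is for squares; d <= (d + 1)^2 avoids a square root. *)
exists (c1 ^ 2 * c2 * c3 + 1); split; [lra |]; intros l n x Hl Hx.
assert (Hit : X1 (Nat.iter n (Pr l) x)).
{ induction n as [|n IH]; [exact Hx |].
  rewrite Nat.iter_succ; now apply X1_right_res. }
set (y := Nat.iter n (Pr l) x) in *.
assert (Hln : 0 < l ^ n) by (apply pow_lt; lra).
assert (Hy : norm y ^ 2 <= c1 ^ 2 * c2 * rinner y (energy y)).
{ apply Rle_trans with ((c1 * norm (energy y)) ^ 2).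
  - apply pow_incr; split; [apply norm_nonneg | now apply H1].
  - rewrite Rpow_mult_distr, Rmult_assoc; apply Rmult_le_compat_l; [apply pow2_ge_0 | apply H2]. }
assert (Hy2 : (l ^ n * norm y) ^ 2 <= c1 ^ 2 * c2 * c3 * norm x ^ 2).
{ rewrite Rpow_mult_distr.
  generalize (energy_dissipation_iter l n x Hl); fold y; intros H4.
  assert (H5 := H3 x).
  assert (0 <= (l ^ n) ^ 2) by apply pow2_ge_0.
  apply Rle_trans with ((l ^ n) ^ 2 * (c1 ^ 2 * c2 * rinner y (energy y))).
  { now apply Rmult_le_compat_l. }
  replace ((l ^ n) ^ 2 * (c1 ^ 2 * c2 * rinner y (energy y)))
    with (c1 ^ 2 * c2 * ((l ^ n) ^ 2 * rinner y (energy y))) by ring.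
  replace (c1 ^ 2 * c2 * c3 * norm x ^ 2) with (c1 ^ 2 * c2 * (c3 * norm x ^ 2)) by ring.
  apply Rmult_le_compat_l; [apply Rmult_le_pos; [apply pow2_ge_0 | lra] | lra]. }
assert (Hy3 : l ^ n * norm y <= (c1 ^ 2 * c2 * c3 + 1) * norm x).
{ apply Rsqr_incr_0.
  - rewrite !Rsqr_pow2; eapply Rle_trans; [exact Hy2 |].
    rewrite Rpow_mult_distr; apply Rmult_le_compat_r; [apply pow2_ge_0 |].
    set (d := c1 ^ 2 * c2 * c3) in *; nra.
  - apply Rmult_le_pos; [lra | apply norm_nonneg].
  - apply Rmult_le_pos; [lra | apply norm_nonneg]. }
apply Rmult_le_reg_l with (l ^ n); [exact Hln |].
eapply Rle_trans; [exact Hy3 |]; right; field; lra.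
Qed.

Lemma left_iter_bound : exists M, 0 <= M /\ forall l n z, w0 < l -> Z1 z ->
  norm (Nat.iter n (Pl l) z) <= M / l ^ n * norm z.
Proof.
destruct right_iter_bound as [M [HM H]], X1_E_bound as [c [Hc Hb]],
  (op_bound E) as [e [He HE]].
exists (e * M * c); split.
{ repeat apply Rmult_le_pos; lra. }
intros l n z Hl Hz; destruct (E_X1_onto z Hz) as [x [Hx <-]].
unfold Pl; rewrite left_iter_E.
assert (Hln : 0 < l ^ n) by (apply pow_lt; lra).
assert (Hln' : 0 < / l ^ n) by now apply Rinv_0_lt_compat.
eapply Rle_trans; [apply HE |].
replace (e * M * c / l ^ n * norm (E x)) with (e * (M / l ^ n * (c * norm (E x))))
  by (field; lra).
apply Rmult_le_compat_l; [lra |].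
eapply Rle_trans; [now apply H |].
apply Rmult_le_compat_l; [| now apply Hb].
apply Rmult_le_pos; lra.
Qed.

(** * Generation on X1 and Z1 *)

Let E1 : Graph X1 Z1 := restrict_graph X1 Z1 (graph_of E).
Let AQ1 : Graph X1 Z1 := restrict_graph X1 Z1 B.

Lemma E_X1_injective (x y : X1) : E (embed x) = E (embed y) -> x = y.
Proof.
intros H; apply sub_eq; destruct X1_E_bound as [c [Hc Hb]].
apply (vec_eq_of_dist (W := X)); intros eps Heps.
change (norm (embed x -v embed y) < eps).
assert (Hxy : X1 (embed x -v embed y)) by apply (proj2_sig (x -v y)).
eapply Rle_lt_trans; [now apply Hb |].
rewrite op_minus, H.
replace (E (embed y) -v E (embed y)) with (vzero : Z) by vec.
rewrite norm_zero_vec; lra.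
Qed.

Let GX : Graph X1 X1 := comp_graph (inv_graph E1) AQ1.
Let GZ : Graph Z1 Z1 := comp_graph AQ1 (inv_graph E1).

(** The intermediate value in Z1 comes for free, since E maps X1 into Z1. *)
Lemma GX_iff (x y : X1) : GX x y <-> B (embed x) (E (embed y)).
Proof.
split.
- intros [z [H1 H2]]; unfold AQ1, E1, inv_graph, restrict_graph, graph_of in *.
  now rewrite H2.
- intros H; exists (exist _ (E (embed y)) (E_X1 _ (proj2_sig y))); now split.
Qed.

Lemma GX_linear : linear_operator GX.
Proof.
split.
- intros x y y'; rewrite !GX_iff; intros H1 H2; apply E_X1_injective.
  exact (graph_fun graph_AQ_linear H1 H2).
- apply GX_iff; change (B vzero (E vzero)); rewrite op_zero; apply (graph_zero graph_AQ_linear).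
- intros x y x' y'; rewrite !GX_iff; intros H1 H2.
  change (B (embed x +v embed y) (E (embed x' +v embed y'))).
  rewrite op_plus; exact (graph_plus graph_AQ_linear H1 H2).
- intros k x y; rewrite !GX_iff; intros H.
  change (B (k *c embed x) (E (k *c embed y))).
  rewrite op_scal; exact (graph_scal graph_AQ_linear k H).
Qed.

Lemma GZ_linear : linear_operator GZ.
Proof.
split.
- intros z w w' [x [H1 H2]] [x' [H1' H2']].
  assert (x = x') as <-.
  { apply E_X1_injective; unfold inv_graph, E1, restrict_graph, graph_of in *; congruence. }
  apply sub_eq; exact (graph_fun graph_AQ_linear H2 H2').
- exists vzero; split.
  + exact (op_zero E).
  + exact (graph_zero graph_AQ_linear).
- intros z z' w w' [x [H1 H2]] [x' [H1' H2']]; exists (x +v x'); split.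
  + change (E (embed x +v embed x') = embed z +v embed z').
    rewrite op_plus; f_equal; [exact H1 | exact H1'].
  + exact (graph_plus graph_AQ_linear H2 H2').
- intros k z w [x [H1 H2]]; exists (k *c x); split.
  + change (E (k *c embed x) = k *c embed z); rewrite op_scal; f_equal; exact H1.
  + exact (graph_scal graph_AQ_linear k H2).
Qed.

Lemma GX_generates : generates_C0_semigroup GX /\
  forall k, generates_integrated_semigroup k GX.
Proof.
destruct right_iter_bound as [M [HM Hb]].
assert (Hinv : forall l, w0 < l -> forall x, X1 x -> X1 (Pr l x)) by (intros; now apply X1_right_res).
assert (Hdom : forall l (u v : X1), w0 < l -> embed v = Pr l (embed u) -> GX v (l *v v -v u)).
{ intros l u v Hl Hv; apply GX_iff.
  change (B (embed v) (E (l *v embed v -v embed u))).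
  rewrite op_minus, op_scal, Hv; exact (pres_graph E B w0 pencil_rho l _ Hl). }
assert (Hleft : forall l (x y : X1), w0 < l -> GX x y ->
  Pr l (l *v embed x -v embed y) = embed x).
{ intros l x y Hl H; apply GX_iff in H.
  change (pres E B l (E (l *v embed x -v embed y)) = embed x).
  rewrite op_minus, op_scal; exact (pres_inv E B w0 pencil_rho l _ _ Hl H). }
assert (Hdense : forall x eps, X1 x -> 0 < eps ->
  exists l u, w0 < l /\ X1 u /\ norm (Pr l u -v x) < eps).
{ intros x eps Hx Heps; destruct (right_limit x eps Hx Heps) as [L [HL H]].
  specialize (H L (Rle_refl _)).
  assert (Hit : forall m, X1 (Nat.iter m (Pr L) x)).
  { induction m as [|m IH]; [exact Hx |].
    rewrite Nat.iter_succ; apply X1_right_res; [lra | exact IH]. }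
  exists L, ((L - (w0 + 1)) ^ (q + 1) *v Nat.iter q (Pr L) x); split; [lra | split].
  (* The remaining factor of the power q + 1 is the resolvent that puts the approximant into the
     domain. *)
  - apply (subspace_scal (c := X1)), Hit.
  - rewrite op_scal, Nat.add_1_r; rewrite Nat.add_1_r, Nat.iter_succ in H; exact H. }
split.
- exact (subspace_generates_C0 X1 Pr w0 M GX w0_pos HM GX_linear Hinv Hdom Hleft
    (fun l n x => Hb l n x) Hdense).
- exact (subspace_generates_integrated X1 Pr w0 M GX w0_pos HM GX_linear Hinv Hdom Hleft
    (fun l n x => Hb l n x) Hdense).
Qed.

Lemma GZ_generates : generates_C0_semigroup GZ /\
  forall k, generates_integrated_semigroup k GZ.
Proof.
destruct left_iter_bound as [M [HM Hb]].
assert (Hinv : forall l, w0 < l -> forall z, Z1 z -> Z1 (Pl l z)) by (intros; now apply Z1_left_res).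
assert (Hdom : forall l (u v : Z1), w0 < l -> embed v = Pl l (embed u) -> GZ v (l *v v -v u)).
{ intros l u v Hl Hv.
  (* The preimage of [Pl l u] under E is [pres l u], which lies in X1. *)
  exists (exist _ (pres E B l (embed u)) (pres_Z1 l _ Hl (proj2_sig u))); split.
  - symmetry; exact Hv.
  - change (B (pres E B l (embed u)) (l *v embed v -v embed u)).
    rewrite Hv; exact (pres_graph E B w0 pencil_rho l _ Hl). }
assert (Hleft : forall l (x y : Z1), w0 < l -> GZ x y ->
  Pl l (l *v embed x -v embed y) = embed x).
{ intros l z w Hl [x [H1 H2]].
  change (E (pres E B l (l *v embed z -v embed w)) = embed z).
  change (E (embed x) = embed z) in H1; rewrite <- H1; f_equal.
  exact (pres_inv E B w0 pencil_rho l _ _ Hl H2). }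
assert (Hdense : forall x eps, Z1 x -> 0 < eps ->
  exists l u, w0 < l /\ Z1 u /\ norm (Pl l u -v x) < eps).
{ intros x eps Hx Heps; destruct (left_limit x eps Hx Heps) as [L [HL H]].
  specialize (H L (Rle_refl _)).
  assert (Hit : forall m, Z1 (Nat.iter m (Pl L) x)).
  { induction m as [|m IH]; [exact Hx |].
    rewrite Nat.iter_succ; apply Z1_left_res; [lra | exact IH]. }
  exists L, ((L - (w0 + 1)) ^ (q + 1) *v Nat.iter q (Pl L) x); split; [lra | split].
  - apply (subspace_scal (c := Z1)), Hit.
  - rewrite op_scal, Nat.add_1_r; rewrite Nat.add_1_r, Nat.iter_succ in H; exact H. }
split.
- exact (subspace_generates_C0 Z1 Pl w0 M GZ w0_pos HM GZ_linear Hinv Hdom Hleft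
    (fun l n x => Hb l n x) Hdense).
- exact (subspace_generates_integrated Z1 Pl w0 M GZ w0_pos HM GZ_linear Hinv Hdom Hleft
    (fun l n x => Hb l n x) Hdense).
Qed.

End Radial.

End PortHamiltonian.

Theorem theorem5p3 (X Z : Hilbert) (E Q : BoundedOp X Z) (A : Graph Z Z)
  (hpH : pHDAE E A Q)
  (q : nat) (w0 : R) (hradial : radial E (graph_AQ A Q) q w0)
  (w : R) (hw : 0 < w)
  (hrho : forall l : C, w <= Re l -> rho E (graph_AQ A Q) l)
  (lam : nat -> R) (hlam : forall k, (k <= q)%nat -> w0 < lam k) :
  let X1 := space_X1 E (graph_AQ A Q) lam q in
  let Z1 := space_Z1 E (graph_AQ A Q) lam q in
  let E1 : Graph X1 Z1 := restrict_graph X1 Z1 (graph_of E) in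
  let AQ1 : Graph X1 Z1 := restrict_graph X1 Z1 (graph_AQ A Q) in
  let AQ1_E1inv : Graph Z1 Z1 := comp_graph AQ1 (inv_graph E1) in
  let E1inv_AQ1 : Graph X1 X1 := comp_graph (inv_graph E1) AQ1 in
  (forall p : nat, is_complex_resolvent_index E (graph_AQ A Q) p ->
     generates_integrated_semigroup (W := Z1) (p + 2) AQ1_E1inv /\
     generates_integrated_semigroup (W := X1) (p + 2) E1inv_AQ1) /\
  ((forall x : X, X1 x <-> exists z : Z, Z1 z /\ adjoint Q z = x) ->
     generates_C0_semigroup (W := X1) E1inv_AQ1) /\
  ((forall z : Z, Z1 z <-> exists x : X, X1 x /\ Q x = z) ->
     generates_C0_semigroup (W := Z1) AQ1_E1inv).
Proof.
intros X1 Z1 E1 AQ1 GZ GX.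
destruct hradial as [Hw0 [Hrho [K [HK Hb]]]].
destruct (GX_generates E Q A hpH q w0 K lam Hw0 Hrho HK Hb hlam) as [HX0 HX].
destruct (GZ_generates E Q A hpH q w0 K lam Hw0 Hrho HK Hb hlam) as [HZ0 HZ].
split; [| split].
- intros p _; split; [apply HZ | apply HX].
- intros _; exact HX0.
- intros _; exact HZ0.
Qed.
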